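(* Let $\mathcal{A}$ be a geometric base ring, $f : X \to S$ a morphism of $\mathcal{A}$-analytic spaces, $x \in X$ and $s = f(x)$. If $f$ is unramified at $x$, then $x$ is an isolated point of the fibre $X_s$. Moreover, $f : X \to S$ is finite at $x$.
   Context: AFFINE SPACES. Rings are commutative with unit. Let $(\mathcal{A},\|\cdot\|_{\mathcal{A}})$ be a Banach ring (a normed ring complete for its norm). $\mathbb{A}^n_{\mathcal{A}}$ is the set of maps $|\cdot|:\mathcal{A}[T_1,\dots,T_n]\to\mathbb{R}_+$ with $|0|=0$, $|1|=1$, $|P+Q|\le|P|+|Q|$, $|PQ|=|P||Q|$ and $|a|\le\|a\|_{\mathcal{A}}$ for $a\in\mathcal{A}$, with the coarsest topology making all maps $|\cdot|\mapsto|P|$ continuous; $\mathcal{M}(\mathcal{A})=\mathbb{A}^0_{\mathcal{A}}$. A point $x$ corresponds to a seminorm $|\cdot|_x$; $\mathcal{H}(x)$ is the completion of $\mathrm{Frac}(\mathcal{A}[T_1,\dots,T_n]/\ker|\cdot|_x)$ and $g(x)\in\mathcal{H}(x)$ is the image of $g$. For compact $V\subset\mathbb{A}^n_{\mathcal{A}}$, $\mathcal{K}(V)$ is the localization of $\mathcal{A}[T_1,\dots,T_n]$ at the elements vanishing at no point of $V$, with the uniform seminorm $\|\cdot\|_V$ (maximum over $V$), and $\mathcal{B}(V)$ is its separated completion. For open $U$, $\mathcal{O}(U)$ is the set of $g:U\to\bigsqcup_{x\in U}\mathcal{H}(x)$ with $g(x)\in\mathcal{H}(x)$ such that each $x\in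 U$ has a compact neighbourhood $V\subset U$ on which $g$ is a uniform limit of elements of $\mathcal{K}(V)$. This makes $\mathbb{A}^n_{\mathcal{A}}$ a locally ringed space. ANALYTIC SPACES. For a point $x$, $\mathfrak{m}_x$ is the maximal ideal of the local ring $\mathcal{O}_x$ and $\kappa(x)=\mathcal{O}_x/\mathfrak{m}_x$ (a valued field, whose completion is $\mathcal{H}(x)$). A morphism between open subsets of affine spaces is a morphism $f$ of locally ringed spaces over $\mathcal{A}$ such that each $\kappa(f(x))\to\kappa(x)$ is isometric. A closed analytic subset of an open $U\subset\mathbb{A}^n_{\mathcal{A}}$ is $(\mathrm{Supp}(\mathcal{O}_U/\mathcal{I}),\iota^{-1}(\mathcal{O}_U/\mathcal{I}))$ with $\mathcal{I}\subset\mathcal{O}_U$ a coherent ideal sheaf and $\iota$ the inclusion. Such spaces are the local models; their morphisms are those locally induced by morphisms between open subsets of affine spaces; $\mathcal{A}$-analytic spaces and their morphisms are obtained by gluing. GEOMETRIC BASE RINGS. A compact $V\subset\mathbb{A}^n_{\mathcal{A}}$ is spectrally convex if the natural map $\mathcal{M}(\mathcal{B}(V))\to\mathbb{A}^n_{\mathcal{A}}$ is a homeomorphism onto $V$ and an isomorphism of locally ringed spaces over the interior $\mathring V$. A fundamental system of neighbourhoods $\mathcal{V}_x$ of $x$ is fine if it contains a fundamental system of neighbourhoods of each of its elements. For $\mathcal{V}_x$ a fine fundamental system of compact spectrally convex neighbourhoods of $x$, $\mathcal{O}_x$ is strongly regular of dimension $n$ relative to $\mathcal{V}_x$ if it is noetherian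 of dimension $n$ and there are $f_1,\dots,f_n\in\mathfrak{m}_x$ such that: each $f_i$ lies in the image of $\mathcal{B}(V)\to\mathcal{O}_x$ for all $V\in\mathcal{V}_x$; and for every compact neighbourhood $U$ of $x$ there are constants $C_V>0$ ($V\in\mathcal{V}_x$) such that for every $f\in\mathfrak{m}_x$ in the image of $\mathcal{B}(U)$ and every $V\in\mathcal{V}_x$ with $V\subset\mathring U$ there are $a_1,\dots,a_n\in\mathcal{B}(V)$ with $\|a_i\|_V\le C_V\|f\|_U$ and $f=\sum a_if_i$. $\mathcal{A}$ is a geometric base ring if $\mathcal{M}(\mathcal{A})$ satisfies analytic continuation (for each $x$ and each nonzero $f\in\mathcal{O}_x$, there is an open neighbourhood $U$ of $x$ such that $f$ has nonzero image in $\mathcal{O}_t$ for all $t\in U$) and each $x\in\mathcal{M}(\mathcal{A})$ has a (fine) fundamental system $\mathcal{V}_x$ of (compact, spectrally convex) neighbourhoods with connected interior such that $\mathcal{O}_x$ is strongly regular of dimension $\le1$ relative to $\mathcal{V}_x$ and, if $\mathcal{H}(x)$ is trivially valued of positive characteristic, then for every $V\in\mathcal{V}_x$ there is a finite closed $\Gamma\subset V$ with $\|f\|_\Gamma=\|f\|_V$ for all $f\in\mathcal{B}(V)$, and all points of $V$ are ultrametric seminorms. (Examples: complete valued fields, rings of integers of number fields, discrete valuation rings.) Over such a ring, analytic spaces have coherent structure sheaf, noetherian local rings, and finite fibre products. MORPHISMS. Let $f:X\to S$ be a morphism, $x\in X$, $s=f(x)$. $X_s=f^{-1}(s)$ is the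 fibre, with the topology induced from $X$. $f$ is unramified at $x$ if $\mathfrak{m}_x=\mathfrak{m}_s\mathcal{O}_x$ and $\kappa(x)$ is a finite separable extension of $\kappa(s)$. A morphism is finite if it is a closed map with finite fibres; $f$ is finite at $x$ if there are open neighbourhoods $U$ of $x$ and $V$ of $s$ with $f(U)\subset V$ such that the induced morphism $U\to V$ is finite. *)

(* Defs.v *)
From HB Require Import structures.
From mathcomp Require Import all_boot all_order all_algebra all_field.
From mathcomp Require mpoly.

(** The notations of [mpoly] clash with those of the analysis library, hence
    the local import. *)
Module PolyRing.
Import mpoly.
Definition poly_ring (A : comNzRingType) (n : nat) : comPzRingType := {mpoly A[n]}.
Definition poly_const (A : comNzRingType) (n : nat) (a : A) : poly_ring A n :=
  mpolyC n a.
End PolyRing.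
Import PolyRing.

From mathcomp Require Import all_classical all_reals all_analysis.
From mathcomp Require Import generic_quotient ring.
Import Order.TTheory GRing.Theory Num.Theory.
Import numFieldNormedType.Exports.

Set Implicit Arguments.
Unset Strict Implicit.
Unset Printing Implicit Defensive.

Local Open Scope classical_set_scope.
Local Open Scope quotient_scope.
Local Open Scope ring_scope.

(** [comPzRingType] is used throughout because the zero ring occurs, for
    instance as [B(V)] for empty [V]. *)

Definition pi_ring (T : Type) (F : T -> comPzRingType) := forall x, F x.

Section PiRing.
Variables (T : Type) (F : T -> comPzRingType).
Notation piF := (pi_ring F).
HB.instance Definition _ := gen_eqMixin piF.
HB.instance Definition _ := gen_choiceMixin piF.

Fact pi_addA : associative (fun f g : piF => (fun x => f x + g x) : piF).
Proof. by move=> f g h; apply: functional_extensionality_dep => x; rewrite addrA. Qed.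
Fact pi_addC : commutative (fun f g : piF => (fun x => f x + g x) : piF).
Proof. by move=> f g; apply: functional_extensionality_dep => x; rewrite addrC. Qed.
Fact pi_add0 :
  left_id ((fun=> 0) : piF) (fun f g : piF => (fun x => f x + g x) : piF).
Proof. by move=> f; apply: functional_extensionality_dep => x; rewrite add0r. Qed.
Fact pi_addN : left_inverse ((fun=> 0) : piF) (fun f : piF => (fun x => - f x) : piF)
  (fun f g : piF => (fun x => f x + g x) : piF).
Proof. by move=> f; apply: functional_extensionality_dep => x; rewrite addNr. Qed.
HB.instance Definition _ :=
  GRing.isZmodule.Build piF pi_addA pi_addC pi_add0 pi_addN.

Fact pi_mulA : associative (fun f g : piF => (fun x => f x * g x) : piF).
Proof. by move=> f g h; apply: functional_extensionality_dep => x; rewrite mulrA. Qed.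
Fact pi_mulC : commutative (fun f g : piF => (fun x => f x * g x) : piF).
Proof. by move=> f g; apply: functional_extensionality_dep => x; rewrite mulrC. Qed.
Fact pi_mul1 :
  left_id ((fun=> 1) : piF) (fun f g : piF => (fun x => f x * g x) : piF).
Proof. by move=> f; apply: functional_extensionality_dep => x; rewrite mul1r. Qed.
Fact pi_mulDl : left_distributive (fun f g : piF => (fun x => f x * g x) : piF)
  (@GRing.add piF).
Proof. by move=> f g h; apply: functional_extensionality_dep => x; exact: mulrDl. Qed.
HB.instance Definition _ :=
  GRing.Zmodule_isComPzRing.Build piF pi_mulA pi_mulC pi_mul1 pi_mulDl.
End PiRing.

Definition is_subring (R : comPzRingType) (M : set R) :=
  [/\ M 1, forall a b, M a -> M b -> M (a - b) &
      forall a b, M a -> M b -> M (a * b)].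

(** [subring S] is the subring generated by [S]; it is only used for sets [S]
    that are already subrings, generation makes the definition total. *)
Section SubRing.
Variables (R : comPzRingType) (S : set R).

Definition subring_pred : pred R := fun a => `[< smallest (@is_subring R) S a >].

Fact subring_closed : GRing.subring_closed subring_pred.
Proof.
split=> [|a b /asboolP ha /asboolP hb|a b /asboolP ha /asboolP hb]; apply/asboolP.
- by move=> M [[]].
- by move=> M hM; case: (hM) => -[_ hB _] _; apply: hB; [exact: ha|exact: hb].
- by move=> M hM; case: (hM) => -[_ _ hB] _; apply: hB; [exact: ha|exact: hb].
Qed.
HB.instance Definition _ := GRing.isSubringClosed.Build R subring_pred subring_closed.

Record subring := SubRing { sr_val : R; _ : subring_pred sr_val }.
HB.instance Definition _ := [isSub for sr_val].
HB.instance Definition _ := [Choice of subring by <:].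
HB.instance Definition _ :=
  GRing.SubChoice_isSubComPzRing.Build R subring_pred subring subring_closed.

Definition sr_in (a : R) : subring := insubd (0 : subring) a.
End SubRing.

Definition is_ideal (R : comPzRingType) (J : set R) :=
  [/\ J 0, forall a b, J a -> J b -> J (a + b) & forall r a, J a -> J (r * a)].

Definition ideal_gen (R : comPzRingType) (I : set R) : set R :=
  smallest (@is_ideal R) I.

Lemma ideal_gen_ideal (R : comPzRingType) (I : set R) : is_ideal (ideal_gen I).
Proof.
split=> [M [[]]//|a b ha hb M hM|r a ha M hM].
- by case: (hM) => -[_ h _] _; apply: h; [exact: ha|exact: hb].
- by case: (hM) => -[_ _ h] _; apply: h; exact: ha.
Qed.

(** [quot I] is the quotient of [R] by the ideal generated by [I]; as above, [I]
    is an ideal wherever this is used. *)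
Section Quotient.
Variables (R : comPzRingType) (I : set R).

Definition quot_rel (a b : R) : bool := `[< ideal_gen I (a - b) >].

Let J0 : ideal_gen I 0. Proof. by case: (ideal_gen_ideal I). Qed.
Let JD a b : ideal_gen I a -> ideal_gen I b -> ideal_gen I (a + b).
Proof. by case: (ideal_gen_ideal I) => _ h _; exact: h. Qed.
Let JM r a : ideal_gen I a -> ideal_gen I (r * a).
Proof. by case: (ideal_gen_ideal I) => _ _ h; exact: h. Qed.

Fact quot_refl : reflexive quot_rel.
Proof. by move=> a; apply/asboolP; rewrite subrr. Qed.
Fact quot_sym : symmetric quot_rel.
Proof.
have h a b : quot_rel a b -> quot_rel b a.
  move=> /asboolP h; apply/asboolP.
  by rewrite -opprB -mulN1r; exact: JM.
by move=> a b; apply/idP/idP; exact: h.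
Qed.
Fact quot_trans : transitive quot_rel.
Proof.
move=> b a c /asboolP h /asboolP h'; apply/asboolP.
by rewrite -(subrK b a) -addrA; exact: JD.
Qed.
Canonical quot_equiv := EquivRel quot_rel quot_refl quot_sym quot_trans.
Definition quot : Type := {eq_quot quot_equiv}.
HB.instance Definition _ := Choice.on quot.
HB.instance Definition _ := EqQuotient.on quot.

Definition qpi (a : R) : quot := \pi_quot a.
Definition qrep (x : quot) : R := repr x.

Lemma qrepK x : qpi (qrep x) = x. Proof. exact: reprK. Qed.
Lemma qpiE a b : ideal_gen I (a - b) -> qpi a = qpi b.
Proof. by move=> h; apply/eqP; rewrite /qpi eqmodE; apply/asboolP. Qed.
Lemma qpiP a : ideal_gen I (qrep (qpi a) - a).
Proof. by apply/asboolP; have /eqP := qrepK (qpi a); rewrite {1}/qpi eqmodE. Qed.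

Let add x y := qpi (qrep x + qrep y).
Let opp x := qpi (- qrep x).
Let mul x y := qpi (qrep x * qrep y).
Let addE a b : add (qpi a) (qpi b) = qpi (a + b).
Proof.
apply: qpiE; have -> (u v : R) : u + v - (a + b) = (u - a) + (v - b) by ring.
by apply: JD; exact: qpiP.
Qed.
Let oppE a : opp (qpi a) = qpi (- a).
Proof.
apply: qpiE; have -> (u : R) : - u - - a = (-1) * (u - a) by ring.
by apply: JM; exact: qpiP.
Qed.
Let mulE a b : mul (qpi a) (qpi b) = qpi (a * b).
Proof.
apply: qpiE.
have -> (u v : R) : u * v - a * b = u * (v - b) + b * (u - a) by ring.
by apply: JD; apply: JM; exact: qpiP.
Qed.
Fact quot_addA : associative add.
Proof. by move=> x y z; rewrite -(qrepK x) -(qrepK y) -(qrepK z) !addE addrA. Qed.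
Fact quot_addC : commutative add.
Proof. by move=> x y; rewrite -(qrepK x) -(qrepK y) !addE addrC. Qed.
Fact quot_add0 : left_id (qpi 0) add.
Proof. by move=> x; rewrite -(qrepK x) !addE add0r. Qed.
Fact quot_addN : left_inverse (qpi 0) opp add.
Proof. by move=> x; rewrite -(qrepK x) oppE addE addNr. Qed.
HB.instance Definition _ :=
  GRing.isZmodule.Build quot quot_addA quot_addC quot_add0 quot_addN.
Fact quot_mulA : associative mul.
Proof. by move=> x y z; rewrite -(qrepK x) -(qrepK y) -(qrepK z) !mulE mulrA. Qed.
Fact quot_mulC : commutative mul.
Proof. by move=> x y; rewrite -(qrepK x) -(qrepK y) !mulE mulrC. Qed.
Fact quot_mul1 : left_id (qpi 1) mul.
Proof. by move=> x; rewrite -(qrepK x) !mulE mul1r. Qed.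
Fact quot_mulDl : left_distributive mul +%R.
Proof.
move=> x y z; rewrite -(qrepK x) -(qrepK y) -(qrepK z).
by rewrite [_ + _]addE !mulE [RHS]addE mulrDl.
Qed.
HB.instance Definition _ :=
  GRing.Zmodule_isComPzRing.Build quot quot_mulA quot_mulC quot_mul1 quot_mulDl.
End Quotient.

(** [loc S] is the localization of [R] at the multiplicative set generated by
    [S]. *)
Section Localization.
Variables (R : comPzRingType) (S : set R).

Definition is_submonoid (M : set R) := M 1 /\ forall a b, M a -> M b -> M (a * b).
Definition mult_gen : set R := smallest is_submonoid S.

Let M1 : mult_gen 1. Proof. by move=> M [[]]. Qed.
Let MM a b : mult_gen a -> mult_gen b -> mult_gen (a * b).
Proof. by move=> ha hb M hM; case: (hM) => -[_ h] _; apply: h; [exact: ha|exact: hb]. Qed.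

Definition loc_pair := {x : R * R | `[< mult_gen x.2 >]}.
Definition loc_rel (x y : loc_pair) : bool :=
  `[< exists2 t, mult_gen t &
        t * ((val x).1 * (val y).2 - (val y).1 * (val x).2) = 0 >].

Fact loc_refl : reflexive loc_rel.
Proof. by move=> x; apply/asboolP; exists 1 => //; ring. Qed.
Fact loc_sym : symmetric loc_rel.
Proof.
have h x y : loc_rel x y -> loc_rel y x.
  by move=> /asboolP[t ht e]; apply/asboolP; exists t => //; rewrite -opprB mulrN e oppr0.
by move=> x y; apply/idP/idP; exact: h.
Qed.
Fact loc_trans : transitive loc_rel.
Proof.
move=> [[b b'] hb] [[a a'] ha] [[c c'] hc] /asboolP[/= t ht e] /asboolP[/= s hs e'].
apply/asboolP; exists (t * s * b') => /=.
  by apply: MM; [exact: MM|exact/asboolP].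
transitivity (s * c' * (t * (a * b' - b * a')) + t * a' * (s * (b * c' - c * b'))).
  by ring.
by rewrite e e' !mulr0 addr0.
Qed.
Canonical loc_equiv := EquivRel loc_rel loc_refl loc_sym loc_trans.
Definition loc : Type := {eq_quot loc_equiv}.
HB.instance Definition _ := Choice.on loc.
HB.instance Definition _ := EqQuotient.on loc.

Fact loc_pair0_subproof : `[< mult_gen (0 : R, 1 : R).2 >].
Proof. exact/asboolP. Qed.
Definition loc_pair0 : loc_pair := exist _ (0, 1) loc_pair0_subproof.

(** The fraction [a / b], for [b] in the multiplicative set, else 0. *)
Definition lfrac (a b : R) : loc := \pi_loc (insubd loc_pair0 (a, b)).
Definition lnum (x : loc) : R := (val (repr x)).1.
Definition lden (x : loc) : R := (val (repr x)).2.

Lemma ldenP x : mult_gen (lden x).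
Proof. by apply/asboolP; exact: (valP (repr x)). Qed.

Lemma lfracK x : lfrac (lnum x) (lden x) = x.
Proof.
rewrite /lfrac -{3}(reprK x); congr \pi_loc; apply: val_inj.
by rewrite val_insubd -surjective_pairing (valP (repr x)).
Qed.

Lemma lfracE a b c d t : mult_gen b -> mult_gen d -> mult_gen t ->
  t * (a * d - c * b) = 0 -> lfrac a b = lfrac c d.
Proof.
move=> hb hd ht e; apply/eqP; rewrite /lfrac eqmodE; apply/asboolP; exists t => //.
by rewrite !val_insubd !ifT //; apply/asboolP.
Qed.

Lemma lfracP a b : mult_gen b ->
  exists2 t, mult_gen t & t * (lnum (lfrac a b) * b - a * lden (lfrac a b)) = 0.
Proof.
move=> hb; have /eqP := reprK (lfrac a b).
rewrite {2}/lfrac eqmodE => /asboolP[t ht].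
by rewrite val_insubd ifT //=; [exists t|apply/asboolP].
Qed.

Let add x y := lfrac (lnum x * lden y + lnum y * lden x) (lden x * lden y).
Let opp x := lfrac (- lnum x) (lden x).
Let mul x y := lfrac (lnum x * lnum y) (lden x * lden y).
Let addE a b c d : mult_gen b -> mult_gen d ->
  add (lfrac a b) (lfrac c d) = lfrac (a * d + c * b) (b * d).
Proof.
move=> hb hd; rewrite /add.
have [t ht e1] := lfracP a hb; have [s hs e2] := lfracP c hd.
have [h1 h2] := (ldenP (lfrac a b), ldenP (lfrac c d)).
set a1 := lnum (lfrac a b) in e1 *; set b1 := lden (lfrac a b) in e1 h1 *.
set c1 := lnum (lfrac c d) in e2 *; set d1 := lden (lfrac c d) in e2 h2 *.
apply: (@lfracE _ _ _ _ (t * s)); try by do ?apply: MM.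
transitivity (s * d * d1 * (t * (a1 * b - a * b1)) + t * b * b1 * (s * (c1 * d - c * d1))).
  by ring.
by rewrite e1 e2 !mulr0 addr0.
Qed.
Let oppE a b : mult_gen b -> opp (lfrac a b) = lfrac (- a) b.
Proof.
move=> hb; rewrite /opp; have [t ht e] := lfracP a hb.
apply: (lfracE (t := t)) => //; first exact: ldenP.
by rewrite !mulNr -opprD mulrN e oppr0.
Qed.
Let mulE a b c d : mult_gen b -> mult_gen d ->
  mul (lfrac a b) (lfrac c d) = lfrac (a * c) (b * d).
Proof.
move=> hb hd; rewrite /mul.
have [t ht e1] := lfracP a hb; have [s hs e2] := lfracP c hd.
have [h1 h2] := (ldenP (lfrac a b), ldenP (lfrac c d)).
set a1 := lnum (lfrac a b) in e1 *; set b1 := lden (lfrac a b) in e1 h1 *.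
set c1 := lnum (lfrac c d) in e2 *; set d1 := lden (lfrac c d) in e2 h2 *.
apply: (@lfracE _ _ _ _ (t * s)); try by do ?apply: MM.
transitivity (s * c1 * d * (t * (a1 * b - a * b1)) + t * a * b1 * (s * (c1 * d - c * d1))).
  by ring.
by rewrite e1 e2 !mulr0 addr0.
Qed.
Let H x := ldenP x.
Let eqf a b c d : mult_gen b -> mult_gen d -> a * d = c * b -> lfrac a b = lfrac c d.
Proof. by move=> hb hd e; apply: (@lfracE _ _ _ _ 1) => //; rewrite e subrr mulr0. Qed.

Fact loc_addA : associative add.
Proof.
move=> x y z; rewrite -(lfracK x) -(lfracK y) -(lfracK z) !addE //; try exact: MM.
by apply: eqf; try (by do ?apply: MM); ring.
Qed.
Fact loc_addC : commutative add.
Proof.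
move=> x y; rewrite -(lfracK x) -(lfracK y) !addE //.
by apply: eqf; try (by do ?apply: MM); ring.
Qed.
Fact loc_add0 : left_id (lfrac 0 1) add.
Proof.
move=> x; rewrite -(lfracK x) !addE //.
by apply: eqf; try (by do ?apply: MM); ring.
Qed.
Fact loc_addN : left_inverse (lfrac 0 1) opp add.
Proof.
move=> x; rewrite -(lfracK x) oppE // !addE //.
by apply: eqf; try (by do ?apply: MM); ring.
Qed.
HB.instance Definition _ :=
  GRing.isZmodule.Build loc loc_addA loc_addC loc_add0 loc_addN.
Fact loc_mulA : associative mul.
Proof.
move=> x y z; rewrite -(lfracK x) -(lfracK y) -(lfracK z) !mulE //; try exact: MM.
by apply: eqf; try (by do ?apply: MM); ring.
Qed.
Fact loc_mulC : commutative mul.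
Proof.
move=> x y; rewrite -(lfracK x) -(lfracK y) !mulE //.
by apply: eqf; try (by do ?apply: MM); ring.
Qed.
Fact loc_mul1 : left_id (lfrac 1 1) mul.
Proof.
move=> x; rewrite -(lfracK x) !mulE //.
by apply: eqf; try (by do ?apply: MM); ring.
Qed.
Fact loc_mulDl : left_distributive mul +%R.
Proof.
move=> x y z; rewrite -(lfracK x) -(lfracK y) -(lfracK z).
rewrite [_ + _]addE // !mulE //; try exact: MM.
rewrite [RHS]addE; try exact: MM.
by apply: eqf; try (by do ?apply: MM); ring.
Qed.
HB.instance Definition _ :=
  GRing.Zmodule_isComPzRing.Build loc loc_mulA loc_mulC loc_mul1 loc_mulDl.
End Localization.

Section CommutativeAlgebra.
Variable R : comPzRingType.

(** The maximal ideal, when [R] is local. *)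
Definition maxid : set R := [set a | ~ exists b, a * b = 1].

Definition is_local := is_ideal maxid.

Definition is_prime_ideal (P : set R) :=
  [/\ is_ideal P, ~ P 1 & forall a b, P (a * b) -> P a \/ P b].

Definition prime_chain (n : nat) := exists P : 'I_n.+1 -> set R,
  (forall i, is_prime_ideal (P i)) /\
  (forall i j : 'I_n.+1, (i < j)%N -> P i `<` P j).

Definition has_krull_dim (n : nat) := prime_chain n /\ ~ prime_chain n.+1.

Definition is_noetherian :=
  forall J : set R, is_ideal J -> exists s : seq R, J = ideal_gen [set` s].
End CommutativeAlgebra.
Arguments maxid : clear implicits.
Arguments is_local : clear implicits.
Arguments has_krull_dim : clear implicits.
Arguments is_noetherian : clear implicits.

(** The norm is bare data; [is_banach] gives the axioms. It is also used for
    seminorms. *)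
Record nring (R : realType) := NRing {
  nr_ring :> comPzRingType;
  nr_norm : nr_ring -> R }.

Section Completion.
Variables (R : realType) (K : nring R).
Local Notation norm := (@nr_norm R K).

Definition seq_ring : comPzRingType := pi_ring (fun _ : nat => nr_ring K).

Definition ncauchy (u : nat -> K) := forall e : R, 0 < e ->
  exists N, forall m n, (N <= m)%N -> (N <= n)%N -> norm (u m - u n) < e.

Definition ncvg (u : nat -> K) (l : K) :=
  norm (u n - l) @[n --> \oo] --> (0 : R).

Definition is_banach :=
  [/\ (forall a, 0 <= norm a) /\ (forall a, norm a = 0 <-> a = 0),
      forall a b, norm (a + b) <= norm a + norm b,
      forall a, norm (- a) = norm a,
      forall a b, norm (a * b) <= norm a * norm b &
      forall u, ncauchy u -> exists l, ncvg u l].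

(** Separated completion: Cauchy sequences modulo null sequences. *)
Definition cpl_ring : comPzRingType :=
  quot [set u : subring [set u : seq_ring | ncauchy u] | ncvg (sr_val u) 0].

Definition cpl_lim (u : nat -> K) : cpl_ring := qpi _ (sr_in _ (u : seq_ring)).
Definition cpl_seq (b : cpl_ring) : nat -> K := sr_val (qrep b).

Definition cpl : nring R :=
  @NRing R cpl_ring (fun b => lim (norm (cpl_seq b n) @[n --> \oo])).
End Completion.

(** A sheaf of rings is presented by its etale space: the stalks, and the sets
    of dependent functions [x |-> s x] which are the families of germs of a
    section over [U]; the values of [s] outside [U] are irrelevant. *)
Record lrs := Lrs {
  lpt :> topologicalType;
  lst : lpt -> comPzRingType;
  lsec : set lpt -> set (forall x, lst x) }.

Definition is_lrs (X : lrs) :=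
  [/\ forall U, open U -> forall s, @lsec X U s <->
        forall x, U x -> exists W, [/\ open W, W x, W `<=` U &
          exists2 t, @lsec X W t & forall y, W y -> t y = s y],
      forall U, open U -> is_subring (lsec U : set (pi_ring (@lst X))),
      forall (x : X) (a : lst x), exists U, [/\ open U, U x &
        exists2 s, @lsec X U s & s x = a],
      forall U s (x : X), open U -> lsec U s -> U x -> s x = 0 ->
        \forall y \near x, s y = 0 &
      forall x : X, is_local (lst x)].

Record mor (X Y : lrs) := Mor {
  mp :> X -> Y;
  ms : forall x, lst (mp x) -> lst x }.

Definition is_mor (X Y : lrs) (f : mor X Y) :=
  [/\ continuous f,
      forall x, GRing.zmod_morphism (@ms _ _ f x) /\
                GRing.monoid_morphism (@ms _ _ f x),
      forall x a, maxid (lst (f x)) a -> maxid (lst x) (ms a) &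
      forall V t, open V -> @lsec Y V t ->
        lsec (f @^-1` V) (fun x => @ms _ _ f x (t (f x)))].

Definition mor_id (X : lrs) : mor X X := @Mor X X id (fun _ => id).

Definition mor_comp (X Y Z : lrs) (g : mor Y Z) (f : mor X Y) : mor X Z :=
  @Mor X Z (g \o f) (fun x => @ms _ _ f x \o @ms _ _ g (f x)).

(** The maps on stalks have types depending on the images of points; they are
    compared on arbitrary families of germs of the target. *)
Definition mor_eq (X Y : lrs) (f g : mor X Y) := forall x, f x = g x /\
  forall t : (forall y : Y, lst y), @ms _ _ f x (t (f x)) = @ms _ _ g x (t (g x)).

Definition is_iso (X Y : lrs) (f : mor X Y) :=
  is_mor f /\ exists g : mor Y X, [/\ is_mor g,
    mor_eq (mor_comp g f) (mor_id X) & mor_eq (mor_comp f g) (mor_id Y)].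

(** Open subspaces ([U] is meant to be open) and morphisms between them. *)
Definition open_sub (X : lrs) (U : set X) : lrs :=
  @Lrs (set_type U) (fun u => lst (val u)) (fun W t =>
    exists2 s, @lsec X (val @` W) s & forall u, W u -> t u = s (val u)).

Definition open_pt (X : lrs) (U : set X) (x : X) (h : x \in U) : open_sub U :=
  exist _ x h.

Definition mor_restr (X Y : lrs) (f : mor X Y) (U : set X) (V : set Y)
    (h : forall x, U x -> V (f x)) : mor (open_sub U) (open_sub V) :=
  @Mor (open_sub U) (open_sub V)
    (fun u => open_pt (mem_set (h _ (set_mem (valP u)))))
    (fun u => @ms _ _ f (val u)).

(** An ideal sheaf is given by its stalks. *)
Section IdealSheaf.
Variables (X : lrs) (I : forall x : X, set (lst x)).

Definition isec (U : set X) (s : forall x, lst x) :=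
  lsec U s /\ forall y, U y -> I (s y).

Definition is_ideal_sheaf :=
  (forall x, is_ideal (@I x)) /\
  forall x a, @I x a -> exists U, [/\ open U, U x & exists2 s, isec U s & s x = a].

Definition is_finite_type := forall x : X, exists U, [/\ open U, U x &
  exists k, exists f : 'I_k -> forall y, lst y,
    (forall i, isec U (f i)) /\
    forall y, U y -> @I y = ideal_gen [set f i y | i in [set: 'I_k]]].

(** The relations between finitely many sections are of finite type. *)
Definition is_finite_rel :=
  forall (W : set X) k (f : 'I_k -> forall y, lst y), open W ->
  (forall i, isec W (f i)) -> forall x, W x ->
  exists U, [/\ open U, U x, U `<=` W &
    exists m, exists r : 'I_m -> 'I_k -> forall y, lst y, [/\
      forall j i, lsec U (r j i),
      forall j y, U y -> \sum_i r j i y * f i y = 0 &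
      forall y (a : 'I_k -> lst y), U y -> \sum_i a i * f i y = 0 ->
        exists c : 'I_m -> lst y, forall i, a i = \sum_j c j * r j i y]].

Definition is_coherent_ideal := [/\ is_ideal_sheaf, is_finite_type & is_finite_rel].

(** The support of [O/I], with the sheaf [O/I]. *)
Definition closed_sub : lrs :=
  @Lrs (set_type [set x | ~ I (1 : lst x)]) (fun z => quot (@I (val z)))
    (fun W t => forall z, W z -> exists U, [/\ open U, U (val z) &
       exists2 s, @lsec X U s &
         forall z', W z' -> U (val z') -> t z' = qpi _ (s (val z'))]).
End IdealSheaf.

(** A ring [P] over a normed ring [A]. Two cases are used: [P] a polynomial
    ring over [A], and [P = A]. *)
Record balg (R : realType) := BAlg {
  ba_base : nring R;
  ba_ring : comPzRingType;
  ba_map : ba_base -> ba_ring }.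

Definition balg_id (R : realType) (A : nring R) : balg R := @BAlg R A A id.

Section Seminorms.
Variables (R : realType) (E : balg R).
Local Notation P := (ba_ring E).

Record bpt := BPt { sn :> P -> R;
  bptP : [/\ forall p, 0 <= sn p, sn 0 = 0 /\ sn 1 = 1,
             forall p q, sn (p + q) <= sn p + sn q,
             forall p q, sn (p * q) = sn p * sn q &
             forall a, sn (ba_map a) <= nr_norm a] }.

HB.instance Definition _ := gen_eqMixin bpt.
HB.instance Definition _ := gen_choiceMixin bpt.
(** The coarsest topology for which all [x |-> sn x p] are continuous. *)
HB.instance Definition _ := Topological.copy bpt
  (@initial_topology bpt (prod_topology (fun _ : P => R)) sn).

(** [Frac (P / ker x)] with its absolute value, and its completion [H(x)]. *)
Definition kring (x : bpt) : comPzRingType :=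
  loc [set a : quot [set p | sn x p = 0] | a <> 0].
Definition kfield (x : bpt) : nring R := @NRing R (kring x)
  (fun a => sn x (qrep (lnum a)) / sn x (qrep (lden a))).
Definition Hx (x : bpt) : nring R := cpl (kfield x).

(** The value of [p / q] at [x], junk if [q] vanishes at [x]. *)
Definition kval (x : bpt) (p q : P) : kfield x := lfrac _ (qpi _ p) (qpi _ q).
Definition hval (p q : P) (x : bpt) : Hx x := cpl_lim (fun=> kval x p q).

(** [K(V)] and its separated completion [B(V)]. *)
Definition KV (V : set bpt) : nring R :=
  @NRing R (loc [set q : P | forall x, V x -> sn x q <> 0])
    (fun k => sup [set sn x (lnum k) / sn x (lden k) | x in V]).
Definition BV (V : set bpt) : nring R := cpl (KV V).

Definition bval (V : set bpt) (b : BV V) (x : bpt) : Hx x :=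
  cpl_lim (fun n => kval x (lnum (cpl_seq b n)) (lden (cpl_seq b n))).

Definition fun_ring : comPzRingType := pi_ring (fun x : bpt => nr_ring (Hx x)).

(** [g] belongs to [O(U)]; its values outside [U] are irrelevant. *)
Definition is_regular (U : set bpt) (g : fun_ring) := forall x, U x ->
  exists V, [/\ compact V, nbhs x V, V `<=` U &
    forall e : R, 0 < e -> exists k : KV V, forall y, V y ->
      nr_norm (g y - hval (lnum k) (lden k) y) <= e].

(** Germs at [x]. The functions regular near [x] form a subring because the
    space is Hausdorff and, for the algebras considered, locally compact. *)
Definition stalk (x : bpt) : comPzRingType :=
  quot [set g : subring [set g : fun_ring |
                 exists U, [/\ open U, U x & is_regular U g]]
       | \forall y \near x, sr_val g y = 0].
Definition germ (x : bpt) (g : fun_ring) : stalk x := qpi _ (sr_in _ g).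
Definition gval (x : bpt) (a : stalk x) : Hx x := sr_val (qrep a) x.
Definition gabs (x : bpt) (a : stalk x) : R := nr_norm (gval a).

Definition bspace : lrs := @Lrs bpt stalk (fun U s =>
  exists2 g, is_regular U g & forall x, U x -> s x = germ x g).

Definition gstr (a : ba_base E) (x : bpt) : stalk x :=
  germ x (hval (ba_map a) 1 : fun_ring).

(** The image of [B(V)] in the stalk at an interior point of [V]. *)
Definition bgerm (V : set bpt) (b : BV V) (x : bpt) : stalk x :=
  germ x (bval b : fun_ring).
End Seminorms.

Section SpectrallyConvex.
Variables (R : realType) (E : balg R) (V : set (bpt E)).
Local Notation EB := (balg_id (BV V)).

Definition toB (p : ba_ring E) : ba_ring EB := cpl_lim (fun=> lfrac _ p 1 : KV V).

(** [N] is the map sending a seminorm on [B(V)] to its composite with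
    [P -> B(V)]. *)
Definition is_natural (N : bpt EB -> bpt E) :=
  forall z p, sn (N z) p = sn z (toB p).

Variable N : bpt EB -> bpt E.

(** [H(N z) -> H(z)], and composition of functions with it. *)
Definition natH (z : bpt EB) (h : Hx (N z)) : Hx z :=
  cpl_lim (fun n => kval z (toB (qrep (lnum (cpl_seq h n))))
                           (toB (qrep (lden (cpl_seq h n))))).
Definition nat_mor : mor (bspace EB) (bspace E) :=
  @Mor (bspace EB) (bspace E) N (fun z a =>
    germ z ((fun z' => natH (sr_val (qrep a) (N z'))) : fun_ring EB)).

Definition is_homeo_onto :=
  [/\ continuous N, injective N, range N = V &
      forall W, open W -> exists2 W', open W' & N @` W = W' `&` V].

Definition is_iso_over (U : set (bpt E)) :=
  is_iso (@mor_restr _ _ nat_mor (N @^-1` U) U (fun _ => id)).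
End SpectrallyConvex.

Definition spectrally_convex (R : realType) (E : balg R) (V : set (bpt E)) :=
  compact V /\ exists N : bpt (balg_id (BV V)) -> bpt E,
    [/\ is_natural N, is_homeo_onto N & is_iso_over N V°].

Section Geometric.
Variables (R : realType) (E : balg R).
Implicit Types (x : bpt E) (V U W : set (bpt E)) (VV : set (set (bpt E))).

Definition is_fundamental x VV :=
  (forall V, VV V -> nbhs x V) /\
  forall W, nbhs x W -> exists2 V, VV V & V `<=` W.

Definition is_fine x VV := is_fundamental x VV /\
  forall V W, VV V -> V `<=` W° ->
    exists V', [/\ VV V', V `<=` V'° & V' `<=` W].

Definition strongly_regular x VV (n : nat) :=
  [/\ is_noetherian (stalk x), has_krull_dim (stalk x) n &
   exists f : 'I_n -> stalk x, [/\
     forall i, maxid (stalk x) (f i),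
     forall i V, VV V -> exists b : BV V, bgerm b x = f i &
     forall U, compact U -> nbhs x U ->
       exists2 C : set (bpt E) -> R, (forall V, VV V -> 0 < C V) &
       forall b : BV U, maxid (stalk x) (bgerm b x) ->
       forall V, VV V -> V `<=` U° ->
       exists a : 'I_n -> BV V,
         (forall i, nr_norm (a i) <= C V * nr_norm b) /\
         bgerm b x = \sum_i bgerm (a i) x * f i]].

Definition analytic_continuation :=
  forall x (f : stalk x), f <> 0 -> exists U, [/\ open U, U x &
    exists s, [/\ @lsec (bspace E) U s, s x = f & forall t, U t -> s t <> 0]].

Definition trivially_valued_pos_char x :=
  (forall h : Hx x, h <> 0 -> nr_norm h = 1) /\
  exists2 p : nat, prime p & p%:R = 0 :> Hx x.

Definition ultrametric x :=
  forall p q, sn x (p + q) <= Num.max (sn x p) (sn x q).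

Definition finite_boundary V := exists G : set (bpt E),
  [/\ finite_set G, closed G, G `<=` V &
      forall b : BV V, sup [set nr_norm (bval b y) | y in G] = nr_norm b].

Definition geometric_at x := exists VV, [/\ is_fine x VV,
  forall V, VV V -> spectrally_convex V /\ connected V°,
  exists2 n, (n <= 1)%N & strongly_regular x VV n &
  trivially_valued_pos_char x -> forall V, VV V ->
    finite_boundary V /\ forall y, V y -> ultrametric y].
End Geometric.

Definition geometric_base_ring (R : realType) (A : nring R) :=
  [/\ is_banach A, analytic_continuation (balg_id A) &
      forall x : bpt (balg_id A), geometric_at x].

Section Analytic.
Variables (R : realType) (A : comNzRingType) (nA : A -> R).

Definition aff_alg (n : nat) : balg R :=
  @BAlg R (@NRing R A nA) (poly_ring A n) (@poly_const A n).
Definition aff (n : nat) : lrs := bspace (aff_alg n).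
Definition aff_str (n : nat) (v : aff n) (a : A) : lst v := @gstr R (aff_alg n) a v.
Definition aff_abs (n : nat) (v : aff n) (g : lst v) : R := @gabs R (aff_alg n) v g.

(** Morphisms from an open subset [W] of an affine space to an affine space.
    The absolute value of [kappa(x)] is
    induced by [aff_abs]. *)
Definition is_aff_mor n m (W : set (aff n)) (F : mor (open_sub W) (aff m)) :=
  [/\ is_mor F,
      forall w a, @ms _ _ F w (aff_str (F w) a) = aff_str (val w) a &
      forall w (g : lst (F w)), aff_abs (@ms _ _ F w g : lst (val w)) = aff_abs g].

Record model := Model {
  md_n : nat;
  md_U : set (aff md_n);
  md_open : open md_U;
  md_I : forall u : open_sub md_U, set (lst u);
  md_coh : is_coherent_ideal md_I }.

Definition md_lrs (M : model) : lrs := closed_sub (@md_I M).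

Definition md_emb (M : model) : mor (md_lrs M) (aff (md_n M)) :=
  @Mor (md_lrs M) (aff (md_n M)) (fun z => val (val z)) (fun z a => qpi _ a).

Section Charts.
Variables (X : lrs) (str : forall x : X, A -> lst x).

Record chart := Chart {
  ch_dom : set X;
  ch_open : open ch_dom;
  ch_model : model;
  ch_map : mor (open_sub ch_dom) (md_lrs ch_model);
  ch_iso : is_iso ch_map;
  ch_str : forall (y : open_sub ch_dom) a,
    @ms _ _ ch_map y
      (qpi _ (aff_str (val (val (ch_map y))) a))
    = str (val y) a }.

Definition ch_emb (c : chart) : mor (open_sub (ch_dom c)) (aff (md_n (ch_model c))) :=
  mor_comp (md_emb (ch_model c)) (@ch_map c).
End Charts.

(** In the charts [c] and [d], near [x], the morphism [f] is induced by a
    morphism between open subsets of affine spaces. *)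
Definition loc_induced (X S : lrs) sX sS (f : mor X S)
    (c : @chart X sX) (d : @chart S sS) (x : X) :=
  exists (W : set (aff (md_n (ch_model c))))
         (F : mor (open_sub W) (aff (md_n (ch_model d)))),
    [/\ open W, is_aff_mor F,
        exists h : x \in ch_dom c, W (ch_emb c (open_pt h)) &
        forall y (hc : y \in ch_dom c) (hd : f y \in ch_dom d)
               (hw : ch_emb c (open_pt hc) \in W),
          let y' := open_pt hc in
          let z' := open_pt hd in
          let w := open_pt hw in
          F w = ch_emb d z' /\
          forall t : (forall v : aff (md_n (ch_model d)), lst v),
            @ms _ _ (ch_emb c) y' (@ms _ _ F w (t (F w))) =
            @ms _ _ f y (@ms _ _ (ch_emb d) z' (t (ch_emb d z')))].

Record analytic_space := AnalyticSpace {
  as_lrs :> lrs;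
  as_lrsP : is_lrs as_lrs;
  as_str : forall x : as_lrs, A -> lst x;
  as_atlas : set (chart as_str);
  as_cover : forall x, exists2 c, as_atlas c & ch_dom c x;
  as_compat : forall c d, as_atlas c -> as_atlas d ->
    forall x, ch_dom c x -> ch_dom d x -> loc_induced (mor_id as_lrs) c d x }.

Definition is_analytic_mor (X S : analytic_space) (f : mor X S) :=
  [/\ is_mor f,
      forall x a, @ms _ _ f x (@as_str S (f x) a) = @as_str X x a &
      forall c d, @as_atlas X c -> @as_atlas S d ->
        forall x, ch_dom c x -> ch_dom d (f x) -> loc_induced f c d x].
End Analytic.

(** The conditions on [kappa(x)] over [kappa(f x)] are stated through isomorphisms
    with a field [k] and an extension [K] of [k] carrying the library's structures;
    a [fieldExtType] is finite-dimensional over its base. *)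
Definition kappa (X : lrs) (x : X) : comPzRingType := quot (maxid (lst x)).

Definition is_unramified (X S : lrs) (f : mor X S) (x : X) :=
  maxid (lst x) = ideal_gen (@ms _ _ f x @` maxid (lst (f x))) /\
  exists (k : fieldType) (K : fieldExtType k)
         (i : {rmorphism kappa (f x) -> k}) (j : {rmorphism kappa x -> K}),
    [/\ bijective i, bijective j,
        forall a, j (qpi _ (@ms _ _ f x a)) = (i (qpi _ a))%:A &
        separable 1 {:K}].

Definition fibre (X S : lrs) (f : mor X S) (s : S) : set X := f @^-1` [set s].

Definition is_finite_mor (X S : lrs) (f : mor X S) :=
  (forall F : set X, closed F -> closed (f @` F)) /\
  forall s : S, finite_set (fibre f s).

Definition is_finite_at (X S : lrs) (f : mor X S) (x : X) :=
  exists (U : set X) (V : set S) (h : forall y, U y -> V (f y)),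
    [/\ open U, open V, U x & is_finite_mor (mor_restr h)].

(* Main.v *)
(** By the primitive element theorem there are, near [x], a function [Th],
    polynomials [M] and [P_i] with coefficients in [O_s], and [a_j] in the maximal ideal
    of [s = f x], such that [M(Th) = sum a_j f_0j] with [M'(Th)] invertible, and
    the coordinates of a chart are [T_i = P_i(Th) + sum a_j f_ij]. On the fibre over a
    point [t] near [s] these are equations over the complete field [H(t)] with small
    [a_j]; regular functions are Lipschitz (by the maximum modulus principle), so a point
    of the fibre is the limit of a contracting iteration starting at a root of [M_t]
    and is determined by the prime ideal over [M_t] that this root defines. Hence
    the fibres near [x] are finite; [x] is then isolated in its fibre, and
    compactness of a small neighbourhood makes [f] closed near [x]. *)
Require Import Defs.
From HB Require Import structures.
From mathcomp Require Import all_boot all_order all_algebra all_field.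
From mathcomp Require mpoly.

Set Implicit Arguments.
Unset Strict Implicit.
Unset Printing Implicit Defensive.

(** The equations given by unramifiedness are identities between germs at x, while finiteness
    concerns nearby fibres; so all germs are represented by functions regular near x ([regs]), which
    can be evaluated at other points. The obstacle is that two points y, y' of one fibre have
    different fields H(y), H(y'), and no common field is at hand. They are compared by a closed
    isometric relation ([isom_corr]): if the roots of M_t attached to y and y' define the same
    prime, uniqueness of the extension of an absolute value to a finite extension of H(t) identifies
    the two subfields they generate, and every ingredient of the iteration respects this relation.
    Since t and y vary, all constants must be uniform in the field, so the estimates quantify over
    all valued fields. The Lipschitz bound needs the approximating fractions to be controlled on
    whole discs over H(y). The points of such a disc are multiplicative seminorms on H(y)[X], and
    the maximum modulus principle comes from Berkovich's existence theorem for them, with no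
    distinction between archimedean and ultrametric fields. *)

Module MpolyFacts.
Import mpoly PolyRing GRing.Theory.
Local Open Scope ring_scope.

Definition poly_var (A : comNzRingType) n (i : 'I_n) : poly_ring A n := ('X_i : {mpoly A[n]}).

(** Keeps monomials out of what follows: properties of evaluation only have to be checked on
    constants, variables, sums and products. *)
Lemma poly_ring_ind (A : comNzRingType) n (Q : poly_ring A n -> Prop) :
  (forall c, Q (poly_const A n c)) -> (forall i, Q (poly_var A i)) ->
  (forall p q, Q p -> Q q -> Q (p + q)) -> (forall p q, Q p -> Q q -> Q (p * q)) ->
  forall p, Q p.
Proof.
move=> QC QX QD QM p.
have Q0 : Q 0 by have := QC 0; rewrite /poly_const mpolyC0.
have Q1 : Q 1 by have := QC 1; rewrite /poly_const mpolyC1.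
have QE q k : Q q -> Q (q ^+ k).
  by move=> hq; elim: k => [|k IH]; rewrite ?expr0 // exprS; exact: QM.
have QXm (m : 'X_{1..n}) : Q ('X_[m] : {mpoly A[n]}).
  rewrite mpolyXE_id; elim/big_ind: _ => // i _; exact: QE (QX i).
rewrite [p](mpolyE (p : {mpoly A[n]})); elim/big_ind: _ => // m _.
by rewrite -mul_mpolyC; apply: QM; [exact: QC|exact: QXm].
Qed.

Section Eval.
Variables (A L : comNzRingType) (n : nat) (io : {rmorphism A -> L}) (u : 'I_n -> L).

Definition peval (p : poly_ring A n) : L := mmap io u (p : {mpoly A[n]}).

Fact peval_zmod : GRing.zmod_morphism peval.
Proof. by move=> p q; rewrite /peval raddfB. Qed.
Fact peval_monoid : GRing.monoid_morphism peval.
Proof. by split; [exact: rmorph1|move=> p q; exact: rmorphM]. Qed.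
HB.instance Definition _ := GRing.isZmodMorphism.Build (poly_ring A n) L peval peval_zmod.
HB.instance Definition _ := GRing.isMonoidMorphism.Build (poly_ring A n) L peval peval_monoid.

Lemma pevalC c : peval (poly_const A n c) = io c.
Proof. exact: mmapC. Qed.
Lemma pevalX i : peval (poly_var A i) = u i.
Proof. by rewrite /peval /poly_var mmapX mmap1U. Qed.
End Eval.
End MpolyFacts.

From mathcomp Require Import all_classical all_reals all_analysis.
From mathcomp Require Import ring lra.
Import PolyRing MpolyFacts.
Import Order.TTheory GRing.Theory Num.Theory.
Import numFieldNormedType.Exports.

Local Open Scope classical_set_scope.
Local Open Scope ring_scope.

(** * Multiplicative seminorms and the maximum modulus principle *)

Section RealHelpers.
Variable R : realType.

Lemma le_add_of_gt (x y z : R) :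
  (forall a b, x < a -> y < b -> z <= a + b) -> z <= x + y.
Proof.
move=> h; apply/ler_addgt0Pr => e e0.
have := h (x + e / 2) (y + e / 2); rewrite !ltrDl !divr_gt0 // => /(_ isT isT) h'.
by apply: (le_trans h'); lra.
Qed.

(** Together with [le_add_of_gt], this passes inequalities to sums and products of infima that need
    not be attained. *)
Lemma le_mul_of_gt (x y z : R) : 0 <= x -> 0 <= y ->
  (forall a b, x < a -> y < b -> z <= a * b) -> z <= x * y.
Proof.
move=> x0 y0 h; rewrite leNgt; apply/negP => lt.
pose c := x + y + 1; have c0 : 0 < c by rewrite /c; lra.
(* As e <= 1, the excess e * (x + y + e) is at most e * c, half of the gap. *)
pose e := Num.min 1 ((z - x * y) / c / 2).
have e0 : 0 < e by rewrite lt_min ltr01 /= !divr_gt0 // subr_gt0.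
have e1 : e <= 1 by rewrite ge_min lexx.
have e2 : e * c <= (z - x * y) / 2.
  have : e <= (z - x * y) / c / 2 by rewrite ge_min lexx orbT.
  by rewrite mulrAC ler_pdivlMr.
have : z <= (x + e) * (y + e) by apply: h; rewrite ltrDl.
have -> : (x + e) * (y + e) = x * y + e * (x + y + e) by ring.
have : e * (x + y + e) <= e * c by rewrite ler_pM2l // /c; lra.
lra.
Qed.

Lemma inf_range_le I (v : I -> R) i : (forall j, 0 <= v j) -> inf (range v) <= v i.
Proof. by move=> h; apply: ge_inf; [exists 0 => _ [j _ <-]|exists i]. Qed.

Lemma inf_range_ge I (i0 : I) (v : I -> R) c : (forall j, c <= v j) -> c <= inf (range v).
Proof. by move=> h; apply: lb_le_inf; [exists (v i0); exists i0|move=> _ [j _ <-]]. Qed.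

Lemma inf_range_lt I (i0 : I) (v : I -> R) c : inf (range v) < c -> exists i, v i < c.
Proof.
have ne : range v !=set0 by exists (v i0); exists i0.
by move=> /(inf_lt ne)[_ [i _ <-] ?]; exists i.
Qed.

End RealHelpers.

Section Seminorms.
Variables (R : realType) (P : comNzRingType).

Record is_rsn (n : P -> R) : Prop := IsRsn {
  rsn_ge0 : forall a, 0 <= n a;
  rsn0 : n 0 = 0;
  rsn1 : n 1 = 1;
  rsnN : forall a, n (- a) = n a;
  rsnD : forall a b, n (a + b) <= n a + n b;
  rsnM : forall a b, n (a * b) <= n a * n b }.

Definition is_mult (n : P -> R) := forall a b, n (a * b) = n a * n b.

Lemma rsnX n : is_rsn n -> forall a k, n (a ^+ k) <= n a ^+ k.
Proof.
move=> hn a; elim=> [|k IH]; first by rewrite !expr0 (rsn1 hn).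
rewrite !exprS; apply: (le_trans (rsnM hn _ _)).
by rewrite ler_wpM2l // (rsn_ge0 hn).
Qed.

Lemma rsn_sum n : is_rsn n -> forall I (r : seq I) (Q : pred I) (F : I -> P),
  n (\sum_(i <- r | Q i) F i) <= \sum_(i <- r | Q i) n (F i).
Proof.
move=> hn I r Q F; elim/big_ind2: _ => [|x1 x2 y1 y2 h1 h2|//].
  by rewrite (rsn0 hn).
by apply: (le_trans (rsnD hn _ _)); exact: lerD.
Qed.

Lemma rsn_natr n : is_rsn n -> forall k, n k%:R <= k%:R.
Proof.
move=> hn; elim=> [|k IH]; first by rewrite mulr0n (rsn0 hn).
by rewrite -natr1 -[in leRHS]natr1; apply: (le_trans (rsnD hn _ _)); rewrite (rsn1 hn) lerD2r.
Qed.

(** No member need be a seminorm: it is enough that a third index dominates each mixed sum and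
    product. This covers both chains of seminorms and the decreasing sequence behind [twist]. *)
Lemma inf_rsn (I : Type) (i0 : I) (v : I -> P -> R) :
  (forall i a, 0 <= v i a) -> (forall i, v i 0 = 0) -> (forall i, v i 1 = 1) ->
  (forall i a, v i (- a) = v i a) ->
  (forall i j, exists l, forall a b, v l (a + b) <= v i a + v j b) ->
  (forall i j, exists l, forall a b, v l (a * b) <= v i a * v j b) ->
  is_rsn (fun a => inf (range (v^~ a))).
Proof.
move=> h0 v0 v1 vN vD vM.
have ge0 a : 0 <= inf (range (v^~ a)) by apply: inf_range_ge.
have cst a c : (forall i, v i a = c) -> inf (range (v^~ a)) = c.
  move=> h; apply/eqP; rewrite eq_le; apply/andP; split.
    by rewrite -(h i0) inf_range_le.
  by apply: inf_range_ge => // i; rewrite h.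
split=> //; try by [exact: cst].
- by move=> a; have -> : v^~ (- a) = v^~ a by apply: funext => i; exact: vN.
- move=> a b; apply: le_add_of_gt => s t /(inf_range_lt i0)[i hi] /(inf_range_lt i0)[j hj].
  have [l hl] := vD i j; apply: (le_trans (inf_range_le l _)) => //.
  by apply: (le_trans (hl _ _)); apply: lerD; exact: ltW.
- move=> a b; apply: le_mul_of_gt => // s t /(inf_range_lt i0)[i hi] /(inf_range_lt i0)[j hj].
  have [l hl] := vM i j; apply: (le_trans (inf_range_le l _)) => //.
  by apply: (le_trans (hl _ _)); apply: ler_pM => //; exact: ltW.
Qed.

Section Spectral.
Variables (n : P -> R) (hn : is_rsn n).

(** The exponential growth rates of the powers of [f]. Their infimum is the spectral seminorm,
    usually the limit of n (f ^+ k) to the power 1 / k; this form needs neither roots nor the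
    convergence of that sequence. *)
Definition sp_bounds (f : P) : set R :=
  [set a | 0 <= a /\ exists2 C, 0 <= C & forall k, n (f ^+ k) <= C * a ^+ k].
Definition spectral (f : P) : R := inf (sp_bounds f).

Lemma sp_bounds_self f : sp_bounds f (n f).
Proof.
split; first exact: (rsn_ge0 hn).
by exists 1 => // k; rewrite mul1r; exact: (rsnX hn).
Qed.

Lemma spectral_le_bound f a : sp_bounds f a -> spectral f <= a.
Proof. by move=> h; apply: ge_inf => //; exists 0 => b []. Qed.

Lemma spectral_le f : spectral f <= n f.
Proof. exact/spectral_le_bound/sp_bounds_self. Qed.

Lemma spectral_ge f c : (forall a, sp_bounds f a -> c <= a) -> c <= spectral f.
Proof. by move=> h; apply: lb_le_inf => //; exists (n f); exact: sp_bounds_self. Qed.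

Lemma spectral_ge0 f : 0 <= spectral f.
Proof. by apply: spectral_ge => a []. Qed.

Lemma spectral_lt f c : spectral f < c -> exists2 a, sp_bounds f a & a < c.
Proof. by move/inf_lt; apply; exists (n f); exact: sp_bounds_self. Qed.

(** If b < a, Bernoulli's inequality makes the powers of a / b exceed any constant. This is the
    device for removing a multiplicative constant by passing to powers. *)
Lemma pow_le_bounded (a b C : R) : 0 <= a -> 0 <= b -> 0 <= C ->
  (forall k, a ^+ k <= C * b ^+ k) -> a <= b.
Proof.
move=> a0 b0 C0 h; rewrite leNgt; apply/negP => ltba.
have a0' : 0 < a by apply: le_lt_trans ltba.
case: (ltrP 0 b) => [b0'|b0']; last first.
  have b0E : b = 0 by apply/eqP; rewrite eq_le b0' b0.
  by have := h 1%N; rewrite !expr1 b0E mulr0 leNgt a0'.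
pose e := a / b - 1.
have e0 : 0 < e by rewrite subr_gt0 ltr_pdivlMr // mul1r.
have bern k : 1 + e *+ k <= (a / b) ^+ k.
  have -> : a / b = 1 + e by rewrite /e addrC subrK.
  elim: k => [|k IH]; first by rewrite mulr0n addr0 expr0.
  rewrite exprS; apply: (@le_trans _ _ ((1 + e) * (1 + e *+ k))).
    rewrite -subr_ge0 mulrS.
    have -> : (1 + e) * (1 + e *+ k) - (1 + (e + e *+ k)) = e * (e *+ k) by ring.
    by rewrite mulr_ge0 ?mulrn_wge0 // ltW.
  by rewrite ler_pM2l //; lra.
have hC k : e *+ k <= C.
  have := h k; rewrite -ler_pdivrMr ?exprn_gt0 // -expr_div_n => h'.
  by have := le_trans (bern k) h'; lra.
have := archi_boundP (divr_ge0 C0 (ltW e0)); rewrite ltr_pdivrMr // => h1.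
by have := le_lt_trans (hC (Num.bound (C / e))) h1; rewrite -mulr_natl ltxx.
Qed.

Lemma spectral_power_ge f c : 0 <= c -> (forall k, c ^+ k <= n (f ^+ k)) -> c <= spectral f.
Proof.
move=> c0 h; apply: spectral_ge => a [a0 [C C0 hC]].
by apply: (pow_le_bounded c0 a0 C0) => k; apply: le_trans (hC k).
Qed.

Lemma spectral1 : spectral 1 = 1.
Proof.
apply/eqP; rewrite eq_le; apply/andP; split; first by have := spectral_le 1; rewrite (rsn1 hn).
by apply: spectral_power_ge => // k; rewrite !expr1n (rsn1 hn).
Qed.

(** By the binomial formula: the integer coefficients have seminorm at most their size, so the
    bounds recombine into (a + b) ^+ k with constant C * D. *)
Lemma sp_boundsD f g a b : sp_bounds f a -> sp_bounds g b -> sp_bounds (f + g) (a + b).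
Proof.
move=> [a0 [C C0 hC]] [b0 [D D0 hD]]; split; first exact: addr_ge0.
exists (C * D); [exact: mulr_ge0|move=> k].
rewrite !exprDn mulr_sumr; apply: (le_trans (rsn_sum hn _ _ _)).
apply: ler_sum => i _.
rewrite -mulr_natl; apply: (le_trans (rsnM hn _ _)).
rewrite -[X in _ <= _ * X]mulr_natl.
have -> (u v w : R) : C * D * (u * (v * w)) = u * ((C * v) * (D * w)) by ring.
apply: ler_pM; try exact: (rsn_ge0 hn); first exact: rsn_natr.
apply: (le_trans (rsnM hn _ _)).
by apply: ler_pM; [exact: (rsn_ge0 hn)|exact: (rsn_ge0 hn)|exact: hC|exact: hD].
Qed.

Lemma sp_boundsM f g a b : sp_bounds f a -> sp_bounds g b -> sp_bounds (f * g) (a * b).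
Proof.
move=> [a0 [C C0 hC]] [b0 [D D0 hD]]; split; first exact: mulr_ge0.
exists (C * D); [exact: mulr_ge0|move=> k].
rewrite !exprMn mulrACA; apply: (le_trans (rsnM hn _ _)).
by apply: ler_pM => //; exact: (rsn_ge0 hn).
Qed.

Lemma spectral_rsn : is_rsn spectral.
Proof.
split.
- exact: spectral_ge0.
- apply/eqP; rewrite eq_le spectral_ge0 andbT -(rsn0 hn); exact: spectral_le.
- exact: spectral1.
- have h f a : sp_bounds f a -> sp_bounds (- f) a.
    move=> [a0 [C C0 hC]]; split => //; exists C => // k.
    rewrite exprNn -signr_odd; case: (odd k); rewrite ?expr0 ?expr1 ?mul1r ?mulN1r //.
    by rewrite (rsnN hn).
  move=> f; congr (inf _); apply/seteqP; split=> a; last exact: h.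
  by move/h; rewrite opprK.
- move=> f g; apply: le_add_of_gt => a b /spectral_lt[a' ha ltaa] /spectral_lt[b' hb ltbb].
  apply: (le_trans (spectral_le_bound (sp_boundsD ha hb))).
  by apply: lerD; exact: ltW.
- move=> f g; apply: le_mul_of_gt; try exact: spectral_ge0.
  move=> a b /spectral_lt[a' ha ltaa] /spectral_lt[b' hb ltbb].
  apply: (le_trans (spectral_le_bound (sp_boundsM ha hb))).
  by apply: ler_pM; [case: ha|case: hb|exact: ltW|exact: ltW].
Qed.

(** A growth rate b of f ^+ 2 yields, up to an arbitrarily small e, the growth rate [Num.sqrt b] of
    f. The e also keeps s positive when b = 0. *)
Lemma spectral_sqr f : spectral (f ^+ 2) = spectral f ^+ 2.
Proof.
apply/eqP; rewrite eq_le (rsnX spectral_rsn) /=.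
apply: spectral_ge => b [b0 [C C0 hC]].
have -> : b = Num.sqrt b ^+ 2 by rewrite sqr_sqrtr.
rewrite lerXn2r ?nnegrE ?sqrtr_ge0 ?spectral_ge0 //.
apply/ler_addgt0Pr => e e0; apply: spectral_le_bound.
set s := _ + e; have s0 : 0 < s by rewrite ltr_wpDl ?sqrtr_ge0.
have bs : b <= s ^+ 2.
  rewrite -[leLHS]sqr_sqrtr // lerXn2r ?nnegrE ?sqrtr_ge0 ?(ltW s0) //.
  by rewrite lerDl ltW.
split; first exact: ltW.
have q0 : 0 <= n f / s by rewrite divr_ge0 // ?(rsn_ge0 hn) // ltW.
(* An odd exponent leaves one factor f over, and n f is at most (1 + n f / s) * s. *)
exists (C * (1 + n f / s)); first by rewrite mulr_ge0 // addr_ge0.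
move=> k; rewrite -[in leLHS](odd_double_half k) exprD -mul2n exprM.
apply: (le_trans (rsnM hn _ _)).
have -> : s ^+ k = s ^+ odd k * (s ^+ 2) ^+ k./2.
  by rewrite -[in LHS](odd_double_half k) exprD -mul2n exprM.
have -> : C * (1 + n f / s) * (s ^+ odd k * (s ^+ 2) ^+ k./2) =
   ((1 + n f / s) * s ^+ odd k) * (C * (s ^+ 2) ^+ k./2) by ring.
apply: ler_pM; try exact: (rsn_ge0 hn).
  case: (odd k); rewrite ?expr1 ?expr0 ?mulr1.
    by rewrite mulrDl mul1r divfK ?gt_eqF // lerDr ltW.
  by rewrite (rsn1 hn) lerDl.
apply: (le_trans (hC _)); rewrite ler_wpM2l //.
by rewrite lerXn2r // nnegrE // exprn_ge0 // ltW.
Qed.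
End Spectral.
End Seminorms.

Section Twist.
Variables (R : realType) (P : comNzRingType) (n : P -> R) (f : P).
Hypotheses (hn : is_rsn n) (f0 : 0 < n f) (hf : forall k, n (f ^+ k) = n f ^+ k).

(** The quotients decrease with k, so this is their limit: the largest modification of [n] below it
    that makes multiplication by [f] scale exactly by n f. *)
Definition twist (g : P) : R := inf (range (fun k => n (g * f ^+ k) / n f ^+ k)).

Let fk0 k : 0 < n f ^+ k. Proof. by rewrite exprn_gt0. Qed.
Let v0 g k : 0 <= n (g * f ^+ k) / n f ^+ k.
Proof. by rewrite divr_ge0 ?(rsn_ge0 hn) // ltW. Qed.

Lemma twist_le g : twist g <= n g.
Proof.
have := @inf_range_le R _ (fun k => n (g * f ^+ k) / n f ^+ k) 0%N (v0 g).
by rewrite !expr0 mulr1 divr1.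
Qed.

Let vle g k l : n (g * f ^+ (k + l)) / n f ^+ (k + l) <= n (g * f ^+ k) / n f ^+ k.
Proof.
rewrite ler_pdivrMr // exprD mulrA; apply: (le_trans (rsnM hn _ _)).
by rewrite hf exprD mulrA divfK // gt_eqF.
Qed.

Lemma twist_rsn : is_rsn twist.
Proof.
apply: (@inf_rsn R P nat 0%N (fun k g => n (g * f ^+ k) / n f ^+ k)) => //.
- by move=> k; rewrite mul0r (rsn0 hn) mul0r.
- by move=> k; rewrite mul1r hf divff // gt_eqF.
- by move=> k a; rewrite mulNr (rsnN hn).
- move=> k l; exists (k + l)%N => a b.
  rewrite mulrDl; apply: (@le_trans _ _ (n (a * f ^+ (k + l)) / n f ^+ (k + l)
     + n (b * f ^+ (k + l)) / n f ^+ (k + l))).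
    by rewrite -[leRHS]mulrDl ler_pM2r ?invr_gt0 // (rsnD hn).
  by apply: lerD; [exact: vle|rewrite addnC; exact: vle].
- move=> k l; exists (k + l)%N => a b.
  rewrite ler_pdivrMr // exprD mulrACA; apply: (le_trans (rsnM hn _ _)).
  rewrite exprD [leRHS]mulrACA.
  by rewrite !divfK ?gt_eqF.
Qed.

Lemma twistMf g : twist (g * f) = twist g * n f.
Proof.
apply/eqP; rewrite eq_le; apply/andP; split.
  apply: le_mul_of_gt; [exact: (rsn_ge0 twist_rsn)|exact: ltW|].
  move=> a b /(inf_range_lt 0%N)[k hk] hb.
  apply: (@le_trans _ _ (n (g * f ^+ k.+1) / n f ^+ k)).
    apply: (@le_trans _ _ (n (g * f * f ^+ k) / n f ^+ k)); first exact: inf_range_le.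
    by rewrite exprS mulrA.
  have : n (g * f ^+ k.+1) / n f ^+ k <= (n (g * f ^+ k) / n f ^+ k) * n f.
    rewrite mulrAC ler_pM2r ?invr_gt0 // exprSr mulrA; exact: (rsnM hn).
  move/le_trans; apply; apply: ler_pM => //; exact: ltW.
apply: (inf_range_ge 0%N) => k.
apply: (@le_trans _ _ ((n (g * f ^+ k.+1) / n f ^+ k.+1) * n f)).
  by rewrite ler_pM2r // (@inf_range_le _ _ (fun k => n (g * f ^+ k) / n f ^+ k)).
rewrite [f ^+ k.+1]exprS [g * (_ * _)]mulrA [n f ^+ k.+1]exprSr invfM.
by rewrite [_ * (_^-1 * _)]mulrA divfK // gt_eqF.
Qed.

Lemma twist_self : twist f = n f.
Proof. by rewrite -[f in LHS]mul1r twistMf (rsn1 twist_rsn) mul1r. Qed.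

Lemma twist_mult s : (forall g, n (s * g) = n s * n g) ->
  forall g, twist (s * g) = n s * twist g.
Proof.
move=> hs g; apply/eqP; rewrite eq_le; apply/andP; split.
  apply: le_mul_of_gt; [exact: (rsn_ge0 hn)|exact: (rsn_ge0 twist_rsn)|].
  move=> a b ha /(inf_range_lt 0%N)[k hk].
  apply: (@le_trans _ _ (n (s * g * f ^+ k) / n f ^+ k)); first exact: inf_range_le.
  rewrite -!mulrA hs -mulrA; apply: ler_pM;
    [exact: (rsn_ge0 hn)|by rewrite v0|exact: ltW|exact: ltW].
apply: (inf_range_ge 0%N) => k.
rewrite -!mulrA hs -mulrA ler_wpM2l ?(rsn_ge0 hn) //.
exact: (inf_range_le k (v0 g)).
Qed.
End Twist.

(** Equality holds for exponents that are powers of 2; for general k, complete k to 2 ^ k and cancel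
    the submultiplicative bound on the remaining factor. *)
Lemma rsnX_sqr (R : realType) (P : comNzRingType) (n : P -> R) :
  is_rsn n -> (forall a, n (a ^+ 2) = n a ^+ 2) ->
  forall a k, 0 < n a -> n (a ^+ k) = n a ^+ k.
Proof.
move=> hn nsq a k a0.
have npow2 j : n (a ^+ (2 ^ j)) = n a ^+ (2 ^ j).
  by elim: j => [|j IH]; rewrite ?expr1 // expnSr !exprM nsq IH.
apply/eqP; rewrite eq_le (rsnX hn) /=.
have kl : (k <= 2 ^ k)%N by exact/ltnW/ltn_expl.
rewrite -(@ler_pM2r _ (n a ^+ (2 ^ k - k))) ?exprn_gt0 // -exprD subnKC // -npow2.
rewrite -[in leLHS](subnKC kl) exprD; apply: (le_trans (rsnM hn _ _)).
by rewrite ler_wpM2l ?(rsn_ge0 hn) // (rsnX hn).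
Qed.

Section Existence.
Variables (R : realType) (P : comNzRingType).

Section SpectralMult.
Variables (n : P -> R) (hn : is_rsn n).

Lemma spectral_mult s : (forall g, n (s * g) = n s * n g) ->
  forall g, spectral n (s * g) = n s * spectral n g.
Proof.
move=> hs g; have hsX k h : n (s ^+ k * h) = n s ^+ k * n h.
  elim: k => [|k IH]; first by rewrite !expr0 !mul1r.
  by rewrite !exprS -!mulrA hs IH.
apply/eqP; rewrite eq_le; apply/andP; split.
  apply: (le_trans (rsnM (spectral_rsn hn) _ _)).
  by rewrite ler_wpM2r ?spectral_ge0 // spectral_le.
case: (ltrP 0 (n s)) => [s0|s0]; last first.
  have -> : n s = 0 by apply/eqP; rewrite eq_le s0 (rsn_ge0 hn).
  by rewrite mul0r spectral_ge0.
apply: spectral_ge => // a [a0 [C C0 hC]].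
rewrite mulrC -ler_pdivlMr //; apply: spectral_le_bound; split.
  by rewrite divr_ge0 // ltW.
exists C => // k; rewrite expr_div_n mulrA ler_pdivlMr ?exprn_gt0 //.
by rewrite mulrC -hsX -exprMn.
Qed.
End SpectralMult.

Variables (n0 : P -> R) (Sg : set P).
Hypotheses (hn0 : is_rsn n0) (hS : forall s g, Sg s -> n0 (s * g) = n0 s * n0 g).

Let fam (n : P -> R) := [/\ is_rsn n, forall a, n a <= n0 a &
  forall s g, Sg s -> n (s * g) = n0 s * n g].

Let famS n s : fam n -> Sg s -> n s = n0 s.
Proof. by case=> h _ hM Ss; have := hM s 1 Ss; rewrite mulr1 (rsn1 h) mulr1. Qed.

(** Zorn's lemma gives a minimal seminorm below [n0]. Replacing it by its spectral seminorm or by a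
    twist cannot lower it, and a seminorm fixed by both operations is multiplicative. The third
    clause of [fam] survives both operations and freezes the values on [Sg]. *)
Lemma exists_mult : exists n, [/\ is_rsn n, is_mult n, forall a, n a <= n0 a &
  forall s, Sg s -> n s = n0 s].
Proof.
have fam0 : fam n0 by split.
pose T := {n : P -> R | fam n}; pose t0 : T := exist _ n0 fam0.
(* The order is reversed, so that a maximal element is a minimal seminorm. *)
pose ord (t s : T) : bool := `[< forall a, sval s a <= sval t a >].
have [||A totA|t tmax] := @ZL_preorder T t0 ord.
- by move=> t; apply/asboolP.
- move=> r s t /asboolP h1 /asboolP h2; apply/asboolP => a.
  by apply: le_trans (h1 a); exact: h2.
- case: (pselect (exists t, A t)) => [[t At]|Ae]; last first.
    by exists t0 => s As; exfalso; apply: Ae; exists s.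
  pose I := {t : T | A t}.
  pose i0 : I := exist _ t At.
  pose v (i : I) := sval (sval i).
  have vfam i : fam (v i) by exact: (svalP (sval i)).
  have vr i : is_rsn (v i) by case: (vfam i).
  have dir (i j : I) : exists l, (forall a, v l a <= v i a) /\ (forall a, v l a <= v j a).
    have [/asboolP h|/asboolP h] := totA _ _ (svalP i) (svalP j).
      by exists j; split.
    by exists i; split.
  (* A chain is bounded by its pointwise infimum; comparability of two members supplies the third
     index required by [inf_rsn]. *)
  have mfam : fam (fun a => inf (range (v^~ a))).
    split.
    - apply: (inf_rsn i0) => //.
      + by move=> i a; exact: rsn_ge0.
      + by move=> i; exact: rsn0.
      + by move=> i; exact: rsn1.
      + by move=> i a; exact: rsnN.
      + move=> i j; have [l [h1 h2]] := dir i j; exists l => a b.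
        by apply: (le_trans (rsnD (vr l) _ _)); exact: lerD.
      + move=> i j; have [l [h1 h2]] := dir i j; exists l => a b.
        apply: (le_trans (rsnM (vr l) _ _)).
        by apply: ler_pM => //; exact: rsn_ge0.
    - move=> a; apply: (@le_trans _ _ (v i0 a)); last by case: (vfam i0).
      by apply: inf_range_le => j; exact: rsn_ge0.
    - move=> s g Ss; have vs i : v i (s * g) = n0 s * v i g by case: (vfam i) => _ _; apply.
      have g0 i : 0 <= v i g by exact: rsn_ge0.
      have s0 : 0 <= n0 s by exact: rsn_ge0.
      apply/eqP; rewrite eq_le; apply/andP; split.
        apply: le_mul_of_gt => //; first exact: (inf_range_ge i0).
        move=> a b ha /(inf_range_lt i0)[i hi].
        apply: (@le_trans _ _ (v i (s * g))).
          by apply: inf_range_le => j; exact: rsn_ge0.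
        by rewrite vs; apply: ler_pM => //; exact: ltW.
      apply: (inf_range_ge i0) => i; rewrite vs ler_wpM2l //.
      exact: inf_range_le.
  exists (exist _ _ mfam) => s As; apply/asboolP => a /=.
  have -> : sval s a = v (exist _ s As) a by [].
  by apply: inf_range_le => j; exact: rsn_ge0.
have {tmax} tmin n : fam n -> (forall a, n a <= sval t a) -> forall a, n a = sval t a.
  move=> fn hle a; have := tmax (exist _ n fn); rewrite /ord => h.
  have /asboolP h' : `[< forall a, sval t a <= n a >] by apply: h; apply/asboolP.
  by apply/eqP; rewrite eq_le hle h'.
case: t tmin => n /= [hn nle nS] tmin.
have nSs s : Sg s -> n s = n0 s by apply: famS.
have nS' s : Sg s -> forall g, n (s * g) = n s * n g by move=> Ss g; rewrite (nSs s Ss) nS.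
have sp a : spectral n a = n a.
  apply: tmin => [|b]; last exact: spectral_le.
  split; [exact: spectral_rsn|move=> b; exact: le_trans (spectral_le hn b) (nle b)|].
  by move=> s g Ss; rewrite (spectral_mult hn (nS' s Ss)) (nSs s Ss).
have nsq a : n (a ^+ 2) = n a ^+ 2 by rewrite -!sp spectral_sqr.
have npow := rsnX_sqr hn nsq.
exists n; split => // a b.
case: (ltrP 0 (n b)) => [b0|b0]; last first.
  have b0' : n b = 0 by apply/eqP; rewrite eq_le b0 (rsn_ge0 hn).
  apply/eqP; rewrite eq_le (rsnM hn) /= b0' mulr0; exact: (rsn_ge0 hn).
have hb k := npow b k b0.
have tw c : twist n b c = n c.
  apply: tmin => [|d]; last exact: twist_le.
  split; [exact: twist_rsn|move=> d; exact: le_trans (twist_le hn b0 d) (nle d)|].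
  by move=> s g Ss; rewrite (twist_mult hn b0 hb (nS' s Ss)) (nSs s Ss).
by rewrite -[LHS]tw twistMf // tw.
Qed.
End Existence.

(** The spectral value is reached at a multiplicative seminorm: twisting the spectral seminorm by f
    keeps its value at f and makes f scale exactly, so f can join [Sg] before the minimal seminorm
    is chosen. *)
Theorem exists_mult_spectral (R : realType) (P : comNzRingType) (n0 : P -> R)
    (Sg : set P) (f : P) :
  is_rsn n0 -> (forall s g, Sg s -> n0 (s * g) = n0 s * n0 g) ->
  exists n, [/\ is_rsn n, is_mult n, forall a, n a <= n0 a,
    forall s, Sg s -> n s = n0 s & spectral n0 f <= n f].
Proof.
move=> hn0 hS; case: (ltrP 0 (spectral n0 f)) => [f0|f0]; last first.
  have [n [h1 h2 h3 h4]] := exists_mult hn0 hS.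
  by exists n; split => //; apply: (le_trans f0); exact: rsn_ge0.
pose n1 := spectral n0; have hn1 : is_rsn n1 by exact: spectral_rsn.
have nsq a : n1 (a ^+ 2) = n1 a ^+ 2 by exact: spectral_sqr.
have hf k := rsnX_sqr hn1 nsq k f0.
pose n2 := twist n1 f; have hn2 : is_rsn n2 by exact: twist_rsn.
have S1 s g : Sg s -> n1 (s * g) = n0 s * n1 g by move=> Ss; apply: spectral_mult => // h; exact: hS.
have S1' s : Sg s -> n1 s = n0 s by move=> Ss; have := S1 s 1 Ss; rewrite mulr1 (rsn1 hn1) mulr1.
have S2 s g : Sg s -> n2 (s * g) = n0 s * n2 g.
  by move=> Ss; rewrite -(S1' s Ss); apply: twist_mult => // h; rewrite S1 // -(S1' s Ss).
have S2' s : Sg s -> n2 s = n0 s by move=> Ss; have := S2 s 1 Ss; rewrite mulr1 (rsn1 hn2) mulr1.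
have f2 : n2 f = n1 f by exact: twist_self.
have [|n [h1 h2 h3 h4]] := @exists_mult R P n2 [set s | Sg s \/ s = f] hn2.
  move=> s g [Ss|->]; first by rewrite (S2' s Ss) S2.
  by rewrite mulrC f2 /n2 twistMf // mulrC.
exists n; split => //.
- move=> a; apply: (le_trans (h3 a)); apply: (le_trans (twist_le hn1 f0 a)); exact: spectral_le.
- by move=> s Ss; rewrite h4 ?S2' //; left.
- by rewrite h4 ?f2 //; right.
Qed.

Record is_abs (R : realType) (L : fieldType) (v : L -> R) : Prop := IsAbs {
  abs_ge0 : forall x, 0 <= v x;
  abs_eq0 : forall x, v x = 0 <-> x = 0;
  absD : forall x y, v (x + y) <= v x + v y;
  absM : forall x y, v (x * y) = v x * v y }.

Section AbsTheory.
Variables (R : realType) (L : fieldType) (v : L -> R).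
Hypothesis hv : is_abs v.

Lemma abs0 : v 0 = 0. Proof. exact/(abs_eq0 hv). Qed.

Lemma abs_gt0 x : (0 < v x) = (x != 0).
Proof.
rewrite lt_neqAle (abs_ge0 hv) andbT eq_sym; apply/idP/idP; apply: contra => /eqP.
  by move=> ->; rewrite abs0.
by move/(abs_eq0 hv)=> ->.
Qed.

Lemma abs1 : v 1 = 1.
Proof.
have h : v 1 != 0 by apply/eqP => /(abs_eq0 hv)/eqP; rewrite oner_eq0.
by apply: (mulfI h); rewrite -(absM hv) !mulr1.
Qed.

Lemma absX x k : v (x ^+ k) = v x ^+ k.
Proof. by elim: k => [|k IH]; rewrite ?expr0 ?abs1 // !exprS (absM hv) IH. Qed.

Lemma absN x : v (- x) = v x.
Proof.
suff h : v (-1) = 1 by rewrite -mulN1r (absM hv) h mul1r.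
apply/eqP; rewrite -(@eqrXn2 _ 2) ?(abs_ge0 hv) //.
by rewrite -absX sqrrN expr1n abs1 expr1n.
Qed.

Lemma absB x y : v (x - y) = v (y - x).
Proof. by rewrite -absN opprB. Qed.

Lemma absV x : v x^-1 = (v x)^-1.
Proof.
case: (eqVneq x 0) => [->|x0]; first by rewrite invr0 abs0 invr0.
have h : v x != 0 by rewrite gt_eqF // abs_gt0.
by apply: (mulfI h); rewrite -(absM hv) !divff // abs1.
Qed.

Lemma abs_triang x y z : v (x - z) <= v (x - y) + v (y - z).
Proof. by apply: le_trans (absD hv _ _); rewrite addrA subrK. Qed.

Lemma absBD x y : v (x - y) <= v x + v y.
Proof. by apply: (le_trans (absD hv _ _)); rewrite absN. Qed.

Lemma abs_le_near x y : v x <= v y + v (x - y).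
Proof. by apply: le_trans (absD hv _ _); rewrite addrC subrK. Qed.

Lemma abs_dist x y : `|v x - v y| <= v (x - y).
Proof.
rewrite ler_norml; apply/andP; split.
  by rewrite lerBrDr addrC lerBlDr absB; exact: abs_le_near.
by rewrite lerBlDl; exact: abs_le_near.
Qed.

Lemma abs_sum I (r : seq I) (Q : pred I) (F : I -> L) :
  v (\sum_(i <- r | Q i) F i) <= \sum_(i <- r | Q i) v (F i).
Proof.
elim/big_ind2: _ => [|x1 x2 y1 y2 h1 h2|//]; first by rewrite abs0.
by apply: (le_trans (absD hv _ _)); exact: lerD.
Qed.
End AbsTheory.

(** * The maximum modulus principle on discs of the analytic line *)

Section MaximumModulus.
Variables (R : realType) (L : fieldType) (v : L -> R) (r : R).
Hypotheses (hv : is_abs v) (r0 : 0 < r).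

(** A norm that makes sense for archimedean and ultrametric [v] alike; the multiplicative seminorms
    it bounds are points of the closed disc of radius [r] over [L]. *)
Definition norm1 (p : {poly L}) : R := \sum_(i < size p) v p`_i * r ^+ i.

Lemma norm1_widen n (p : {poly L}) : (size p <= n)%N ->
  norm1 p = \sum_(i < n) v p`_i * r ^+ i.
Proof.
move=> h; rewrite /norm1 -!(big_mkord xpredT (fun i => v p`_i * r ^+ i)).
rewrite [RHS](big_cat_nat (n := size p)) //= [X in _ = _ + X]big_nat_cond.
rewrite [X in _ = _ + X]big1 ?addr0 // => i /andP[/andP[h1 _] _].
by rewrite nth_default // (abs0 hv) mul0r.
Qed.

Lemma norm1C c : norm1 c%:P = v c.
Proof.
rewrite (norm1_widen (n := 1)) ?size_polyC_leq1 //.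
by rewrite big_ord1 coefC expr0 mulr1.
Qed.

Lemma norm1MX (p : {poly L}) : norm1 ('X * p) = r * norm1 p.
Proof.
rewrite (norm1_widen (n := (size p).+1)); last first.
  by apply: (leq_trans (size_polyMleq _ _)); rewrite size_polyX.
rewrite big_ord_recl coefXM /= (abs0 hv) mul0r add0r mulr_sumr.
by apply: eq_bigr => i _; rewrite coefXM /= exprS mulrCA.
Qed.

Lemma norm1MC c (p : {poly L}) : norm1 (c%:P * p) = v c * norm1 p.
Proof.
rewrite (norm1_widen (n := size p)); last by rewrite mul_polyC size_scale_leq.
by rewrite mulr_sumr; apply: eq_bigr => i _; rewrite coefCM (absM hv) mulrA.
Qed.

Lemma norm1_ge0 p : 0 <= norm1 p.
Proof. by apply: sumr_ge0 => i _; rewrite mulr_ge0 ?(abs_ge0 hv) // exprn_ge0 // ltW. Qed.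

Lemma norm1D p q : norm1 (p + q) <= norm1 p + norm1 q.
Proof.
pose n := maxn (size p) (size q).
rewrite !(@norm1_widen n) ?leq_maxl ?leq_maxr ?size_polyD // -big_split /=.
apply: ler_sum => i _; rewrite coefD -mulrDl ler_pM2r ?exprn_gt0 //.
exact: (absD hv).
Qed.

Lemma norm1_rsn : is_rsn norm1.
Proof.
split; [exact: norm1_ge0|by rewrite -polyC0 norm1C (abs0 hv)
  |by rewrite -polyC1 norm1C (abs1 hv)| |exact: norm1D|].
  by move=> p; rewrite -mulN1r -polyC1 -polyCN norm1MC (absN hv) (abs1 hv) mul1r.
move=> p q; elim/poly_ind: p => [|p c IH].
  by rewrite mul0r -polyC0 norm1C (abs0 hv) mul0r.
have -> : norm1 (p * 'X + c%:P) = r * norm1 p + v c.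
  rewrite (norm1_widen (n := (size p).+1)) ?size_MXaddC; last by case: ifP.
  rewrite big_ord_recl addrC coefD coefMX coefC /= add0r expr0 mulr1; congr (_ + _).
  rewrite mulr_sumr; apply: eq_bigr => i _.
  by rewrite coefD coefMX coefC /= addr0 exprS mulrCA.
rewrite mulrDl; apply: (le_trans (norm1D _ _)).
rewrite norm1MC mulrAC -mulrA [p * _]mulrC mulrAC [_ * 'X]mulrC norm1MX mulrDl.
by rewrite lerD2r -mulrA ler_pM2l // mulrC.
Qed.

Definition ext_mult (z : {poly L} -> R) :=
  [/\ is_rsn z, is_mult z & forall c, z c%:P = v c].

(** The bound z c <= v c on constants also holds for the inverse of c, which forces equality. *)
Lemma mult_ext z : is_rsn z -> is_mult z -> (forall p, z p <= norm1 p) -> ext_mult z.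
Proof.
move=> h1 h2 h3; split=> // c; have h c' : z c'%:P <= v c' by rewrite -norm1C.
case: (eqVneq c 0) => [->|c0]; first by rewrite polyC0 (rsn0 h1) (abs0 hv).
have e : z c%:P * z (c^-1)%:P = 1 by rewrite -h2 -polyCM divff // (rsn1 h1).
apply/eqP; rewrite eq_le h /= leNgt; apply/negP => lt.
suff : z c%:P * z (c^-1)%:P < 1 by rewrite e ltxx.
have -> : 1 = v c * v c^-1 by rewrite -(absM hv) divff // (abs1 hv).
apply: (@le_lt_trans _ _ (z c%:P * v c^-1)); first by rewrite ler_wpM2l ?(rsn_ge0 h1).
by rewrite ltr_pM2r // (abs_gt0 hv) invr_eq0.
Qed.

(** The quotient seminorm [n] modulo q is tested at 1. If n 1 were at least 1, [exists_mult] would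
    produce a point of the disc where q vanishes. Hence n 1 < 1, and n 1 <= n 1 * n 1 leaves only n
    1 = 0. *)
Lemma approx_inverse (q : {poly L}) :
  (forall z, ext_mult z -> z 'X <= r -> z q <> 0) ->
  forall e, 0 < e -> exists s, norm1 (1 - q * s) < e.
Proof.
move=> hq; pose n g := inf (range (fun s => norm1 (g - q * s))).
have nle g s : n g <= norm1 (g - q * s).
  exact: (inf_range_le s (fun s => norm1_ge0 (g - q * s))).
have nle1 g : n g <= norm1 g by have := nle g 0; rewrite mulr0 subr0.
have nge0 g : 0 <= n g by apply: (inf_range_ge 0) => s; exact: norm1_ge0.
have nM a b : n (a * b) <= n a * n b.
  apply: le_mul_of_gt => // x y /(inf_range_lt 0)[s hs] /(inf_range_lt 0)[t ht].
  apply: (le_trans (nle _ (a * t + s * b - q * s * t))).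
  have -> : a * b - q * (a * t + s * b - q * s * t) = (a - q * s) * (b - q * t) by ring.
  apply: (le_trans (rsnM norm1_rsn _ _)).
  by apply: ler_pM; rewrite ?norm1_ge0 // ltW.
have n1 : n 1 < 1.
  rewrite ltNge; apply/negP => n1ge.
  have hn : is_rsn n.
    split=> //.
    - by apply/eqP; rewrite eq_le nge0 andbT -(rsn0 norm1_rsn).
    - by apply/eqP; rewrite eq_le n1ge andbT -(rsn1 norm1_rsn).
    - move=> a; have h b : n (- b) <= n b.
        apply: (inf_range_ge 0) => s; apply: (le_trans (nle _ (- s))).
        by rewrite mulrN -opprD -(rsnN norm1_rsn) opprK.
      by apply/eqP; rewrite eq_le h /= -[a in leLHS]opprK h.
    - move=> a b; apply: le_add_of_gt => x y /(inf_range_lt 0)[s hs] /(inf_range_lt 0)[t ht].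
      apply: (le_trans (nle _ (s + t))).
      have -> : a + b - q * (s + t) = (a - q * s) + (b - q * t) by ring.
      apply: (le_trans (rsnD norm1_rsn _ _)).
      by apply: lerD; rewrite ltW.
  have [|z [h1 h2 h3 _]] := @exists_mult R _ n set0 hn; first by [].
  apply: (hq z).
  - by apply: mult_ext => // p; apply: (le_trans (h3 p)).
  - apply: (le_trans (h3 _)); apply: (le_trans (nle1 _)).
    by rewrite -[X in norm1 X]mulr1 norm1MX (rsn1 norm1_rsn) mulr1.
  - apply/eqP; rewrite eq_le (rsn_ge0 h1) andbT; apply: (le_trans (h3 _)).
    by apply: (le_trans (nle _ 1)); rewrite mulr1 subrr (rsn0 norm1_rsn).
have n10 : n 1 = 0.
  apply/eqP; rewrite eq_le nge0 andbT leNgt; apply/negP => n1p.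
  have := nM 1 1; rewrite mulr1 leNgt => /negP; apply.
  by rewrite -[ltRHS]mulr1 ltr_pM2l.
by move=> e e0; apply: (inf_range_lt 0); rewrite -/(n 1) n10.
Qed.

(** With s an approximate inverse of q, the spectral value of p * s dominates its value at the
    centre and is reached at a point of the circle, where the hypothesis bounds p by B * q and q * s
    is close to 1. *)
Theorem maximum_modulus (p q : {poly L}) (B : R) : 0 <= B ->
  (forall z, ext_mult z -> z 'X <= r -> z q <> 0) ->
  (forall z, ext_mult z -> z 'X = r -> z p <= B * z q) ->
  v p.[0] <= B * v q.[0].
Proof.
move=> B0 hq hp; apply/ler_addgt0Pr => d d0.
(* The factors 1 - e and 1 + e below produce an error e * (v p.[0] + B * v q.[0]), which [c]
   absorbs. *)
pose c := v p.[0] + B * v q.[0] + 1.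
have c0 : 0 < c by rewrite ltr_wpDl // addr_ge0 ?(abs_ge0 hv) // mulr_ge0 ?(abs_ge0 hv).
pose e := d / c; have e0 : 0 < e by rewrite divr_gt0.
have ec : e * c = d by rewrite /e divfK // gt_eqF.
have [s hs] := approx_inverse hq e0.
have ev0 (g : {poly L}) : v g.[0] <= norm1 g.
  rewrite horner_coef0 /norm1; case E: (size g) => [|k].
    by rewrite nth_default ?E // (abs0 hv) big_ord0.
  rewrite big_ord_recl expr0 mulr1 lerDl; apply: sumr_ge0 => i _.
  by rewrite mulr_ge0 ?(abs_ge0 hv) // exprn_ge0 // ltW.
have Xmul g : norm1 ('X * g) = norm1 'X * norm1 g.
  by rewrite norm1MX -[X in norm1 X * _]mulr1 norm1MX (rsn1 norm1_rsn) mulr1.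
(* Multiplication by X scales [norm1] exactly, so X may be put in [Sg]; this forces z 'X = r, that
   is, a point on the circle. *)
have [|z [h1 h2 h3 h4 h5]] := @exists_mult_spectral R _ norm1 [set 'X] (p * s) norm1_rsn.
  by move=> _ g ->.
have hz : ext_mult z by apply: mult_ext.
have zX : z 'X = r by rewrite h4 // -[X in norm1 X]mulr1 norm1MX (rsn1 norm1_rsn) mulr1.
have ps : v (p.[0] * s.[0]) <= z (p * s).
  apply: le_trans h5; apply: (spectral_power_ge norm1_rsn); first exact: (abs_ge0 hv).
  by move=> k; rewrite -(absX hv) -hornerM -horner_exp.
have qs : z (q * s) <= 1 + e.
  have -> : q * s = 1 + - (1 - q * s) by ring.
  apply: (le_trans (rsnD h1 _ _)); rewrite (rsn1 h1) (rsnN h1) lerD2l.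
  by apply: (le_trans (h3 _)); exact: ltW.
have bd : v p.[0] * v s.[0] <= B * (1 + e).
  rewrite -(absM hv); apply: (le_trans ps); rewrite h2.
  apply: (@le_trans _ _ (B * z q * z s)).
    by rewrite ler_wpM2r ?(rsn_ge0 h1) //; exact: hp.
  by rewrite -mulrA -h2 ler_wpM2l.
have q0s0 : 1 - e <= v q.[0] * v s.[0].
  have : v (1 - q * s).[0] <= e by apply: (le_trans (ev0 _)); exact: ltW.
  rewrite hornerD hornerN hornerM hornerC -(absM hv) => h.
  by have := abs_le_near hv 1 (q.[0] * s.[0]); rewrite (abs1 hv); lra.
have f1 : v p.[0] * (1 - e) <= v p.[0] * (v q.[0] * v s.[0]).
  by rewrite ler_wpM2l ?(abs_ge0 hv).
have f2 : v q.[0] * (v p.[0] * v s.[0]) <= v q.[0] * (B * (1 + e)).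
  by rewrite ler_wpM2l ?(abs_ge0 hv).
have f3 : v p.[0] * (1 - e) = v p.[0] - e * v p.[0] by ring.
have f4 : v q.[0] * (B * (1 + e)) = B * v q.[0] + e * (B * v q.[0]) by ring.
have f5 : v p.[0] * (v q.[0] * v s.[0]) = v q.[0] * (v p.[0] * v s.[0]) by ring.
have f6 : d = e * v p.[0] + e * (B * v q.[0]) + e by rewrite -ec /c; ring.
lra.
Qed.
End MaximumModulus.

(** * Complete valued fields and the Newton iteration *)

Section RationalLipschitz.
Variables (R : realType) (L : fieldType) (v : L -> R).
Hypothesis hv : is_abs v.

Lemma eval_ext x : ext_mult v (fun g : {poly L} => v g.[x]).
Proof.
split; last by move=> c; rewrite hornerC.
  split=> [a|||a|a b|a b].
  - exact: (abs_ge0 hv).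
  - by rewrite horner0 (abs0 hv).
  - by rewrite hornerC (abs1 hv).
  - by rewrite hornerN (absN hv).
  - by rewrite hornerD (absD hv).
  - by rewrite hornerM (absM hv).
by move=> a b; rewrite hornerM (absM hv).
Qed.

Lemma comp_ext (z : {poly L} -> R) h : ext_mult v z -> ext_mult v (fun g => z (g \Po h)).
Proof.
case=> h1 h2 h3; split; last by move=> c; rewrite comp_polyC.
  split=> [a|||a|a b|a b].
  - exact: (rsn_ge0 h1).
  - by rewrite comp_poly0 (rsn0 h1).
  - by rewrite comp_polyC (rsn1 h1).
  - by rewrite raddfN (rsnN h1).
  - by rewrite comp_polyD (rsnD h1).
  - by rewrite comp_polyM (rsnM h1).
by move=> a b; rewrite comp_polyM h2.
Qed.

(** The Cauchy estimate: the maximum modulus principle is applied to the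
    difference quotient, on the circle of radius [r - 1] around [1]. *)
Lemma rational_lipschitz (p q : {poly L}) (r B : R) : 4 <= r -> 0 <= B ->
  (forall z, ext_mult v z -> z 'X <= r -> z q <> 0 /\ z p <= B * z q) ->
  v (p.[1] / q.[1] - p.[0] / q.[0]) <= 4 * B / r.
Proof.
move=> r4 B0 hpq.
have q0 : 0 < v q.[0].
  have := (hpq _ (eval_ext 0)); rewrite hornerX (abs0 hv) => -[]; first by lra.
  by move=> /eqP h _; rewrite lt_neqAle (abs_ge0 hv) eq_sym h.
have q1 : 0 < v q.[1].
  have := (hpq _ (eval_ext 1)); rewrite hornerX (abs1 hv) => -[]; first by lra.
  by move=> /eqP h _; rewrite lt_neqAle (abs_ge0 hv) eq_sym h.
have p0 : v p.[0] <= B * v q.[0].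
  by have := (hpq _ (eval_ext 0)); rewrite hornerX (abs0 hv) => -[] //; lra.
have [p1 hp1] : exists p1, p * q.[0]%:P - p.[0]%:P * q = p1 * ('X - 0%:P).
  apply/factor_theorem; rewrite rootE !hornerE mulrC subrr //.
rewrite subr0 in hp1.
pose t : {poly L} := 'X + 1.
(* The two terms of p1 * X give 2 * B, and dividing by X costs r - 2, its least value on the circle
   of radius r - 1 around 1. As r >= 4, this is at most 4 * B / r. *)
pose B' := 2 * B / (r - 2).
have B'0 : 0 <= B' by rewrite /B' divr_ge0 //; lra.
have r10 : 0 < r - 1 by lra.
have mm := @maximum_modulus R L v (r - 1) hv r10 (p1 \Po t) ((q \Po t) * q.[0]%:P) B' B'0.
have zt z : ext_mult v z -> (z (t) <= z 'X + 1) /\ (z 'X <= z t + 1).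
  move=> [h1 h2 h3]; split; first by have := rsnD h1 'X 1; rewrite (rsn1 h1).
  have := rsnD h1 t (-1); rewrite (rsnN h1) (rsn1 h1) /t.
  by rewrite addrK.
have hE : v p1.[1] <= B' * (v q.[1] * v q.[0]).
  have e : (1 : L) = t.[0] by rewrite /t hornerD hornerX hornerC add0r.
  have -> : v p1.[1] = v (p1 \Po t).[0] by rewrite horner_comp -e.
  have -> : v q.[1] * v q.[0] = v ((q \Po t) * q.[0]%:P).[0].
    by rewrite hornerM horner_comp -e hornerC (absM hv).
  apply: mm => z hz zX.
    have [h1 h2 h3] := hz; rewrite h2 h3; apply/eqP; rewrite mulf_neq0 //; last by rewrite gt_eqF.
    have := hpq _ (comp_ext t hz); rewrite comp_polyX => -[|/eqP//].
    by have := (zt _ hz).1; lra.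
  have [h1 h2 h3] := hz.
  have := hpq _ (comp_ext t hz); rewrite comp_polyX => -[|zq zp].
    by have := (zt _ hz).1; lra.
  have ztl : r - 2 <= z t by have := (zt _ hz).2; lra.
  have r2 : 0 < r - 2 by lra.
  have : z (p1 \Po t) * z t <= 2 * B * z ((q \Po t) * q.[0]%:P).
    rewrite -h2; have -> : (p1 \Po t) * t = (p1 * 'X) \Po t by rewrite comp_polyM comp_polyX.
    rewrite -hp1 raddfB /= !comp_polyM !comp_polyC.
    apply: (le_trans (rsnD h1 _ _)); rewrite (rsnN h1) !h2 !h3.
    have f1 : z (p \Po t) * v q.[0] <= B * z (q \Po t) * v q.[0].
      by rewrite ler_pM2r.
    have f2 : v p.[0] * z (q \Po t) <= B * v q.[0] * z (q \Po t).
      by rewrite ler_wpM2r // (rsn_ge0 h1).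
    lra.
  move=> h; rewrite /B' mulrAC ler_pdivlMr //; apply: le_trans h.
  by rewrite ler_wpM2l // (rsn_ge0 h1).
have -> : p.[1] / q.[1] - p.[0] / q.[0] = p1.[1] / (q.[1] * q.[0]).
  have := congr1 (fun g => g.[1]) hp1; rewrite !hornerE /= => e.
  rewrite -e; field.
  by rewrite -!(abs_gt0 hv) q0 q1.
rewrite (absM hv) (absV hv) (absM hv) ler_pdivrMr ?mulr_gt0 //.
apply: (le_trans hE); rewrite ler_pM2r ?mulr_gt0 //.
rewrite /B' ler_pdivrMr; last by lra.
rewrite mulrAC ler_pdivlMr; last by lra.
have : B * r >= B * 4 by rewrite ler_wpM2l.
lra.
Qed.
End RationalLipschitz.

(** Size, Lipschitz and second-order Taylor bounds with one [K] for all valued fields, as the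
    polynomials M and P_i will be specialized to fields H(t) with t varying. By induction on the
    degree through p = q * X + p(0). *)
Lemma poly_estimates (R : realType) (C rho : R) (n : nat) : 0 <= C -> 0 <= rho ->
  exists2 K, 0 <= K & forall (L : fieldType) (v : L -> R) (p : {poly L}),
  is_abs v -> (size p <= n)%N -> (forall i, v p`_i <= C) ->
  forall x y w, v x <= rho -> v y <= rho -> v w <= rho ->
  [/\ v p.[x] <= K, v (p.[x] - p.[y]) <= K * v (x - y) &
      v (p.[x] - p.[y] - p^`().[w] * (x - y)) <= K * (v (x - w) + v (y - w)) * v (x - y)].
Proof.
move=> C0 rho0; elim: n => [|n [K K0 IH]].
  exists 0 => // L v p hv; rewrite leqn0 size_poly_eq0 => /eqP -> _ x y w _ _ _.
  by rewrite deriv0 !horner0 !mul0r !subrr (abs0 hv).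
exists (K * rho + C + K + rho * K); first by rewrite !addr_ge0 // mulr_ge0.
move=> L v p hv sp hC x y w hx hy hw.
pose q : {poly L} := \poly_(i < n) p`_i.+1.
have pE : p = q * 'X + (p`_0)%:P.
  apply/polyP => -[|i]; rewrite coefD coefMX coefC /= ?add0r // addr0 coef_poly.
  case: ltnP => // h; rewrite nth_default //; exact: leq_trans sp _.
have sq : (size q <= n)%N by exact: size_poly.
have hq i : v q`_i <= C by rewrite coef_poly; case: ifP; rewrite ?(abs0 hv).
have [h1 h2 h3] := IH L v q hv sq hq x y w hx hy hw.
have [_ h4 _] := IH L v q hv sq hq x w y hx hw hy.
have E u : p.[u] = q.[u] * u + p`_0 by rewrite [in LHS]pE !hornerE.
have E' u : p^`().[u] = q.[u] + q^`().[u] * u.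
  by rewrite pE derivD derivC derivM derivX addr0 !hornerE addrC.
have Kr : 0 <= K * rho by rewrite mulr_ge0.
have rK : 0 <= rho * K by rewrite mulr_ge0.
have d0 : 0 <= v (x - y) by exact: (abs_ge0 hv).
split.
- rewrite E; apply: (le_trans (absD hv _ _)); rewrite (absM hv).
  have : v q.[x] * v x <= K * rho by apply: ler_pM; rewrite ?(abs_ge0 hv).
  by have := hC 0%N; lra.
- have -> : p.[x] - p.[y] = (x - y) * q.[x] + y * (q.[x] - q.[y]) by rewrite !E; ring.
  apply: (le_trans (absD hv _ _)); rewrite !(absM hv).
  have f1 : v (x - y) * v q.[x] <= v (x - y) * K by rewrite ler_wpM2l.
  have f2 : v y * v (q.[x] - q.[y]) <= rho * (K * v (x - y)).
    by apply: ler_pM; rewrite ?(abs_ge0 hv).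
  have f3 : 0 <= (K * rho + C) * v (x - y) by rewrite mulr_ge0 // addr_ge0.
  lra.
- have -> : p.[x] - p.[y] - p^`().[w] * (x - y) =
     (x - y) * (q.[x] - q.[w]) + (y - w) * (q.[x] - q.[y])
     + w * (q.[x] - q.[y] - q^`().[w] * (x - y)) by rewrite !E E'; ring.
  apply: (le_trans (absD hv _ _)); rewrite (absM hv w).
  have f0 := absD hv ((x - y) * (q.[x] - q.[w])) ((y - w) * (q.[x] - q.[y])).
  rewrite !(absM hv) in f0.
  have f1 : v (x - y) * v (q.[x] - q.[w]) <= v (x - y) * (K * v (x - w)) by rewrite ler_wpM2l.
  have f2 : v (y - w) * v (q.[x] - q.[y]) <= v (y - w) * (K * v (x - y)).
    by rewrite ler_wpM2l ?(abs_ge0 hv).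
  have f3 : v w * v (q.[x] - q.[y] - q^`().[w] * (x - y)) <=
            rho * (K * (v (x - w) + v (y - w)) * v (x - y)).
    by apply: ler_pM; rewrite ?(abs_ge0 hv).
  have f4 : 0 <= (K * rho + C) * ((v (x - w) + v (y - w)) * v (x - y)).
    by rewrite mulr_ge0 ?addr_ge0 // mulr_ge0 // addr_ge0 // (abs_ge0 hv).
  lra.
Qed.

Definition abs_cvg (R : realType) (L : fieldType) (v : L -> R) (u : nat -> L) (l : L) :=
  forall e, 0 < e -> exists N, forall n, (N <= n)%N -> v (u n - l) < e.

Definition abs_complete (R : realType) (L : fieldType) (v : L -> R) :=
  forall u : nat -> L, (forall e, 0 < e -> exists N, forall m n,
    (N <= m)%N -> (N <= n)%N -> v (u m - u n) < e) -> exists l, abs_cvg v u l.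

Section FixedPoint.
Variables (R : realType) (L : fieldType) (v : L -> R).
Hypotheses (hv : is_abs v) (cv : abs_complete v).

Lemma half_pow_lt (c e : R) : 0 <= c -> 0 < e -> exists N, forall n, (N <= n)%N -> c * 2^-1 ^+ n < e.
Proof.
move=> c0 e0.
have [N hN] : exists N : nat, c / e < N%:R.
  by exists (Num.bound (c / e)); apply: archi_boundP; rewrite divr_ge0 // ltW.
exists N => n Nn; rewrite exprVn ltr_pdivrMr ?exprn_gt0 // mulrC -ltr_pdivrMr //.
apply: (lt_le_trans hN); apply: (@le_trans _ _ n%:R); first by rewrite ler_nat.
by rewrite -natrX ler_nat; apply/ltnW/ltn_expl.
Qed.

Lemma small_eq (x y : L) : (forall e, 0 < e -> v (x - y) < e) -> x = y.
Proof.
move=> h; apply/eqP; rewrite -subr_eq0; apply/negP => /negP; rewrite -(abs_gt0 hv) => h0.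
by have := h _ h0; rewrite ltxx.
Qed.

(** Banach's fixed point theorem on a ball that [G] need not preserve: the increments are halved at
    each step, so the orbit of [a] stays within 2 * v (G a - a) of [a], hence in the ball. *)
Lemma fixed_point (G : L -> L) a (rho : R) :
  (forall x y, v (x - a) <= rho -> v (y - a) <= rho -> v (G x - G y) <= v (x - y) / 2) ->
  v (G a - a) <= rho / 2 ->
  exists2 l, G l = l & v (l - a) <= 2 * v (G a - a).
Proof.
move=> hG ha; set d := v (G a - a) in ha *.
have d0 : 0 <= d by exact: (abs_ge0 hv).
pose u n := iter n G a.
have hu n : v (u n.+1 - u n) <= d * 2^-1 ^+ n /\ v (u n - a) <= 2 * d * (1 - 2^-1 ^+ n).
  elim: n => [|n [IH1 IH2]].
    by rewrite /= !expr0 !mulr1 !subrr mulr0 (abs0 hv).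
  have p0 : 0 <= (2^-1 : R) ^+ n by rewrite exprn_ge0 // invr_ge0.
  have dp : 0 <= d * 2^-1 ^+ n by rewrite mulr_ge0.
  have b1 : v (u n - a) <= rho by lra.
  have b2 : v (u n.+1 - a) <= 2 * d * (1 - 2^-1 ^+ n.+1).
    apply: (le_trans (abs_triang hv _ (u n) _)); rewrite exprS; lra.
  split=> //.
  have dp' : 0 <= d * 2^-1 ^+ n.+1 by rewrite exprS; lra.
  apply: (le_trans (hG (u n.+1) (u n) _ b1)); first by lra.
  by rewrite exprS; lra.
have hc m n : (n <= m)%N -> v (u m - u n) <= 2 * d * 2^-1 ^+ n.
  move=> nm; have [k ->] : exists k, m = (n + k)%N by exists (m - n)%N; rewrite subnKC.
  suff : v (u (n + k)%N - u n) <= 2 * d * (2^-1 ^+ n - 2^-1 ^+ (n + k)).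
    have : 0 <= d * 2^-1 ^+ (n + k) by rewrite mulr_ge0 // exprn_ge0 // invr_ge0.
    by lra.
  elim: k => [|k IH]; first by rewrite addn0 !subrr mulr0 (abs0 hv).
  apply: (le_trans (abs_triang hv _ (u (n + k)%N) _)).
  by have := (hu (n + k)%N).1; rewrite addnS exprS; lra.
have [|l hl] := cv (u := u).
  move=> e e0; have [N hN] := @half_pow_lt (4 * d) e (mulr_ge0 (ler0n _ 4) d0) e0.
  exists N => m n Nm Nn; apply: (@le_lt_trans _ _ (4 * d * 2^-1 ^+ N)); last exact: hN.
  apply: (le_trans (abs_triang hv _ (u N) _)).
  by have := hc _ _ Nm; have := hc _ _ Nn; rewrite (absB hv (u n)); lra.
have la : v (l - a) <= 2 * d.
  apply/ler_addgt0Pr => e e0; have [N hN] := hl _ e0.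
  apply: (le_trans (abs_triang hv _ (u N) _)).
  have := hN N (leqnn _); have := (hu N).2; rewrite (absB hv l).
  have : 0 <= d * 2^-1 ^+ N by rewrite mulr_ge0 // exprn_ge0 // invr_ge0.
  by lra.
exists l => //; apply: small_eq => e e0.
have [N hN] := hl _ (divr_gt0 e0 (ltr0n _ 2 : 0 < 2 :> R)).
apply: (le_lt_trans (abs_triang hv _ (u N.+1) _)).
have h1 := hN N (leqnn _); have h2 := hN N.+1 (leqnSn _).
have h3 : v (G l - u N.+1) <= v (l - u N) / 2.
  apply: hG; first by lra.
  apply: (le_trans (hu N).2).
  have : 0 <= d * 2^-1 ^+ N by rewrite mulr_ge0 // exprn_ge0 // invr_ge0.
  by lra.
by rewrite (absB hv l) in h3; lra.
Qed.
End FixedPoint.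

Lemma eventually_all_lt (n : nat) (Q : nat -> nat -> Prop) :
  (forall j, (j < n)%N -> exists N, forall m, (N <= m)%N -> Q j m) ->
  exists N, forall m, (N <= m)%N -> forall j, (j < n)%N -> Q j m.
Proof.
elim: n => [|p IH] h; first by exists 0%N.
have [|N hN] := IH; first by move=> j jp; apply: h; exact: ltnW.
have [M hM] := h p (leqnn _).
exists (maxn N M) => m; rewrite geq_max => /andP[Nm Mm] j.
by rewrite ltnS leq_eqVlt => /predU1P[->|jp]; [exact: hM|exact: hN].
Qed.

(** * Extensions of a complete absolute value *)

Section NormEquivalence.
Variables (R : realType) (k L : fieldType) (vk : k -> R) (v : L -> R).
Variable (i : {rmorphism k -> L}).
Hypotheses (hvk : is_abs vk) (hv : is_abs v) (ck : abs_complete vk).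
Hypothesis (iso : forall c, v (i c) = vk c).

Definition lin_indep (n : nat) (e : nat -> L) := forall c : nat -> k,
  \sum_(j < n) i (c j) * e j = 0 -> forall j, (j < n)%N -> c j = 0.

(** Coordinates on a finite-dimensional subspace are continuous because [k] is complete. In the
    induction, the span of the first n vectors is closed, so the last vector has a positive distance
    d from it, which bounds the last coordinate. *)
Lemma lin_indep_bound n e : lin_indep n e ->
  exists2 C, 0 <= C & forall (c : nat -> k) j, (j < n)%N ->
    vk (c j) <= C * v (\sum_(j < n) i (c j) * e j).
Proof.
elim: n => [|n IH] ind; first by exists 0.
have indn : lin_indep n e.
  move=> c hc j jn; have := ind (fun j => if (j < n)%N then c j else 0).
  rewrite big_ord_recr /= ltnn rmorph0 mul0r addr0.
  under eq_bigr => l _ do rewrite ltn_ord.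
  by move=> /(_ hc j (ltnW jn)); rewrite jn.
have [C C0 hC] := IH indn.
(* Otherwise e n is approached by combinations of the earlier vectors; by induction their
   coefficients are Cauchy sequences and converge in [k]. *)
have [d d0 hd] : exists2 d, 0 < d & forall c : nat -> k,
    d <= v (e n - \sum_(j < n) i (c j) * e j).
  apply: contrapT => hn.
  have hm m : exists c : nat -> k, v (e n - \sum_(j < n) i (c j) * e j) < (m.+1%:R)^-1.
    apply: contrapT => h; apply: hn; exists (m.+1%:R)^-1; first by rewrite invr_gt0.
    by move=> c; rewrite leNgt; apply/negP => h'; apply: h; exists c.
  have [c hc] := choice hm.
  have small (eps : R) : 0 < eps -> exists N, forall m, (N <= m)%N -> (m.+1%:R)^-1 < eps.
    move=> e0; exists (Num.bound eps^-1) => m Nm.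
    rewrite invf_plt ?posrE //; apply: (lt_le_trans (archi_boundP _)).
      by rewrite invr_ge0 ltW.
    by rewrite ler_nat (leq_trans Nm).
  have cc j : (j < n)%N -> exists l, abs_cvg vk (fun m => c m j) l.
    move=> jn; apply: ck => eps e0.
    have [N hN] := small (eps / (2 * (C + 1))) (divr_gt0 e0 (mulr_gt0 (ltr0n _ 2) (ltr_wpDl C0 ltr01))).
    exists N => m m' Nm Nm'.
    apply: (le_lt_trans (hC (fun j => c m j - c m' j) j jn)).
    pose s m := \sum_(j < n) i (c m j) * e j.
    have -> : \sum_(j0 < n) i (c m j0 - c m' j0) * e j0 = s m - s m'.
      by rewrite -sumrB; apply: eq_bigr => l _; rewrite rmorphB mulrBl.
    have := absBD hv (e n - s m') (e n - s m).
    have -> : e n - s m' - (e n - s m) = s m - s m' by ring.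
    have h1 := lt_trans (hc m) (hN _ Nm); have h2 := lt_trans (hc m') (hN _ Nm').
    rewrite -/(s m) in h1; rewrite -/(s m') in h2.
    set a := v (s m - s m') => h5.
    have h6 : a < 2 * (eps / (2 * (C + 1))) by lra.
    have h7 : 2 * (eps / (2 * (C + 1))) = eps / (C + 1) by field; lra.
    have C1 : 0 < C + 1 by lra.
    rewrite h7 ltr_pdivlMr // in h6.
    have a0 : 0 <= a by exact: (abs_ge0 hv).
    lra.
  have [l hl] : exists l : nat -> k, forall j, (j < n)%N -> abs_cvg vk (fun m => c m j) (l j).
    have h j : exists l, (j < n)%N -> abs_cvg vk (fun m => c m j) l.
      case: (ltnP j n) => jn; last by exists 0.
      by have [l hl] := cc j jn; exists l.
    by have [l hl] := choice h; exists l.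
  have eE : e n = \sum_(j < n) i (l j) * e j.
    apply: (small_eq hv) => eps e0.
    pose E := \sum_(j < n) v (e j) + 1.
    have E0 : 0 < E by rewrite ltr_wpDl // sumr_ge0 // => j _; exact: (abs_ge0 hv).
    have [N1 hN1] := small (eps / 2) (divr_gt0 e0 (ltr0n _ 2)).
    have [N2 hN2] : exists N, forall m, (N <= m)%N -> forall j, (j < n)%N ->
        vk (c m j - l j) < eps / 2 / E.
      have e2 : 0 < eps / 2 / E by rewrite !divr_gt0.
      exact: (eventually_all_lt (fun j jn => hl j jn _ e2)).
    pose m := maxn N1 N2.
    apply: (le_lt_trans (abs_triang hv _ (\sum_(j < n) i (c m j) * e j) _)).
    have h1 := lt_trans (hc m) (hN1 m (leq_maxl _ _)).
    suff : v (\sum_(j < n) i (c m j) * e j - \sum_(j < n) i (l j) * e j) <= eps / 2 by move: h1; lra.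
    rewrite -sumrB; apply: (le_trans (abs_sum hv _ _ _)).
    apply: (@le_trans _ _ (\sum_(j < n) (eps / 2 / E) * v (e j))).
      apply: ler_sum => j _; rewrite -mulrBl -rmorphB (absM hv) iso.
      rewrite ler_wpM2r ?(abs_ge0 hv) // ltW // hN2 ?ltn_ord //; exact: leq_maxr.
    rewrite -mulr_sumr mulrAC ler_pdivrMr // ler_pM2l; last by rewrite divr_gt0.
    by rewrite /E; lra.
  (* The limit writes e n through the earlier vectors, against independence. *)
  have := ind (fun j => if (j < n)%N then - l j else 1).
  rewrite big_ord_recr /= ltnn rmorph1 mul1r.
  under eq_bigr => j _ do rewrite ltn_ord rmorphN mulNr.
  rewrite sumrN -eE addNr => /(_ erefl n (leqnn _)); rewrite ltnn => /eqP.
  by rewrite oner_eq0.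
have h1 c : vk (c n) <= d^-1 * v (\sum_(j < n.+1) i (c j) * e j).
  case: (eqVneq (c n) 0) => [->|cn0].
    by rewrite (abs0 hvk) mulr_ge0 ?(abs_ge0 hv) // invr_ge0 ltW.
  have -> : \sum_(j < n.+1) i (c j) * e j =
      i (c n) * (e n - \sum_(j < n) i (- c j / c n) * e j).
    rewrite big_ord_recr /= addrC mulrBr; congr (_ + _).
    rewrite mulr_sumr -sumrN; apply: eq_bigr => j _.
    by rewrite mulrA -rmorphM mulrCA divff // mulr1 rmorphN mulNr opprK.
  rewrite (absM hv) iso mulrCA -[leLHS]mulr1 ler_wpM2l ?(abs_ge0 hvk) //.
  by rewrite ler_pdivlMl // mulr1; exact: (hd (fun j => - c j / c n)).
exists (C * (1 + d^-1 * v (e n)) + d^-1).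
  rewrite addr_ge0 ?invr_ge0 ?(ltW d0) // mulr_ge0 // addr_ge0 // mulr_ge0 ?(abs_ge0 hv) //.
  by rewrite invr_ge0 ltW.
move=> c j; set s := \sum_(j < n.+1) _.
have s0 : 0 <= v s by exact: (abs_ge0 hv).
have en0 : 0 <= v (e n) by exact: (abs_ge0 hv).
have di0 : 0 <= d^-1 by rewrite invr_ge0 ltW.
have D0 : 0 <= C * (1 + d^-1 * v (e n)) by rewrite mulr_ge0 // addr_ge0 // mulr_ge0.
rewrite ltnS leq_eqVlt => /predU1P[->|jn].
  apply: (le_trans (h1 c)); rewrite -/s ler_wpM2r //; lra.
apply: (le_trans (hC c j jn)).
have -> : \sum_(j < n) i (c j) * e j = s - i (c n) * e n.
  by rewrite /s big_ord_recr /= addrK.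
have h2 : v (s - i (c n) * e n) <= v s + vk (c n) * v (e n).
  by apply: (le_trans (absBD hv _ _)); rewrite (absM hv) iso.
have h3 : vk (c n) * v (e n) <= d^-1 * v s * v (e n) by rewrite ler_wpM2r // h1.
have h4 : C * v (s - i (c n) * e n) <= C * (v s + d^-1 * v s * v (e n)).
  by rewrite ler_wpM2l //; lra.
have h5 : 0 <= d^-1 * v s by rewrite mulr_ge0.
lra.
Qed.
End NormEquivalence.

Section UniqueExtension.
Variables (R : realType) (k L L' : fieldType) (vk : k -> R) (v : L -> R) (v' : L' -> R).
Variables (i : {rmorphism k -> L}) (i' : {rmorphism k -> L'}) (a : L) (a' : L').
Hypotheses (hvk : is_abs vk) (hv : is_abs v) (hv' : is_abs v') (ck : abs_complete vk).
Hypotheses (iso : forall c, v (i c) = vk c) (iso' : forall c, v' (i' c) = vk c).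
Hypothesis ker : forall g, (map_poly i g).[a] = 0 <-> (map_poly i' g).[a'] = 0.

(** Expanding in powers of a and a' and bounding coordinates gives v' <= C * D * v on polynomial
    values; applied to all powers of g, this loses its constant by [pow_le_bounded]. *)
Lemma unique_extension_le (m : {poly k}) : m != 0 -> (map_poly i m).[a] = 0 ->
  forall g, v' (map_poly i' g).[a'] <= v (map_poly i g).[a].
Proof.
(* An annihilator f of least size plays the role of the minimal polynomial of a; the powers of a
   below its degree d.-1 are then independent. *)
move=> m0 ma; have [d dd dmin] := @ex_minnP (fun d => `[< exists g : {poly k},
   [/\ g != 0, (map_poly i g).[a] = 0 & size g = d] >])
   (ex_intro _ (size m) (asboolT (ex_intro _ m (And3 m0 ma erefl)))).
move/asboolP: dd => [f [f0 fa fd]].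
have ind : lin_indep i d.-1 (fun j => a ^+ j).
  move=> c hc j jd.
  pose g := \poly_(j < d.-1) c j.
  have ga : (map_poly i g).[a] = 0.
    rewrite -[RHS]hc (@horner_coef_wide _ d.-1); last first.
      by rewrite size_map_poly size_poly.
    by apply: eq_bigr => l _; rewrite coef_map coef_poly ltn_ord.
  have sg : (size g <= d.-1)%N by exact: size_poly.
  case: (eqVneq g 0) => [g0|g0].
    by have := coef_poly (d.-1) c j; rewrite jd -/g g0 coef0.
  have := dmin (size g); move=> /(_ (asboolT (ex_intro _ g (And3 g0 ga erefl)))) dg.
  have : (0 < d)%N by rewrite -fd size_poly_gt0.
  by move=> d0; have := leq_trans dg sg; rewrite -{1}(prednK d0) ltnn.
have [C C0 hC] := lin_indep_bound hvk hv ck iso ind.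
pose D := \sum_(j < d.-1) v' a' ^+ j.
have D0 : 0 <= D by apply: sumr_ge0 => j _; rewrite exprn_ge0 // (abs_ge0 hv').
have fa' : (map_poly i' f).[a'] = 0 by apply/ker.
have d0 : (0 < d)%N by rewrite -fd size_poly_gt0.
have bd g : v' (map_poly i' g).[a'] <= C * D * v (map_poly i g).[a].
  pose h := g %% f.
  have sh : (size h <= d.-1)%N by rewrite -ltnS (prednK d0) -fd ltn_modp.
  have hE : (map_poly i g).[a] = \sum_(j < d.-1) i h`_j * a ^+ j.
    rewrite [in LHS](divp_eq g f) rmorphD rmorphM /= hornerD hornerM fa mulr0 add0r.
    rewrite (@horner_coef_wide _ d.-1) ?size_map_poly //.
    by apply: eq_bigr => l _; rewrite coef_map.
  have hE' : (map_poly i' g).[a'] = \sum_(j < d.-1) i' h`_j * a' ^+ j.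
    rewrite [in LHS](divp_eq g f) rmorphD rmorphM /= hornerD hornerM fa' mulr0 add0r.
    rewrite (@horner_coef_wide _ d.-1) ?size_map_poly //.
    by apply: eq_bigr => l _; rewrite coef_map.
  rewrite hE'; apply: (le_trans (abs_sum hv' _ _ _)).
  rewrite -mulrA mulrCA mulr_suml; apply: ler_sum => j _.
  rewrite (absM hv') (absX hv') iso' mulrC ler_wpM2l ?exprn_ge0 ?(abs_ge0 hv') //.
  by rewrite hE; apply: (hC (fun j => h`_j) j); exact: ltn_ord.
move=> g; apply: (@pow_le_bounded R _ _ (C * D)); rewrite ?(abs_ge0 hv) ?(abs_ge0 hv') ?mulr_ge0 //.
by move=> n; rewrite -(absX hv) -(absX hv') -!horner_exp -!rmorphXn; exact: bd.
Qed.
End UniqueExtension.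

Lemma unique_extension (R : realType) (k L L' : fieldType) (vk : k -> R)
  (v : L -> R) (v' : L' -> R) (i : {rmorphism k -> L}) (i' : {rmorphism k -> L'}) a a' :
  is_abs vk -> is_abs v -> is_abs v' -> abs_complete vk ->
  (forall c, v (i c) = vk c) -> (forall c, v' (i' c) = vk c) ->
  (forall g, (map_poly i g).[a] = 0 <-> (map_poly i' g).[a'] = 0) ->
  forall m, m != 0 -> (map_poly i m).[a] = 0 ->
  forall g, v' (map_poly i' g).[a'] = v (map_poly i g).[a].
Proof.
move=> hvk hv hv' ck iso iso' ker m m0 ma g; apply/eqP; rewrite eq_le.
rewrite (unique_extension_le hvk hv hv' ck iso iso' ker m0 ma) /=.
apply: (unique_extension_le hvk hv' hv ck iso' iso _ m0); last exact/ker.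
by move=> h; rewrite ker.
Qed.

Definition prime_poly_ideal (k : fieldType) (I : set {poly k}) :=
  [/\ ~ I 1, forall f g, I f -> I g -> I (f + g), forall f g, I f -> I (g * f) &
      forall f g, I (f * g) -> I f \/ I g].

(** Induction on the degree: a prime containing a product contains one of the factors, and over a
    polynomial without proper factors only its own multiples can form a prime. *)
Lemma finite_primes_over (k : fieldType) (m : {poly k}) : m != 0 ->
  finite_set [set I | prime_poly_ideal I /\ I m].
Proof.
move: {2}(size m) (leqnn (size m)) => n; elim: n m => [|n IH] m.
  by rewrite leqn0 size_poly_eq0 => ->.
move=> sm m0.
case: (pselect (exists a b, [/\ m = a * b, (1 < size a)%N & (1 < size b)%N])).
  move=> [a [b [mE sa sb]]].
  have a0 : a != 0 by apply: contraTneq sa => ->; rewrite size_poly0.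
  have b0 : b != 0 by apply: contraTneq sb => ->; rewrite size_poly0.
  have smab : size m = (size a + size b).-1 by rewrite mE size_mul.
  have ha : finite_set [set I | prime_poly_ideal I /\ I a].
    by apply: IH => //; rewrite smab in sm; case: (size a) (size b) sa sb sm => [|p] [|[|q]] //= _ _; rewrite addnS ltnS; apply: leq_trans; rewrite addnS ltnS leq_addr.
  have hb : finite_set [set I | prime_poly_ideal I /\ I b].
    by apply: IH => //; rewrite smab in sm; case: (size a) (size b) sa sb sm => [|[|p]] [|q] //= _ _; rewrite !addSn !ltnS addnC; apply: leq_trans; rewrite addSn ltnS leq_addr.
  apply: sub_finite_set (_ : _ `<=` [set I | prime_poly_ideal I /\ I a] `|` [set I | prime_poly_ideal I /\ I b]) _; last by rewrite finite_setU.
  by move=> I [pI Im]; rewrite mE in Im; case: (pI) => _ _ _ /(_ _ _ Im)[]; [left|right].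
move=> irr.
(* A prime containing m and some g not divisible by m would contain 1 by Bezout, unless their gcd
   were a proper factor of m. *)
apply: (@sub_finite_set _ _ [set [set g | m %| g]]); last exact: finite_set1.
move=> I [[I1 ID IM IP] Im] /=.
apply/seteqP; split=> g /=; last first.
  by move=> /dvdpP[q ->]; exact: IM.
move=> Ig; apply: contrapT => ndv.
have ndI : ~ coprimep m g.
  move=> /Bezout_eq1_coprimepP[[u w] /= e]; apply: I1; rewrite -e.
  by apply: ID; apply: IM.
have /dvdpP[q mE] := dvdp_gcdl m g.
apply: irr; exists q, (gcdp m g); split=> //; last first.
  have : gcdp m g != 0 by rewrite gcdp_eq0 negb_and m0.
  rewrite -size_poly_gt0 leq_eqVlt => /predU1P[e|//].
  by case: ndI; rewrite /coprimep -e.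
rewrite ltnNge; apply/negP => sq; apply: ndv; rewrite mE (size1_polyC sq) mul_polyC.
have [q0|q0] := eqVneq q`_0 0.
  by move: m0; rewrite mE (size1_polyC sq) q0 polyC0 mul0r eqxx.
by rewrite dvdpZl // dvdp_gcdr.
Qed.

(** The graph of an isometric isomorphism between closed subfields of L and L', encoded as a
    relation because neither subfield is the whole field in general. Closedness ([ic_lim]) lets
    limits of iterations correspond. *)
Record isom_corr (R : realType) (L L' : fieldType) (v : L -> R) (v' : L' -> R)
    (r : L -> L' -> Prop) : Prop := IsomCorr {
  ic_iso : forall e e', r e e' -> v e = v' e';
  ic_D : forall e e' f f', r e e' -> r f f' -> r (e + f) (e' + f');
  ic_N : forall e e', r e e' -> r (- e) (- e');
  ic_M : forall e e' f f', r e e' -> r f f' -> r (e * f) (e' * f');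
  ic_V : forall e e', r e e' -> r e^-1 e'^-1;
  ic_lim : forall e e', (forall eps, 0 < eps -> exists d d',
    [/\ r d d', v (e - d) < eps & v' (e' - d') < eps]) -> r e e' }.

Lemma abs_mul_est (R : realType) (F : fieldType) (w : F -> R) (hw : is_abs w) (x y x1 y1 : F) (d eps A B : R) :
  0 < d -> d <= 1 -> w x <= A -> w y <= B -> d * (A + B + 1) <= eps ->
  w (x - x1) < d -> w (y - y1) < d -> w (x * y - x1 * y1) < eps.
Proof.
move=> d0 d1 hA hB he h1 h2.
have -> : x * y - x1 * y1 = x * (y - y1) + y1 * (x - x1) by ring.
apply: (le_lt_trans (absD hw _ _)); rewrite !(absM hw).
have y1B : w y1 <= B + d by have := abs_le_near hw y1 y; rewrite (absB hw y1); lra.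
have A0 : 0 <= A by apply: le_trans hA; exact: (abs_ge0 hw).
have B0 : 0 <= B by apply: le_trans hB; exact: (abs_ge0 hw).
have f1 : w x * w (y - y1) <= A * d by apply: ler_pM; rewrite ?(abs_ge0 hw) // ltW.
have f2 : w y1 * w (x - x1) <= w y1 * d by rewrite ler_wpM2l ?(abs_ge0 hw) // ltW.
have f3 : w y1 * w (x - x1) <= (B + d) * w (x - x1) by rewrite ler_wpM2r ?(abs_ge0 hw).
have f4 : (B + d) * w (x - x1) < (B + d) * d by rewrite ltr_pM2l //; lra.
have f5 : d * d <= d by rewrite -[leRHS]mulr1 ler_pM2l.
lra.
Qed.

Lemma abs_inv_est (R : realType) (F : fieldType) (w : F -> R) (hw : is_abs w) (x y : F) (d eps : R) :
  x != 0 -> d <= w x / 2 -> 2 * d <= eps * w x ^+ 2 -> w (x - y) < d ->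
  y != 0 /\ w (x^-1 - y^-1) < eps.
Proof.
move=> x0 hd he h; have wx : 0 < w x by rewrite (abs_gt0 hw).
have wy : w x / 2 < w y by have := abs_le_near hw x y; lra.
have y0 : y != 0 by rewrite -(abs_gt0 hw); lra.
split => //; have -> : x^-1 - y^-1 = (y - x) / (x * y) by field; rewrite x0 y0.
rewrite (absM hw) (absV hw) (absM hw) (absB hw) ltr_pdivrMr; last by rewrite mulr_gt0 //; lra.
apply: (lt_le_trans h); have e0 : 0 <= eps.
  have : 0 <= eps * w x ^+ 2 by apply: le_trans he; have := abs_ge0 hw (x - y); lra.
  by rewrite pmulr_lge0 // exprn_gt0.
have : eps * (w x * (w x / 2)) <= eps * (w x * w y).
  by rewrite ler_wpM2l // ler_wpM2l // ltW.
have -> : eps * (w x * (w x / 2)) = eps * w x ^+ 2 / 2 by rewrite expr2; field.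
lra.
Qed.

Lemma abs_sub_est (R : realType) (F : fieldType) (w : F -> R) (hw : is_abs w) (a b c d : F) (e : R) :
  w (a - c) <= e / 2 -> w (b - d) <= e / 2 -> w (a - b - (c - d)) <= e.
Proof.
move=> h1 h2; have -> : a - b - (c - d) = (a - c) - (b - d) by ring.
by apply: (le_trans (absBD hw _ _)); lra.
Qed.

Lemma dist3_est (R : realType) (a b c d e : R) : `|a - c| <= e / 3 -> `|b - d| <= e / 3 ->
  `|c - d| <= e / 3 -> `|a - b| <= e.
Proof.
rewrite !ler_norml => /andP[k1 k2] /andP[k3 k4] /andP[k5 k6].
by apply/andP; split; lra.
Qed.

Section Closure.
Variables (R : realType) (L L' : fieldType) (v : L -> R) (v' : L' -> R).
Variable (D : L -> L' -> Prop).
Hypotheses (hv : is_abs v) (hv' : is_abs v').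
Hypothesis D_iso : forall e e', D e e' -> v e = v' e'.
Hypothesis D_D : forall e e' f f', D e e' -> D f f' -> D (e + f) (e' + f').
Hypothesis D_N : forall e e', D e e' -> D (- e) (- e').
Hypothesis D_M : forall e e' f f', D e e' -> D f f' -> D (e * f) (e' * f').
Hypothesis D_V : forall e e', D e e' -> D e^-1 e'^-1.

Definition corr_closure (e : L) (e' : L') := forall eps, 0 < eps ->
  exists d d', [/\ D d d', v (e - d) < eps & v' (e' - d') < eps].

Lemma corr_closure_sub d d' : D d d' -> corr_closure d d'.
Proof. by move=> h eps e0; exists d, d'; rewrite !subrr (abs0 hv) (abs0 hv'). Qed.

Let corr_iso e e' : corr_closure e e' -> v e = v' e'.
Proof.
move=> h; apply/eqP; rewrite -subr_eq0 -normr_eq0 eq_le normr_ge0 andbT.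
apply/ler_addgt0Pr => eps e0; rewrite add0r.
have [d [d' [hd h1 h2]]] := h _ (divr_gt0 e0 (ltr0n _ 2)).
have h3 := abs_dist hv e d; have h4 := abs_dist hv' e' d'.
rewrite -(D_iso hd) in h4; have := ler_normB (v e - v d) (v' e' - v d).
have -> : v e - v d - (v' e' - v d) = v e - v' e' by ring.
lra.
Qed.

Lemma corr_closure_isom : isom_corr v v' corr_closure.
Proof.
split; first exact: corr_iso.
- move=> e e' f f' h1 h2 eps e0.
  have [g [g' [g0 g1 g2]]] := h1 _ (divr_gt0 e0 (ltr0n _ 2)).
  have [h [h' [h0 h3 h4]]] := h2 _ (divr_gt0 e0 (ltr0n _ 2)).
  exists (g + h), (g' + h'); split; first exact: D_D.
    rewrite opprD addrACA; apply: (le_lt_trans (absD hv _ _)); lra.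
  rewrite opprD addrACA; apply: (le_lt_trans (absD hv' _ _)); lra.
- move=> e e' h eps e0; have [g [g' [g0 g1 g2]]] := h _ e0; exists (- g), (- g').
  by rewrite -!opprD (absN hv) (absN hv'); split=> //; exact: D_N.
- move=> e e' f f' h1 h2 eps e0.
  pose B := v e + v f + 1.
  have B0 : 0 < B by rewrite ltr_wpDl // addr_ge0 // (abs_ge0 hv).
  pose d := Num.min 1 (eps / B).
  have d0 : 0 < d by rewrite lt_min ltr01 divr_gt0.
  have d1 : d <= 1 by rewrite ge_min lexx.
  have dD : d * B <= eps by rewrite -ler_pdivlMr // ge_min lexx orbT.
  have [g [g' [g0 g1 g2]]] := h1 _ d0; have [h [h' [h0 h3 h4]]] := h2 _ d0.
  exists (g * h), (g' * h'); split; first exact: D_M.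
    exact: (abs_mul_est hv d0 d1 (lexx _) (lexx _) dD g1 h3).
  apply: (abs_mul_est hv' d0 d1 _ _ dD g2 h4); by rewrite -(corr_iso h1, corr_iso h2).
- move=> e e' h; have he := corr_iso h.
  case: (eqVneq e 0) => [e0|e0].
    have -> : e' = 0 by apply/(abs_eq0 hv'); rewrite -he e0 (abs0 hv).
    move=> eps eps0; have [d [d' [hd _ _]]] := h _ eps0.
    exists 0, 0; rewrite e0 !invr0 !subr0 (abs0 hv) (abs0 hv'); split=> //.
    by have := D_D hd (D_N hd); rewrite !subrr.
  have e'0 : e' != 0 by rewrite -(abs_gt0 hv') -he (abs_gt0 hv).
  have ve0 : 0 < v e by rewrite (abs_gt0 hv).
  move=> eps eps0.
  pose d := Num.min (v e / 2) (eps * v e ^+ 2 / 2).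
  have d0 : 0 < d by rewrite lt_min !divr_gt0 // mulr_gt0 // exprn_gt0.
  have d1 : d <= v e / 2 by rewrite ge_min lexx.
  have d2 : 2 * d <= eps * v e ^+ 2.
    by rewrite mulrC -ler_pdivlMr // ge_min lexx orbT.
  have [g [g' [g0 g1 g2]]] := h _ d0.
  have [n1 h1] := abs_inv_est hv e0 d1 d2 g1.
  rewrite he in d1 d2; have [n2 h2] := abs_inv_est hv' e'0 d1 d2 g2.
  by exists g^-1, g'^-1; split=> //; exact: D_V.
- move=> e e' h eps e0.
  have [d [d' [h1 h2 h3]]] := h _ (divr_gt0 e0 (ltr0n _ 2)).
  have [g [g' [g0 g1 g2]]] := h1 _ (divr_gt0 e0 (ltr0n _ 2)).
  exists g, g'; split=> //.
    by apply: (le_lt_trans (abs_triang hv _ d _)); lra.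
  by apply: (le_lt_trans (abs_triang hv' _ d' _)); lra.
Qed.
End Closure.

Section Correspondence.
Variables (R : realType) (k L L' : fieldType) (vk : k -> R) (v : L -> R) (v' : L' -> R).
Variables (i : {rmorphism k -> L}) (i' : {rmorphism k -> L'}) (a : L) (a' : L').
Hypotheses (hvk : is_abs vk) (hv : is_abs v) (hv' : is_abs v') (ck : abs_complete vk).
Hypotheses (iso : forall c, v (i c) = vk c) (iso' : forall c, v' (i' c) = vk c).
Hypothesis ker : forall g, (map_poly i g).[a] = 0 <-> (map_poly i' g).[a'] = 0.
Variable m : {poly k}.
Hypotheses (m0 : m != 0) (ma : (map_poly i m).[a] = 0).

Let ev g := (map_poly i g).[a].
Let ev' g := (map_poly i' g).[a'].

Let evE g : v' (ev' g) = v (ev g).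
Proof. exact: (unique_extension hvk hv hv' ck iso iso' ker m0 ma). Qed.

(** A Bezout relation with the minimal annihilator of a yields one polynomial h that inverts g at a
    and at a' simultaneously; this is what makes the correspondence stable under inversion. *)
Let ev_inv g : ev g != 0 -> exists h, ev h * ev g = 1 /\ ev' h * ev' g = 1.
Proof.
move=> g0.
have [d dd dmin] := @ex_minnP (fun d => `[< exists g : {poly k},
   [/\ g != 0, ev g = 0 & size g = d] >])
   (ex_intro _ (size m) (asboolT (ex_intro _ m (And3 m0 ma erefl)))).
move/asboolP: dd => [f [f0 fa fd]].
have evM p q : ev (p * q) = ev p * ev q by rewrite /ev rmorphM hornerM.
have cop : coprimep f g.
  have /dvdpP[q fE] := dvdp_gcdl f g.
  have /dvdpP[q' gE] := dvdp_gcdr f g.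
  have d0 : ev (gcdp f g) != 0.
    by apply: contraNneq g0 => e; rewrite gE evM e mulr0.
  have q0 : q != 0 by apply: contraNneq f0 => e; rewrite fE e mul0r.
  have h0 : gcdp f g != 0 by apply: contraNneq d0 => ->; rewrite /ev rmorph0 horner0.
  have qa : ev q = 0 by apply/eqP; have := fa; rewrite fE evM => /eqP; rewrite mulf_eq0 (negbTE d0) orbF.
  have := dmin _ (asboolT (ex_intro _ q (And3 q0 qa erefl))).
  have sf : size f = (size q + size (gcdp f g)).-1 by rewrite {1}fE size_mul.
  rewrite -fd sf /coprimep.
  have : (0 < size (gcdp f g))%N by rewrite size_poly_gt0.
  by case: (size (gcdp f g)) => [|[|n]] // _; rewrite !addnS /= ltnNge leq_addr.
have [[u w] /= e] := Bezout_eq1_coprimepP _ _ cop.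
have fa' : ev' f = 0 by apply/ker.
exists w; split.
  have := congr1 ev e; rewrite /ev rmorphD !rmorphM hornerD !hornerM -/(ev f) fa mulr0 add0r.
  by move=> ->; rewrite rmorph1 hornerC.
have := congr1 ev' e; rewrite /ev' rmorphD !rmorphM hornerD !hornerM -/(ev' f) fa' mulr0 add0r.
by move=> ->; rewrite rmorph1 hornerC.
Qed.

(** The closure of the identification of g(a) with g(a'): isometric by uniqueness of the extension,
    stable under inverses since a is algebraic. *)
Lemma exists_corr : exists r, [/\ isom_corr v v' r, forall c, r (i c) (i' c) & r a a'].
Proof.
pose D e e' := exists g, e = ev g /\ e' = ev' g.
have hD : isom_corr v v' (corr_closure v v' D).
  apply: corr_closure_isom => //.
  - by move=> _ _ [g [-> ->]]; rewrite evE.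
  - by move=> _ _ _ _ [g [-> ->]] [h [-> ->]]; exists (g + h); rewrite /ev /ev' !rmorphD !hornerD.
  - by move=> _ _ [g [-> ->]]; exists (- g); rewrite /ev /ev' !rmorphN !hornerN.
  - by move=> _ _ _ _ [g [-> ->]] [h [-> ->]]; exists (g * h); rewrite /ev /ev' !rmorphM !hornerM.
  - move=> _ _ [g [-> ->]]; case: (eqVneq (ev g) 0) => [g0|g0].
      exists 0; have -> : ev' g = 0 by apply/ker.
      by rewrite g0 !invr0 /ev /ev' !rmorph0 !horner0.
    have [h [h1 h2]] := ev_inv g0; exists h; split.
      by apply: (mulIf g0); rewrite h1 mulVf.
    have g0' : ev' g != 0 by rewrite -(abs_gt0 hv') evE (abs_gt0 hv).
    by apply: (mulIf g0'); rewrite h2 mulVf.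
exists (corr_closure v v' D); split=> //.
  move=> c; apply: corr_closure_sub => //; exists c%:P.
  by rewrite /ev /ev' !map_polyC !hornerC.
apply: corr_closure_sub => //; exists 'X.
by rewrite /ev /ev' !map_polyX !hornerX.
Qed.
End Correspondence.

Section CorrespondenceTheory.
Variables (R : realType) (L L' : fieldType) (v : L -> R) (v' : L' -> R) (r : L -> L' -> Prop).
Hypothesis hr : isom_corr v v' r.

Lemma ic_0 e e' : r e e' -> r 0 0.
Proof. by move=> h; have := ic_D hr h (ic_N hr h); rewrite !subrr. Qed.

Lemma ic_sum (I : Type) (s : seq I) (F : I -> L) (F' : I -> L') : r 0 0 ->
  (forall j, r (F j) (F' j)) -> r (\sum_(j <- s) F j) (\sum_(j <- s) F' j).
Proof.
move=> r0 h; elim: s => [|j s IH]; first by rewrite !big_nil.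
by rewrite !big_cons; exact: (ic_D hr).
Qed.

Lemma ic_horner (k : fieldType) (i : {rmorphism k -> L}) (i' : {rmorphism k -> L'}) :
  (forall c, r (i c) (i' c)) -> forall (p : {poly k}) x x', r x x' ->
  r (map_poly i p).[x] (map_poly i' p).[x'].
Proof.
move=> hi p x x' hx; elim/poly_ind: p => [|p c IH].
  by rewrite !rmorph0 !horner0; exact: ic_0 hx.
rewrite !rmorphD !rmorphM /= !map_polyX !map_polyC !hornerE.
by apply: (ic_D hr); [apply: (ic_M hr)|exact: hi].
Qed.
End CorrespondenceTheory.

Definition newton_step (L : fieldType) N J (M : {poly L}) (P : 'I_N -> {poly L})
    (a : 'I_J -> L) (f0 : 'I_J -> ('I_N -> L) -> L) (f : 'I_N -> 'I_J -> ('I_N -> L) -> L)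
    (c : L) (s : L * ('I_N -> L)) : L * ('I_N -> L) :=
  (s.1 - c^-1 * (M.[s.1] - \sum_j a j * f0 j s.2),
   fun n => (P n).[s.1] + \sum_j a j * f n j s.2).

Lemma abs_muln (R : realType) (L : fieldType) (v : L -> R) : is_abs v ->
  forall x k, v (x *+ k) <= v x *+ k.
Proof.
move=> hv x; elim=> [|k IH]; first by rewrite !mulr0n (abs0 hv).
by rewrite !mulrS; apply: (le_trans (absD hv _ _)); rewrite lerD2l.
Qed.

(** The two unknowns are measured with different weights, so that the
    coefficients of [P] need not be small for the step to be a contraction. *)
Lemma newton_system (R : realType) (C rho dlt Lam Bf sg : R) (n : nat) :
  0 <= C -> 0 <= rho -> 0 < dlt -> 0 <= Lam -> 0 <= Bf -> 0 < sg ->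
  exists2 eps, 0 < eps &
  forall (L : fieldType) (v : L -> R) N J (M : {poly L}) (P : 'I_N -> {poly L})
    (a : 'I_J -> L) (f0 : 'I_J -> ('I_N -> L) -> L) (f : 'I_N -> 'I_J -> ('I_N -> L) -> L)
    (th : L) (T : 'I_N -> L),
  is_abs v -> abs_complete v ->
  (size M <= n)%N -> (forall m, v M`_m <= C) ->
  (forall i, (size (P i) <= n)%N /\ forall m, v (P i)`_m <= C) ->
  v th <= rho -> dlt <= v M^`().[th] ->
  (forall j, v (f0 j T) <= Bf) -> (forall i j, v (f i j T) <= Bf) ->
  (forall j u E, 0 <= E -> E <= sg -> (forall i, v (u i - T i) <= E) ->
     v (f0 j u - f0 j T) <= Lam * E) ->
  (forall l j u E, 0 <= E -> E <= sg -> (forall i, v (u i - T i) <= E) ->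
     v (f l j u - f l j T) <= Lam * E) ->
  M.[th] = \sum_j a j * f0 j T ->
  (forall i, T i = (P i).[th] + \sum_j a j * f i j T) ->
  \sum_j v (a j) <= eps ->
  exists al, M.[al] = 0 /\
    let s k := iter k (newton_step M P a f0 f M^`().[al]) (al, fun i => (P i).[al]) in
    (forall k i, v ((s k).2 i - T i) <= sg) /\
    (forall i, abs_cvg v (fun k => (s k).2 i) (T i)).
Proof.
move=> C0 rho0 dlt0 Lam0 Bf0 sg0.
have C'0 : 0 <= C * n%:R + C by rewrite addr_ge0 // mulr_ge0.
have rho1 : 0 <= rho + 1 by rewrite addr_ge0.
have [K1 K10 hK1] := poly_estimates n C'0 rho1.
pose K := K1 + 1; have K0 : 1 <= K by rewrite /K; lra.
have Kp : 0 < K by lra.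
have dn0 : dlt != 0 by rewrite gt_eqF.
have Kn0 : K != 0 by rewrite gt_eqF.
(* In the ball of this radius around th, the simplified Newton map for M has contraction factor 1 /
   2, and M' keeps at least half of [dlt]. *)
pose rad := Num.min 1 (dlt / (4 * K)).
have rad0 : 0 < rad by rewrite lt_min ltr01 divr_gt0 // mulr_gt0.
have rad1 : rad <= 1 by rewrite ge_min lexx.
have radK : rad * (4 * K) <= dlt by rewrite -ler_pdivlMr ?mulr_gt0 // ge_min lexx orbT.
pose dv (c d : R) := d / (c + 1).
have dv0 c d : 0 <= c -> 0 < d -> 0 < dv c d by move=> c0 d0; rewrite divr_gt0 // ltr_wpDl.
have dvE c d e : 0 <= c -> 0 < d -> 0 <= e -> e <= dv c d -> c * e <= d.
  move=> c0 d0 e0; rewrite /dv ler_pdivlMr ?ltr_wpDl //; lra.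
(* Coefficients of eps: c1 * eps bounds the distance from th to the root al, c2 * eps the initial
   error, (c3 + c4) * eps the contraction factor for th. Demanding 1 / 4 of the last two summands,
   and of Lam * eps, halves the error at each step. *)
pose c1 := 2 * Bf / dlt.
pose c2 := (8 * K / dlt + 1) * Bf.
pose c3 := 2 * K / dlt * (6 / dlt + (4 * K)^-1) * Bf.
pose c4 := 8 * K * Lam / dlt.
have c10 : 0 <= c1 by rewrite /c1 divr_ge0 // ?mulr_ge0 // ltW.
have c20 : 0 <= c2 by rewrite /c2 mulr_ge0 // addr_ge0 // divr_ge0 // ?mulr_ge0 // ltW.
have c30 : 0 <= c3.
  rewrite /c3 !mulr_ge0 ?addr_ge0 ?invr_ge0 ?divr_ge0 ?mulr_ge0 ?invr_ge0 //; exact: ltW.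
have c40 : 0 <= c4 by rewrite /c4 divr_ge0 ?mulr_ge0 // ltW.
have q0 : 0 < 4^-1 :> R by rewrite invr_gt0.
exists (Num.min (dv c1 rad) (Num.min (dv c2 sg) (Num.min (dv c2 (4 * K))
   (Num.min (dv c3 4^-1) (Num.min (dv c4 4^-1) (dv Lam 4^-1)))))).
  by rewrite !lt_min !dv0 ?mulr_gt0.
move=> L v N J M P a f0 f th T hv cv sM hM hP hth hd bf0 bf lf0 lf eM eT.
set eps := \sum_j v (a j); rewrite !le_min => /and5P[e1 e2 e3 e4 /andP[e5 e6]].
have eps0 : 0 <= eps by apply: sumr_ge0 => j _; exact: (abs_ge0 hv).
have {e1}e1 := dvE _ _ _ c10 rad0 eps0 e1.
have {e2}e2 := dvE _ _ _ c20 sg0 eps0 e2.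
have {e3}e3 := dvE _ _ _ c20 (mulr_gt0 (ltr0n _ 4) Kp) eps0 e3.
have {e4}e4 := dvE _ _ _ c30 q0 eps0 e4.
have {e5}e5 := dvE _ _ _ c40 q0 eps0 e5.
have {e6}e6 := dvE _ _ _ Lam0 q0 eps0 e6.
have sume (g : 'I_J -> L) b : 0 <= b -> (forall j, v (g j) <= b) ->
    v (\sum_j a j * g j) <= eps * b.
  move=> b0 hg; apply: (le_trans (abs_sum hv _ _ _)); rewrite mulr_suml.
  by apply: ler_sum => j _; rewrite (absM hv) ler_wpM2l ?(abs_ge0 hv).
have CC : C <= C * n%:R + C by rewrite lerDr mulr_ge0.
have estK (p : {poly L}) : (size p <= n)%N -> (forall m, v p`_m <= C * n%:R + C) ->
    forall x y w, v x <= rho + 1 -> v y <= rho + 1 -> v w <= rho + 1 ->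
    v (p.[x] - p.[y]) <= K * v (x - y) /\
    v (p.[x] - p.[y] - p^`().[w] * (x - y)) <= K * (v (x - w) + v (y - w)) * v (x - y).
  move=> sp hp x y w hx hy hw; have [_ h1 h2] := hK1 L v p hv sp hp x y w hx hy hw.
  have x0 : 0 <= v (x - y) by exact: (abs_ge0 hv).
  split; first by rewrite /K; lra.
  apply: (le_trans h2); rewrite ler_wpM2r // ler_wpM2r ?addr_ge0 ?(abs_ge0 hv) //.
  by rewrite /K; lra.
have hM' m : v M`_m <= C * n%:R + C by apply: le_trans (hM m) CC.
have hP' i m : v (P i)`_m <= C * n%:R + C by apply: le_trans ((hP i).2 m) CC.
have hdM m : v M^`()`_m <= C * n%:R + C.
  rewrite coef_deriv; case: (ltnP m.+1 (size M)) => hm; last first.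
    by rewrite nth_default // mul0rn (abs0 hv).
  apply: (le_trans (abs_muln hv _ _)); rewrite -[leLHS]mulr_natr.
  apply: (@le_trans _ _ (C * n%:R)); last by rewrite lerDl.
  by apply: ler_pM; rewrite ?(abs_ge0 hv) // ler_nat (leq_trans (ltnW hm)).
have sdM : (size M^`() <= n)%N.
  apply: leq_trans sM; have [->|M0] := eqVneq M 0; first by rewrite deriv0.
  exact/ltnW/lt_size_deriv.
have near_rho x : v (x - th) <= 1 -> v x <= rho + 1 by have := abs_le_near hv x th; lra.
have thr : v th <= rho + 1 by lra.
set c0 := M^`().[th] in hd.
have vc0 : 0 < v c0 by lra.
have c0n : c0 != 0 by rewrite -(abs_gt0 hv).
have vM : v M.[th] <= eps * Bf by rewrite eM; exact: sume.
have dE : (v c0)^-1 <= dlt^-1 by rewrite lef_pV2 ?posrE.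
pose G x := x - c0^-1 * M.[x].
pose tau := 2 * (eps * Bf / dlt).
have tauE : tau = c1 * eps by rewrite /tau /c1; ring.
have tau_rad : tau <= rad by rewrite tauE.
have Gth : v (G th - th) <= eps * Bf / dlt.
  rewrite /G addrAC subrr add0r (absN hv) (absM hv) (absV hv) mulrC.
  by apply: ler_pM; rewrite ?invr_ge0 ?(abs_ge0 hv).
(* M(th) is of size eps, so the simplified Newton map started at th finds an exact root of M
   nearby. *)
have [||al Gal al_th] := @fixed_point R L v hv cv G th rad.
- move=> x y hx hy.
  have [_ h] := estK M sM hM' x y th (near_rho x (le_trans hx rad1)) (near_rho y (le_trans hy rad1)) thr.
  have -> : G x - G y = - (c0^-1 * (M.[x] - M.[y] - c0 * (x - y))).
    by rewrite /G; field.
  rewrite (absN hv) (absM hv) (absV hv) mulrC ler_pdivrMr //.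
  apply: (le_trans h).
  have x0 : 0 <= v (x - y) by exact: (abs_ge0 hv).
  have h1 : K * (v (x - th) + v (y - th)) <= K * (rad + rad) by rewrite ler_pM2l //; exact: lerD.
  rewrite [leRHS](_ : _ = (v c0 / 2) * v (x - y)); last by ring.
  by rewrite ler_wpM2r //; lra.
- by apply: (le_trans Gth); move: tau_rad; rewrite /tau; lra.
have {}al_th : v (al - th) <= tau by rewrite /tau; lra.
have Mal : M.[al] = 0.
  have : c0^-1 * M.[al] = 0.
    by have := congr1 (fun x => al - x) Gal; rewrite /G subrr opprB addrC subrK.
  by move/eqP; rewrite mulf_eq0 invr_eq0 (negbTE c0n) => /eqP.
have tau0 : 0 <= tau by apply: le_trans al_th; exact: (abs_ge0 hv).
have alr : v al <= rho + 1 by apply: near_rho; lra.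
set c := M^`().[al].
have vc : dlt / 2 <= v c.
  have [h _] := estK _ sdM hdM th al th thr alr thr.
  have h1 := abs_le_near hv c0 c.
  have h2 : K * v (th - al) <= K * rad by rewrite ler_pM2l // (absB hv); lra.
  by move: h h1; rewrite -/c0 -/c; lra.
have vcp : 0 < v c by apply: lt_le_trans vc; rewrite divr_gt0.
have cn : c != 0 by rewrite -(abs_gt0 hv).
have vcV : (v c)^-1 <= 2 / dlt by rewrite -invf_div lef_pV2 ?posrE // divr_gt0.
pose E0 := 4 * K * tau + eps * Bf.
have E0E : E0 = c2 * eps by rewrite /E0 /tau /c2; field.
have E0sg : E0 <= sg by rewrite E0E.
have E0K : E0 <= 4 * K by rewrite E0E.
have eB0 : 0 <= eps * Bf by rewrite mulr_ge0.
have Kt0 : 0 <= K * tau by rewrite mulr_ge0 // ltW.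
have E00 : 0 <= E0 by rewrite /E0; lra.
pose E k := E0 * 2^-1 ^+ k.
have Ek0 k : 0 <= E k by rewrite mulr_ge0 // exprn_ge0 // invr_ge0.
have EkS k : E k.+1 = E k / 2 by rewrite /E exprSr mulrA.
have EkE0 k : E k <= E0.
  by rewrite /E -[leRHS]mulr1 ler_wpM2l // exprn_ile1 // ?invr_ge0 // invf_le1 // ler1n.
exists al; split => // s.
(* With weight 4 * K on th, the terms P_i contribute at most E k / 4 to the next error of T, however
   large their coefficients. *)
have inv k : 4 * K * v ((s k).1 - th) <= E k /\ forall i, v ((s k).2 i - T i) <= E k.
  elim: k => [|k [IH1 IH2]].
    rewrite /E expr0 mulr1 /=; split.
      have : 4 * K * v (al - th) <= 4 * K * tau by rewrite ler_pM2l // mulr_gt0.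
      by rewrite /E0; lra.
    move=> i; rewrite eT opprD addrA; apply: (le_trans (absBD hv _ _)).
    have [h _] := estK _ (hP i).1 (hP' i) al th th alr thr thr.
    have h1 : K * v (al - th) <= K * tau by rewrite ler_pM2l.
    have := sume (fun j => f i j T) Bf Bf0 (bf i); rewrite /E0; lra.
  set y := (s k).1 in IH1 *; set u := (s k).2 in IH2 *.
  have y1 : v (y - th) <= E k / (4 * K) by rewrite ler_pdivlMr ?mulr_gt0 // mulrC.
  have yr : v y <= rho + 1.
    apply: near_rho; apply: (le_trans y1); rewrite ler_pdivrMr ?mulr_gt0 // mul1r.
    exact: le_trans (EkE0 k) _.
  have Esg : E k <= sg by exact: le_trans (EkE0 k) _.
  have LE0 : 0 <= Lam * E k by rewrite mulr_ge0.
  have epsL : eps * (Lam * E k) <= E k / 4.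
    by rewrite mulrA [eps * _]mulrC [leRHS]mulrC ler_wpM2r.
  have -> : s k.+1 = newton_step M P a f0 f c (s k) by [].
  rewrite EkS; split=> /=; rewrite -/y -/u; last first.
    move=> i; rewrite eT.
    have -> : (P i).[y] + \sum_j a j * f i j u - ((P i).[th] + \sum_j a j * f i j T) =
      ((P i).[y] - (P i).[th]) + \sum_j a j * (f i j u - f i j T).
      by under [in RHS]eq_bigr => j _ do rewrite mulrBr; rewrite sumrB; ring.
    apply: (le_trans (absD hv _ _)).
    have [h _] := estK _ (hP i).1 (hP' i) y th th yr thr thr.
    have := sume (fun j => f i j u - f i j T) _ LE0 (fun j => lf i j u _ (Ek0 k) Esg IH2).
    lra.
  have -> : y - c^-1 * (M.[y] - \sum_j a j * f0 j u) - th =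
     - (c^-1 * ((M.[y] - M.[th] - c * (y - th)) - \sum_j a j * (f0 j u - f0 j T))).
    under [in RHS]eq_bigr => j _ do rewrite mulrBr.
    by rewrite sumrB -eM; field.
  rewrite (absN hv) (absM hv) (absV hv).
  set X := v (_ - _ - _).
  have hX : X <= K * (v (y - al) + v (th - al)) * v (y - th) + eps * (Lam * E k).
    apply: (le_trans (absBD hv _ _)); apply: lerD.
      by have [_ h] := estK _ sM hM' y th al yr thr alr.
    exact: (sume (fun j => f0 j u - f0 j T) _ LE0 (fun j => lf0 j u _ (Ek0 k) Esg IH2)).
  have X0 : 0 <= X by exact: (abs_ge0 hv).
  have hya : v (y - al) + v (th - al) <= E0 / (4 * K) + 2 * tau.
    have h1 := abs_triang hv y th al; rewrite (absB hv th) in h1 *.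
    have h2 : E k / (4 * K) <= E0 / (4 * K) by rewrite ler_pM2r ?invr_gt0 ?mulr_gt0.
    lra.
  have hX2 : X <= K * (E0 / (4 * K) + 2 * tau) * (E k / (4 * K)) + eps * (Lam * E k).
    apply: (le_trans hX); rewrite lerD2r; apply: ler_pM; rewrite ?(abs_ge0 hv) //.
      by rewrite mulr_ge0 ?addr_ge0 ?(abs_ge0 hv) // ltW.
    by rewrite ler_pM2l.
  apply: (@le_trans _ _ (4 * K * (2 / dlt * X))).
    by rewrite ler_pM2l ?mulr_gt0 // ler_wpM2r.
  apply: (@le_trans _ _ (4 * K * (2 / dlt * (K * (E0 / (4 * K) + 2 * tau) * (E k / (4 * K)) + eps * (Lam * E k))))).
    by rewrite ler_pM2l ?mulr_gt0 // ler_pM2l // divr_gt0.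
  have -> : 4 * K * (2 / dlt * (K * (E0 / (4 * K) + 2 * tau) * (E k / (4 * K)) + eps * (Lam * E k)))
    = (c3 * eps + c4 * eps) * E k.
    by rewrite /E0 /tau /c3 /c4; field; rewrite dn0 Kn0.
  by rewrite [leRHS]mulrC ler_wpM2r //; lra.
split=> [k i|i e e0].
  by apply: (le_trans ((inv k).2 i)); exact: le_trans (EkE0 k) _.
have [N' hN'] := half_pow_lt E00 e0; exists N' => k Nk.
by apply: (le_lt_trans ((inv k).2 i)); exact: hN'.
Qed.

(** * Quotients, localizations and completions *)

Lemma ideal_gen_id (R : comPzRingType) (I : set R) : is_ideal I -> ideal_gen I = I.
Proof.
move=> hI; apply/seteqP; split=> [a h|a Ia M [hM]]; last exact.
by apply: (h I); split.
Qed.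

Lemma subring_predP (R : comPzRingType) (S : set R) : is_subring S ->
  forall a, subring_pred S a <-> S a.
Proof.
move=> hS a; split=> [/asboolP h|Sa]; first by apply: (h S); split.
by apply/asboolP => M [hM]; apply.
Qed.

Lemma sr_valP (R : comPzRingType) (S : set R) : is_subring S ->
  forall a : subring S, S (sr_val a).
Proof. by move=> hS [a h]; apply/(subring_predP hS). Qed.

Lemma sr_inK (R : comPzRingType) (S : set R) : is_subring S ->
  forall a, S a -> sr_val (sr_in S a) = a.
Proof.
move=> hS a Sa; rewrite /sr_in -[sr_val _]/(val _) val_insubd.
by rewrite ((subring_predP hS a).2 Sa).
Qed.

Section QuotTheory.
Variables (R : comPzRingType) (I : set R).

Lemma qpiP_eq (a b : R) : qpi I a = qpi I b <-> ideal_gen I (a - b).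
Proof.
split; last exact: qpiE.
move/eqP; rewrite /qpi eqmodE => /asboolP //.
Qed.

Let J0 := let: And3 h _ _ := ideal_gen_ideal I in h.
Let JD := let: And3 _ h _ := ideal_gen_ideal I in h.
Let JM := let: And3 _ _ h := ideal_gen_ideal I in h.

Lemma qpiD a b : qpi I (a + b) = qpi I a + qpi I b.
Proof.
apply/esym/qpiE.
have -> (u v : R) : u + v - (a + b) = (u - a) + (v - b) by ring.
by apply: JD; exact: qpiP.
Qed.

Lemma qpiN a : qpi I (- a) = - qpi I a.
Proof.
apply/esym/qpiE; have -> (u : R) : - u - - a = (-1) * (u - a) by ring.
by apply: JM; exact: qpiP.
Qed.

Lemma qpiM a b : qpi I (a * b) = qpi I a * qpi I b.
Proof.
apply/esym/qpiE.
have -> (u v : R) : u * v - a * b = u * (v - b) + b * (u - a) by ring.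
by apply: JD; apply: JM; exact: qpiP.
Qed.

Lemma qpi0 : qpi I 0 = 0. Proof. by []. Qed.
Lemma qpi1 : qpi I 1 = 1. Proof. by []. Qed.

Lemma qpiB a b : qpi I (a - b) = qpi I a - qpi I b.
Proof. by rewrite qpiD qpiN. Qed.

Lemma quotP (P : quot I -> Prop) : (forall a, P (qpi I a)) -> forall x, P x.
Proof. by move=> h x; rewrite -(qrepK x). Qed.
End QuotTheory.

Section LocTheory.
Variables (R : comPzRingType) (S : set R).

Lemma mult_gen1 : mult_gen S 1. Proof. by move=> M [[]]. Qed.
Lemma mult_genM a b : mult_gen S a -> mult_gen S b -> mult_gen S (a * b).
Proof. by move=> ha hb M hM; case: (hM) => -[_ h] _; apply: h; [exact: ha|exact: hb]. Qed.

Lemma lfracD a b c d : mult_gen S b -> mult_gen S d ->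
  lfrac S a b + lfrac S c d = lfrac S (a * d + c * b) (b * d).
Proof.
move=> hb hd.
have -> (x y : loc S) : x + y = lfrac S (lnum x * lden y + lnum y * lden x) (lden x * lden y) by [].
have [t ht e1] := lfracP a hb; have [s hs e2] := lfracP c hd.
have [h1 h2] := (ldenP (lfrac S a b), ldenP (lfrac S c d)).
set a1 := lnum (lfrac S a b) in e1 *; set b1 := lden (lfrac S a b) in e1 h1 *.
set c1 := lnum (lfrac S c d) in e2 *; set d1 := lden (lfrac S c d) in e2 h2 *.
apply: (@lfracE _ _ _ _ _ _ (t * s)); try by do ?apply: mult_genM.
transitivity (s * d * d1 * (t * (a1 * b - a * b1)) + t * b * b1 * (s * (c1 * d - c * d1))).
  by ring.
by rewrite e1 e2 !mulr0 addr0.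
Qed.

Lemma lfracM a b c d : mult_gen S b -> mult_gen S d ->
  lfrac S a b * lfrac S c d = lfrac S (a * c) (b * d).
Proof.
move=> hb hd.
have -> (x y : loc S) : x * y = lfrac S (lnum x * lnum y) (lden x * lden y) by [].
have [t ht e1] := lfracP a hb; have [s hs e2] := lfracP c hd.
have [h1 h2] := (ldenP (lfrac S a b), ldenP (lfrac S c d)).
set a1 := lnum (lfrac S a b) in e1 *; set b1 := lden (lfrac S a b) in e1 h1 *.
set c1 := lnum (lfrac S c d) in e2 *; set d1 := lden (lfrac S c d) in e2 h2 *.
apply: (@lfracE _ _ _ _ _ _ (t * s)); try by do ?apply: mult_genM.
transitivity (s * c1 * d * (t * (a1 * b - a * b1)) + t * a * b1 * (s * (c1 * d - c * d1))).
  by ring.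
by rewrite e1 e2 !mulr0 addr0.
Qed.

Lemma lfrac0 : lfrac S 0 1 = 0. Proof. by []. Qed.
Lemma lfracN a b : mult_gen S b -> - lfrac S a b = lfrac S (- a) b.
Proof.
move=> hb; apply/eqP; rewrite eq_sym -addr_eq0 lfracD // mulNr addNr -lfrac0.
apply/eqP; apply: (@lfracE _ _ _ _ _ _ 1); try exact: mult_gen1.
  exact: mult_genM.
by rewrite !mul0r subrr mulr0.
Qed.
End LocTheory.

Section Completion.
Variables (R : realType) (K : nring R).
Local Notation norm := (@nr_norm R K).

(** Elements of norm 0 are allowed and only the others must be invertible: exactly what makes the
    separated completion a valued field. *)
Record is_vring : Prop := IsVring {
  vr_ge0 : forall a, 0 <= norm a;
  vr0 : norm 0 = 0;
  vr1 : norm 1 = 1;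
  vrN : forall a, norm (- a) = norm a;
  vrD : forall a b, norm (a + b) <= norm a + norm b;
  vrM : forall a b, norm (a * b) = norm a * norm b;
  vrV : forall a, norm a <> 0 -> exists b, a * b = 1 }.

Hypothesis hK : is_vring.
Local Notation C := (cpl_ring K).

Lemma ncvg0P (u : nat -> K) : ncvg u 0 <->
  forall e, 0 < e -> exists N, forall n, (N <= n)%N -> norm (u n) < e.
Proof.
rewrite /ncvg; under eq_fun do rewrite subr0.
split=> [/cvgrPdist_lt h e e0|h].
  have [N _ hN] := h e e0; exists N => n Nn.
  by have := hN n Nn; rewrite /= sub0r normrN ger0_norm // (vr_ge0 hK).
apply/cvgrPdist_lt => e e0; have [N hN] := h e e0; exists N => // n Nn.
by rewrite sub0r normrN ger0_norm ?(vr_ge0 hK) //; exact: hN.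
Qed.

Lemma ncauchy_cst (a : K) : ncauchy (fun=> a).
Proof. by move=> e e0; exists 0%N => m n _ _; rewrite subrr (vr0 hK). Qed.

Lemma vr_sym a b : norm (a - b) = norm (b - a).
Proof. by rewrite -(vrN hK) opprB. Qed.

Lemma vr_near a b : norm a <= norm b + norm (a - b).
Proof. by apply: le_trans (vrD hK _ _); rewrite addrC subrK. Qed.

Lemma vr_dist a b : `|norm a - norm b| <= norm (a - b).
Proof.
rewrite ler_norml; apply/andP; split.
  by rewrite lerBrDr addrC lerBlDr vr_sym; exact: vr_near.
by rewrite lerBlDl; exact: vr_near.
Qed.

Lemma ncauchy_bounded (u : nat -> K) : ncauchy u -> exists2 B, 0 < B &
  exists N, forall n, (N <= n)%N -> norm (u n) <= B.
Proof.
move=> h; have [N hN] := h 1 ltr01.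
exists (norm (u N) + 1); first by rewrite ltr_wpDl // (vr_ge0 hK).
exists N => n Nn; apply: (le_trans (vr_near _ (u N))); rewrite lerD2l.
by apply/ltW/hN.
Qed.

Lemma ncauchy_subring : is_subring (@ncauchy R K : set (seq_ring K)).
Proof.
split; first exact: ncauchy_cst.
- move=> u w hu hw e e0.
  have [N hN] := hu _ (divr_gt0 e0 (ltr0n _ 2)).
  have [M hM] := hw _ (divr_gt0 e0 (ltr0n _ 2)).
  exists (maxn N M) => m n; rewrite !geq_max => /andP[m1 m2] /andP[n1 n2].
  have -> : (u - w) m - (u - w) n = (u m - u n) - (w m - w n).
    by rewrite -[(u - w) m]/(u m - w m) -[(u - w) n]/(u n - w n); ring.
  apply: (le_lt_trans (vrD hK _ _)); rewrite (vrN hK).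
  by have := hN m n m1 n1; have := hM m n m2 n2; lra.
- move=> u w hu hw e e0.
  have [A A0 [N1 hA]] := ncauchy_bounded hu; have [B B0 [N2 hB]] := ncauchy_bounded hw.
  have AB0 : 0 < A + B by rewrite addr_gt0.
  have [N hN] := hu _ (divr_gt0 e0 AB0).
  have [M hM] := hw _ (divr_gt0 e0 AB0).
  exists (maxn (maxn N1 N2) (maxn N M)) => m n.
  rewrite !geq_max => /andP[/andP[m1 m2] /andP[m3 m4]] /andP[/andP[n1 n2] /andP[n3 n4]].
  have -> : (u * w) m - (u * w) n = u m * (w m - w n) + w n * (u m - u n).
    by rewrite -[(u * w) m]/(u m * w m) -[(u * w) n]/(u n * w n); ring.
  apply: (le_lt_trans (vrD hK _ _)); rewrite !(vrM hK).
  have h1 : norm (u m) * norm (w m - w n) <= A * norm (w m - w n).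
    by rewrite ler_wpM2r ?(vr_ge0 hK) // hA.
  have h2 : norm (w n) * norm (u m - u n) <= B * norm (u m - u n).
    by rewrite ler_wpM2r ?(vr_ge0 hK) // hB.
  have h3 : A * norm (w m - w n) < A * (e / (A + B)) by rewrite ltr_pM2l // hM.
  have h4 : B * norm (u m - u n) < B * (e / (A + B)) by rewrite ltr_pM2l // hN.
  have h5 : A * (e / (A + B)) + B * (e / (A + B)) = e by field; rewrite gt_eqF.
  lra.
Qed.

Local Notation Cs := [set u : seq_ring K | ncauchy u].
Local Notation sub := (subring Cs).

Lemma null_ideal : is_ideal [set u : sub | ncvg (sr_val u) 0].
Proof.
have srD (a b : sub) n : sr_val (a + b) n = sr_val a n + sr_val b n by [].
have srM (a b : sub) n : sr_val (a * b) n = sr_val a n * sr_val b n by [].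
split.
- by apply/ncvg0P => e e0; exists 0%N => n _; rewrite (vr0 hK).
- move=> a b /ncvg0P ha /ncvg0P hb; apply/ncvg0P => e e0.
  have [N hN] := ha _ (divr_gt0 e0 (ltr0n _ 2)).
  have [M hM] := hb _ (divr_gt0 e0 (ltr0n _ 2)).
  exists (maxn N M) => n; rewrite geq_max => /andP[n1 n2]; rewrite srD.
  apply: (le_lt_trans (vrD hK _ _)); have := hN n n1; have := hM n n2; lra.
- move=> a b /ncvg0P hb; apply/ncvg0P => e e0.
  have [A A0 [N hA]] := ncauchy_bounded (sr_valP ncauchy_subring a).
  have [M hM] := hb _ (divr_gt0 e0 A0).
  exists (maxn N M) => n; rewrite geq_max => /andP[n1 n2]; rewrite srM (vrM hK).
  apply: (@le_lt_trans _ _ (A * norm (sr_val b n))).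
    by rewrite ler_wpM2r ?(vr_ge0 hK) // hA.
  by rewrite -ltr_pdivlMl // mulrC hM.
Qed.

Lemma cpl_lim_eq (u w : nat -> K) : ncauchy u -> ncauchy w ->
  cpl_lim u = cpl_lim w <-> forall e, 0 < e ->
    exists N, forall n, (N <= n)%N -> norm (u n - w n) < e.
Proof.
move=> hu hw.
have E : sr_val (sr_in Cs (u : seq_ring K) - sr_in Cs (w : seq_ring K)) =
    (fun n => u n - w n).
  have -> : sr_val (sr_in Cs (u : seq_ring K) - sr_in Cs (w : seq_ring K)) =
    sr_val (sr_in Cs (u : seq_ring K)) - sr_val (sr_in Cs (w : seq_ring K)) by [].
  by rewrite !(sr_inK ncauchy_subring).
rewrite /cpl_lim qpiP_eq (ideal_gen_id null_ideal).
by apply: (iff_trans _ (ncvg0P _)); rewrite -E.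
Qed.

Lemma cpl_seqP (b : C) : ncauchy (cpl_seq b).
Proof. exact: (sr_valP ncauchy_subring). Qed.

Lemma cpl_seqK (b : C) : cpl_lim (cpl_seq b) = b.
Proof.
rewrite /cpl_lim /cpl_seq -[RHS]qrepK; congr qpi; apply: val_inj.
exact: (sr_inK ncauchy_subring (sr_valP ncauchy_subring _)).
Qed.

Lemma cpl_ind (P : C -> Prop) : (forall u, ncauchy u -> P (cpl_lim u)) -> forall b, P b.
Proof. by move=> h b; rewrite -(cpl_seqK b); apply: h; exact: cpl_seqP. Qed.

Let srin (u : nat -> K) : ncauchy u -> sr_val (sr_in Cs (u : seq_ring K)) = u.
Proof. exact: (sr_inK ncauchy_subring). Qed.

Lemma ncauchyB u w : ncauchy u -> ncauchy w -> ncauchy (fun n => u n - w n : K).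
Proof. by case: ncauchy_subring => _ h _; exact: h. Qed.
Lemma ncauchyN u : ncauchy u -> ncauchy (fun n => - u n : K).
Proof.
move=> h; have := ncauchyB (ncauchy_cst 0) h.
by under eq_fun do rewrite sub0r.
Qed.
Lemma ncauchyD u w : ncauchy u -> ncauchy w -> ncauchy (fun n => u n + w n : K).
Proof.
move=> hu hw; have := ncauchyB hu (ncauchyN hw).
by under eq_fun do rewrite opprK.
Qed.
Lemma ncauchyM u w : ncauchy u -> ncauchy w -> ncauchy (fun n => u n * w n : K).
Proof. by case: ncauchy_subring => _ _ h; exact: h. Qed.

Lemma cpl_limD u w : ncauchy u -> ncauchy w ->
  cpl_lim u + cpl_lim w = cpl_lim (fun n => u n + w n : K).
Proof.
move=> hu hw; rewrite /cpl_lim -qpiD; congr qpi; apply: val_inj.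
rewrite -[LHS]/(sr_val (sr_in Cs (u : seq_ring K)) + sr_val (sr_in Cs (w : seq_ring K))).
by rewrite -[RHS]/(sr_val _) !srin //; exact: ncauchyD.
Qed.

Lemma cpl_limM u w : ncauchy u -> ncauchy w ->
  cpl_lim u * cpl_lim w = cpl_lim (fun n => u n * w n : K).
Proof.
move=> hu hw; rewrite /cpl_lim -qpiM; congr qpi; apply: val_inj.
rewrite -[LHS]/(sr_val (sr_in Cs (u : seq_ring K)) * sr_val (sr_in Cs (w : seq_ring K))).
by rewrite -[RHS]/(sr_val _) !srin //; exact: ncauchyM.
Qed.

Lemma cpl_limN u : ncauchy u -> - cpl_lim u = cpl_lim (fun n => - u n : K).
Proof.
move=> hu; rewrite /cpl_lim -qpiN; congr qpi; apply: val_inj.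
rewrite -[LHS]/(- sr_val (sr_in Cs (u : seq_ring K))).
by rewrite -[RHS]/(sr_val _) !srin //; exact: ncauchyN.
Qed.

Lemma cpl_lim0 : cpl_lim (fun=> 0 : K) = 0.
Proof.
rewrite /cpl_lim -(qpi0 [set u : sub | ncvg (sr_val u) 0]); congr qpi; apply: val_inj.
exact: (srin (ncauchy_cst 0)).
Qed.

Lemma cpl_lim1 : cpl_lim (fun=> 1 : K) = 1.
Proof.
rewrite /cpl_lim -(qpi1 [set u : sub | ncvg (sr_val u) 0]); congr qpi; apply: val_inj.
exact: (srin (ncauchy_cst 1)).
Qed.

Local Notation cnorm := (@nr_norm R (cpl K)).

Lemma norm_cvg (u : nat -> K) : ncauchy u -> cvgn (fun n => norm (u n)).
Proof.
move=> hu; apply/cauchy_cvgP/cauchyP => /= e e0.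
have [N hN] := hu e e0; exists (norm (u N)); exists N => // n Nn.
rewrite /ball /= (le_lt_trans (vr_dist _ _)) //.
by apply: hN.
Qed.

Lemma cnorm_lim u : ncauchy u -> cnorm (cpl_lim u) = lim (norm (u n) @[n --> \oo]).
Proof.
move=> hu; have hs := cpl_seqP (cpl_lim u).
apply/esym/cvg_lim => //=.
have hc := norm_cvg hs.
have e := (cpl_lim_eq hs hu).1 (cpl_seqK (cpl_lim u)).
apply/cvgrPdist_lt => eps eps0.
have [N1 _ hN1] := ((cvgrPdist_lt _ _).1 hc) _ (divr_gt0 eps0 (ltr0n _ 2)).
have [N2 hN2] := e _ (divr_gt0 eps0 (ltr0n _ 2)).
exists (maxn N1 N2) => // n; rewrite /= geq_max => /andP[n1 n2].
have h1 := hN1 n n1; have h2 := hN2 n n2; rewrite /= in h1.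
apply: (le_lt_trans (ler_distD (norm (cpl_seq (cpl_lim u) n)) _ _)).
have h3 := vr_dist (cpl_seq (cpl_lim u) n) (u n).
rewrite [ltRHS](splitr eps); apply: ltrD => //; exact: le_lt_trans h3 h2.
Qed.

Lemma cnorm_near u e : ncauchy u -> 0 < e -> exists N, forall n, (N <= n)%N ->
  `|cnorm (cpl_lim u) - norm (u n)| < e.
Proof.
move=> hu e0; rewrite cnorm_lim //.
by have [N _ hN] := ((cvgrPdist_lt _ _).1 (norm_cvg hu)) _ e0; exists N.
Qed.

Lemma cnorm_cst a : cnorm (cpl_lim (fun=> a)) = norm a.
Proof. by rewrite cnorm_lim ?lim_cst //; exact: ncauchy_cst. Qed.

Lemma cnorm_ge0 b : 0 <= cnorm b.
Proof.
elim/cpl_ind: b => u hu; rewrite cnorm_lim // limr_ge //; first exact: norm_cvg.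
by near=> n; exact: (vr_ge0 hK).
Unshelve. all: by end_near.
Qed.

Lemma cnorm_le u c : ncauchy u -> (exists N, forall n, (N <= n)%N -> norm (u n) <= c) ->
  cnorm (cpl_lim u) <= c.
Proof.
move=> hu [N hN]; rewrite cnorm_lim //; apply: limr_le; first exact: norm_cvg.
by exists N => // n Nn; apply: hN.
Qed.

Lemma cnorm_eq0 b : cnorm b = 0 <-> b = 0.
Proof.
elim/cpl_ind: b => u hu; split=> [h|->]; last by rewrite -cpl_lim0 cnorm_cst (vr0 hK).
rewrite -cpl_lim0; apply/(cpl_lim_eq hu (ncauchy_cst 0)) => e e0.
have [N hN] := cnorm_near hu e0; exists N => n Nn.
by have := hN n Nn; rewrite h sub0r normrN subr0 ger0_norm // (vr_ge0 hK).
Qed.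

Lemma cnormN b : cnorm (- b) = cnorm b.
Proof.
elim/cpl_ind: b => u hu; rewrite cpl_limN // !cnorm_lim //; last exact: ncauchyN.
by under eq_fun do rewrite (vrN hK).
Qed.

Lemma cnormM a b : cnorm (a * b) = cnorm a * cnorm b.
Proof.
elim/cpl_ind: a => u hu; elim/cpl_ind: b => w hw.
rewrite cpl_limM // !cnorm_lim //; last exact: ncauchyM.
under eq_fun do rewrite (vrM hK).
by rewrite limM //; exact: norm_cvg.
Qed.

Lemma cnormD a b : cnorm (a + b) <= cnorm a + cnorm b.
Proof.
elim/cpl_ind: a => u hu; elim/cpl_ind: b => w hw.
rewrite cpl_limD // !cnorm_lim //; last exact: ncauchyD.
have cu := norm_cvg hu; have cw := norm_cvg hw.
rewrite -limD //; apply: ler_lim; [exact: norm_cvg (ncauchyD hu hw)|exact: is_cvgD|].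
by near=> n; exact: (vrD hK).
Unshelve. all: by end_near.
Qed.

Lemma cnorm1 : cnorm 1 = 1.
Proof. by rewrite -cpl_lim1 cnorm_cst (vr1 hK). Qed.

Lemma cpl_dense b e : 0 < e -> exists a, cnorm (b - cpl_lim (fun=> a)) < e.
Proof.
elim/cpl_ind: b => u hu e0; have [N hN] := hu _ (divr_gt0 e0 (ltr0n _ 2)).
exists (u N); rewrite cpl_limN; last exact: ncauchy_cst.
rewrite cpl_limD //; last exact/ncauchyN/ncauchy_cst.
apply: (@le_lt_trans _ _ (e / 2)); last by lra.
apply: cnorm_le; first by apply: ncauchyB => //; exact: ncauchy_cst.
by exists N => n Nn; apply/ltW/hN.
Qed.

(** Diagonal argument: replacing the n-th term by a constant sequence within 1 / (n + 1) gives a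
    Cauchy sequence of K, whose class is the limit. *)
Lemma cpl_complete (u : nat -> C) :
  (forall e, 0 < e -> exists N, forall m n, (N <= m)%N -> (N <= n)%N ->
     cnorm (u m - u n) < e) ->
  exists l, forall e, 0 < e -> exists N, forall n, (N <= n)%N -> cnorm (u n - l) < e.
Proof.
move=> hu.
have inv0 n : 0 < (n.+1%:R)^-1 :> R by rewrite invr_gt0.
have [w hw] := choice (fun n => cpl_dense (u n) (inv0 n)).
have small (e : R) : 0 < e -> exists N, forall n, (N <= n)%N -> (n.+1%:R)^-1 < e.
  move=> e0; exists (Num.bound e^-1) => m Nm.
  rewrite invf_plt ?posrE //; apply: (lt_le_trans (archi_boundP _)).
    by rewrite invr_ge0 ltW.
  by rewrite ler_nat (leq_trans Nm).
have tri a b c : cnorm (a - c) <= cnorm (a - b) + cnorm (b - c).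
  by apply: le_trans (cnormD _ _); rewrite addrA subrK.
have sym a b : cnorm (a - b) = cnorm (b - a) by rewrite -cnormN opprB.
have cst a b : cnorm (cpl_lim (fun=> a) - cpl_lim (fun=> b)) = norm (a - b).
  rewrite cpl_limN ?cpl_limD ?cnorm_cst //; try exact/ncauchyN/ncauchy_cst; exact: ncauchy_cst.
have cw : ncauchy w.
  move=> e e0; have e3 : 0 < e / 3 by rewrite divr_gt0.
  have [N1 h1] := hu _ e3; have [N2 h2] := small _ e3.
  exists (maxn N1 N2) => m n; rewrite !geq_max => /andP[m1 m2] /andP[n1 n2].
  rewrite -cst; apply: (le_lt_trans (tri _ (u m) _)).
  have k1 := lt_trans (hw m) (h2 m m2); have k2 := lt_trans (hw n) (h2 n n2).
  have k3 := h1 m n m1 n1; have k4 := tri (u m) (u n) (cpl_lim (fun=> w n)).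
  rewrite sym in k1; lra.
exists (cpl_lim w) => e e0; have e2 : 0 < e / 2 by rewrite divr_gt0.
have e4 : 0 < e / 4 by rewrite divr_gt0.
have [N1 h1] := small _ e2; have [N2 h2] := cw _ e4.
exists (maxn N1 N2) => n; rewrite geq_max => /andP[n1 n2].
apply: (le_lt_trans (tri _ (cpl_lim (fun=> w n)) _)).
have k1 := lt_trans (hw n) (h1 n n1).
suff : cnorm (cpl_lim (fun=> w n) - cpl_lim w) <= e / 4 by lra.
rewrite cpl_limN // cpl_limD; [|exact: ncauchy_cst|exact: ncauchyN].
apply: cnorm_le; first by apply: ncauchyB => //; exact: ncauchy_cst.
by exists N2 => m m2; apply/ltW/h2.
Qed.

Lemma cpl_inv (b : C) : b <> 0 -> exists c, b * c = 1.
Proof.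
elim/cpl_ind: b => u hu b0.
have d0 : 0 < cnorm (cpl_lim u).
  by rewrite lt_neqAle cnorm_ge0 andbT; apply/eqP => h; apply/b0/cnorm_eq0.
set d := cnorm _ in d0; have d2 : 0 < d / 2 by rewrite divr_gt0.
have [N1 h1] := cnorm_near hu d2; rewrite -/d in h1.
have u0 n : (N1 <= n)%N -> d / 2 < norm (u n).
  by move=> /h1; rewrite ltr_distlC => /andP[]; lra.
(* Terms before N1 may have norm 0 and get the default 0; they do not change the class. *)
have inv n : exists c, (N1 <= n)%N -> u n * c = 1.
  case: (leqP N1 n) => hn; last by exists 0.
  have [|c hc] := @vrV hK (u n); last by exists c.
  by apply/eqP; rewrite gt_eqF //; have := u0 n hn; lra.
have [w hw] := choice inv.
have nw n : (N1 <= n)%N -> norm (w n) <= 2 / d.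
  move=> hn; have : norm (u n) * norm (w n) = 1 by rewrite -(vrM hK) hw // (vr1 hK).
  move=> e; have := u0 n hn; rewrite ler_pdivlMr // => h.
  have : (d / 2) * norm (w n) <= norm (u n) * norm (w n).
    by rewrite ler_wpM2r ?(vr_ge0 hK) // ltW.
  by rewrite e; lra.
have cw : ncauchy w.
  move=> e e0; have dd : 0 < 2 / d by rewrite divr_gt0.
  have [N2 h2] := hu (e / ((2 / d) * (2 / d))) (divr_gt0 e0 (mulr_gt0 dd dd)).
  exists (maxn N1 N2) => m n; rewrite !geq_max => /andP[m1 m2] /andP[n1 n2].
  have -> : w m - w n = w m * w n * (u n - u m).
    transitivity (w m * (u n * w n) - w n * (u m * w m)); last by ring.
    by rewrite !hw // !mulr1.
  rewrite !(vrM hK).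
  have h3 : norm (w m) * norm (w n) <= (2 / d) * (2 / d).
    by apply: ler_pM; rewrite ?(vr_ge0 hK) // nw.
  apply: (@le_lt_trans _ _ ((2 / d) * (2 / d) * norm (u n - u m))).
    by rewrite ler_wpM2r ?(vr_ge0 hK).
  by have := h2 n m n2 m2; rewrite (ltr_pdivlMr _ _ (mulr_gt0 dd dd)) => h4; rewrite mulrC.
exists (cpl_lim w); rewrite cpl_limM // -cpl_lim1.
apply/cpl_lim_eq; [exact: ncauchyM|exact: ncauchy_cst|move=> e e0].
by exists N1 => n hn; rewrite hw // subrr (vr0 hK).
Qed.
End Completion.

(** * The fields H(x) *)

Section PointTheory.
Variables (R : realType) (E : balg R) (x : bpt E).
Local Notation P := (ba_ring E).

Lemma sn_ge0 p : 0 <= sn x p. Proof. by case: (bptP x). Qed.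
Lemma sn0 : sn x 0 = 0. Proof. by case: (bptP x) => _ []. Qed.
Lemma sn1 : sn x 1 = 1. Proof. by case: (bptP x) => _ []. Qed.
Lemma snD p q : sn x (p + q) <= sn x p + sn x q. Proof. by case: (bptP x). Qed.
Lemma snM p q : sn x (p * q) = sn x p * sn x q. Proof. by case: (bptP x). Qed.
Lemma sn_base a : sn x (ba_map a) <= nr_norm a. Proof. by case: (bptP x). Qed.

Lemma snN p : sn x (- p) = sn x p.
Proof.
suff h : sn x (-1) = 1 by rewrite -mulN1r snM h mul1r.
apply/eqP; rewrite -(@eqrXn2 _ 2) ?sn_ge0 // expr1n expr2 -snM.
by rewrite mulrNN mulr1 sn1.
Qed.

Lemma sn_near p q : sn x p <= sn x q + sn x (p - q).
Proof. by apply: le_trans (snD _ _); rewrite addrC subrK. Qed.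

Lemma sn_sym p q : sn x (p - q) = sn x (q - p).
Proof. by rewrite -snN opprB. Qed.

Lemma sn_congr p q : sn x (p - q) = 0 -> sn x p = sn x q.
Proof.
move=> h; apply/eqP; rewrite eq_le; apply/andP; split.
  by apply: (le_trans (sn_near p q)); rewrite h addr0.
by apply: (le_trans (sn_near q p)); rewrite sn_sym h addr0.
Qed.

Local Notation I := [set p : P | sn x p = 0].
Local Notation S := [set a : quot I | a <> 0].

Lemma sn_ker_ideal : is_ideal I.
Proof.
split=> [|a b /= ha hb|r a /= ha]; first exact: sn0.
  by apply/eqP; rewrite eq_le sn_ge0 andbT; apply: (le_trans (snD _ _)); rewrite ha hb addr0.
by rewrite snM ha mulr0.
Qed.

Lemma sn_qpi_eq p q : qpi I p = qpi I q <-> sn x (p - q) = 0.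
Proof. by rewrite qpiP_eq (ideal_gen_id sn_ker_ideal). Qed.

Lemma sn_qpi_eq0 p : qpi I p = 0 <-> sn x p = 0.
Proof. by rewrite -(qpi0 I) sn_qpi_eq subr0. Qed.

Lemma sn_qrep p : sn x (qrep (qpi I p)) = sn x p.
Proof. by apply: sn_congr; have := @qpiP _ I p; rewrite (ideal_gen_id sn_ker_ideal). Qed.

(** The kernel of a multiplicative seminorm is prime, so the nonzero classes already form a
    monoid. *)
Lemma ker_mult_gen (a : quot I) : mult_gen S a <-> a <> 0.
Proof.
split; last by move=> a0 M [_]; apply.
move=> h; apply: (h S); split=> //; split=> /=.
  by rewrite -(qpi1 I) sn_qpi_eq0 sn1; apply/eqP; rewrite oner_eq0.
elim/quotP => p; elim/quotP => q; rewrite -qpiM !sn_qpi_eq0 snM => p0 q0 /eqP.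
by rewrite mulf_eq0 => /orP[/eqP|/eqP].
Qed.

Lemma den_mult_gen q : sn x q <> 0 -> mult_gen S (qpi I q).
Proof. by move=> h; apply/ker_mult_gen; rewrite sn_qpi_eq0. Qed.

Lemma snM_neq0 p q : sn x p <> 0 -> sn x q <> 0 -> sn x (p * q) <> 0.
Proof. by rewrite snM => /eqP h1 /eqP h2; apply/eqP; rewrite mulf_neq0. Qed.

Lemma kval_surj (a : kfield x) : exists p q, sn x q <> 0 /\ a = kval x p q.
Proof.
exists (qrep (lnum a)), (qrep (lden a)); rewrite /kval !qrepK lfracK; split=> //.
have := ldenP a => /ker_mult_gen; rewrite -{1}(qrepK (lden a)).
by rewrite sn_qpi_eq0.
Qed.

Lemma kval_eq p q p' q' : sn x q <> 0 -> sn x q' <> 0 ->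
  sn x (p * q' - p' * q) = 0 -> kval x p q = kval x p' q'.
Proof.
move=> hq hq' h; apply: (@lfracE _ _ _ _ _ _ 1).
- exact: den_mult_gen.
- exact: den_mult_gen.
- exact: mult_gen1.
by rewrite mul1r -!qpiM -qpiB; apply/sn_qpi_eq0.
Qed.

Lemma kvalD p q p' q' : sn x q <> 0 -> sn x q' <> 0 ->
  kval x p q + kval x p' q' = kval x (p * q' + p' * q) (q * q').
Proof.
move=> hq hq'; rewrite /kval -[LHS]/(lfrac _ _ _ + lfrac _ _ _) lfracD; try exact: den_mult_gen.
by rewrite qpiD !qpiM.
Qed.

Lemma kvalM p q p' q' : sn x q <> 0 -> sn x q' <> 0 ->
  kval x p q * kval x p' q' = kval x (p * p') (q * q').
Proof.
move=> hq hq'; rewrite /kval -[LHS]/(lfrac _ _ _ * lfrac _ _ _) lfracM; try exact: den_mult_gen.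
by rewrite !qpiM.
Qed.

Lemma kvalN p q : sn x q <> 0 -> - kval x p q = kval x (- p) q.
Proof.
move=> hq; rewrite /kval -[LHS]/(- lfrac _ _ _) lfracN; last exact: den_mult_gen.
by rewrite qpiN.
Qed.

Lemma kval0 : kval x 0 1 = 0. Proof. by rewrite /kval qpi0 qpi1. Qed.
Lemma kval1 : kval x 1 1 = 1. Proof. by rewrite /kval qpi1. Qed.

Lemma sn1_neq0 : sn x 1 <> 0. Proof. by rewrite sn1; apply/eqP; rewrite oner_eq0. Qed.

Lemma knorm_kval p q : sn x q <> 0 -> nr_norm (kval x p q) = sn x p / sn x q.
Proof.
move=> hq; have [t ht] := lfracP (qpi I p) (den_mult_gen hq).
rewrite /kval -[nr_norm _]/(sn x (qrep (lnum (lfrac S (qpi I p) (qpi I q)))) /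
   sn x (qrep (lden (lfrac S (qpi I p) (qpi I q))))).
have := ldenP (lfrac S (qpi I p) (qpi I q)) => /ker_mult_gen.
set a := lnum _; set b := lden _; rewrite -(qrepK a) -(qrepK b) !sn_qrep.
move: (qrep a) (qrep b) => {a b} a b /sn_qpi_eq0 hb.
move: ht => /ker_mult_gen; elim/quotP: t => t /sn_qpi_eq0 ht.
have -> : qpi I t * (qpi I a * qpi I q - qpi I p * qpi I b) = qpi I (t * (a * q - p * b)).
  by rewrite qpiM qpiB !qpiM.
rewrite sn_qpi_eq0 snM => /eqP; rewrite mulf_eq0 => /orP[/eqP//|/eqP h].
have := sn_congr h; rewrite !snM => e.
by apply/eqP; rewrite eqr_div; [apply/eqP|exact/eqP|exact/eqP].
Qed.

Lemma kfield_vring : is_vring (kfield x).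
Proof.
have n1 := sn1_neq0.
split.
- by move=> a; have [p [q [hq ->]]] := kval_surj a; rewrite knorm_kval // divr_ge0 ?sn_ge0.
- by rewrite -[0 in LHS]kval0 knorm_kval // sn0 mul0r.
- by rewrite -[1 in LHS]kval1 knorm_kval // sn1 divr1.
- by move=> a; have [p [q [hq ->]]] := kval_surj a; rewrite kvalN // !knorm_kval // snN.
- move=> a b; have [p [q [hq ->]]] := kval_surj a; have [p' [q' [hq' ->]]] := kval_surj b.
  rewrite kvalD // !knorm_kval //; last exact: snM_neq0.
  have q0 : 0 < sn x q by rewrite lt_neqAle sn_ge0 andbT eq_sym; apply/eqP.
  have q0' : 0 < sn x q' by rewrite lt_neqAle sn_ge0 andbT eq_sym; apply/eqP.
  rewrite snM ler_pdivrMr ?mulr_gt0 //.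
  apply: (le_trans (snD _ _)); rewrite !snM.
  rewrite le_eqVlt; apply/orP; left; apply/eqP; field.
  by rewrite !gt_eqF.
- move=> a b; have [p [q [hq ->]]] := kval_surj a; have [p' [q' [hq' ->]]] := kval_surj b.
  rewrite kvalM // !knorm_kval //; last exact: snM_neq0.
  by rewrite !snM invfM mulrACA.
- move=> a; have [p [q [hq ->]]] := kval_surj a; rewrite knorm_kval // => h.
  have hp : sn x p <> 0 by move=> e; apply: h; rewrite e mul0r.
  exists (kval x q p); rewrite kvalM // -kval1; apply: kval_eq => //; first exact: snM_neq0.
  by rewrite mulr1 mul1r [q * p]mulrC subrr sn0.
Qed.

(** H(x) under a name of its own, so that the field structure and the polynomials over it can be
    inferred. *)
Definition HF : Type := nr_ring (Hx x).
HB.instance Definition _ := GRing.ComPzRing.on HF.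
Definition habs (h : HF) : R := @nr_norm R (Hx x) h.

Fact HF_nonzero : (1 : HF) != 0.
Proof.
apply/eqP => e; have := cnorm1 kfield_vring; rewrite -[1]/(1 : HF) e.
by rewrite ((cnorm_eq0 kfield_vring _).2 erefl) => /esym/eqP; rewrite oner_eq0.
Qed.
HB.instance Definition _ := GRing.PzSemiRing_isNonZero.Build HF HF_nonzero.

Definition HF_inv (h : HF) : HF :=
  if pselect (h <> 0) is left h0 then projT1 (cid (cpl_inv kfield_vring h0)) else 0.

Fact HF_mulVf (h : HF) : h != 0 -> HF_inv h * h = 1.
Proof.
move=> /eqP h0; rewrite /HF_inv; case: pselect => // h0'.
by rewrite mulrC; exact: (projT2 (cid (cpl_inv kfield_vring h0'))).
Qed.
Fact HF_inv0 : HF_inv 0 = 0.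
Proof. by rewrite /HF_inv; case: pselect. Qed.
HB.instance Definition _ := GRing.ComNzRing_isField.Build HF HF_mulVf HF_inv0.

Lemma habs_abs : is_abs habs.
Proof.
split.
- exact: (cnorm_ge0 kfield_vring).
- exact: (cnorm_eq0 kfield_vring).
- exact: (cnormD kfield_vring).
- exact: (cnormM kfield_vring).
Qed.

Lemma habs_complete : abs_complete habs.
Proof. exact: (cpl_complete kfield_vring). Qed.

Definition hv (p q : P) : HF := hval p q x.

Lemma habs_hv p q : sn x q <> 0 -> habs (hv p q) = sn x p / sn x q.
Proof. by move=> hq; rewrite -knorm_kval //; exact: (cnorm_cst kfield_vring). Qed.

Lemma hvD p q p' q' : sn x q <> 0 -> sn x q' <> 0 ->
  hv p q + hv p' q' = hv (p * q' + p' * q) (q * q').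
Proof.
move=> hq hq'; rewrite /hv /hval -kvalD //.
by rewrite -[LHS]/(cpl_lim _ + cpl_lim _) (cpl_limD kfield_vring) //; exact: (ncauchy_cst kfield_vring).
Qed.

Lemma hvM p q p' q' : sn x q <> 0 -> sn x q' <> 0 ->
  hv p q * hv p' q' = hv (p * p') (q * q').
Proof.
move=> hq hq'; rewrite /hv /hval -kvalM //.
by rewrite -[LHS]/(cpl_lim _ * cpl_lim _) (cpl_limM kfield_vring) //; exact: (ncauchy_cst kfield_vring).
Qed.

Lemma hvN p q : sn x q <> 0 -> - hv p q = hv (- p) q.
Proof.
move=> hq; rewrite /hv /hval -kvalN //.
by rewrite -[LHS]/(- cpl_lim _) (cpl_limN kfield_vring) //; exact: (ncauchy_cst kfield_vring).
Qed.

Lemma hv_eq p q p' q' : sn x q <> 0 -> sn x q' <> 0 ->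
  sn x (p * q' - p' * q) = 0 -> hv p q = hv p' q'.
Proof. by move=> hq hq' h; rewrite /hv /hval (kval_eq hq hq' h). Qed.

Lemma hv0 : hv 0 1 = 0.
Proof. by rewrite /hv /hval kval0; exact: (cpl_lim0 kfield_vring). Qed.
Lemma hv1 : hv 1 1 = 1.
Proof. by rewrite /hv /hval kval1; exact: (cpl_lim1 kfield_vring). Qed.

Lemma hv_dense (h : HF) e : 0 < e -> exists p q, sn x q <> 0 /\ habs (h - hv p q) < e.
Proof.
move=> e0; have [a ha] := cpl_dense kfield_vring h e0.
have [p [q [hq aE]]] := kval_surj a.
by exists p, q; split=> //; rewrite /hv /hval -aE.
Qed.

Definition pv (p : P) : HF := hv p 1.

Fact pv_zmod : GRing.zmod_morphism pv.
Proof.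
move=> p q; rewrite /pv hvN; last exact: sn1_neq0.
by rewrite hvD ?mulr1 //; exact: sn1_neq0.
Qed.
Fact pv_monoid : GRing.monoid_morphism pv.
Proof.
split; first exact: hv1.
by move=> p q; rewrite /pv hvM ?mulr1 //; exact: sn1_neq0.
Qed.
HB.instance Definition _ := GRing.isZmodMorphism.Build P HF pv pv_zmod.
HB.instance Definition _ := GRing.isMonoidMorphism.Build P HF pv pv_monoid.

Lemma habs_pv p : habs (pv p) = sn x p.
Proof. by rewrite habs_hv; [rewrite sn1 divr1|exact: sn1_neq0]. Qed.

Lemma hvE p q : sn x q <> 0 -> hv p q = pv p / pv q.
Proof.
move=> hq; have q0 : pv q != 0 by rewrite -(abs_gt0 habs_abs) habs_pv lt_neqAle sn_ge0 andbT eq_sym; apply/eqP.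
apply: (mulIf q0); rewrite divfK // /pv hvM //; last exact: sn1_neq0.
by apply: hv_eq; rewrite ?mulr1 ?subrr ?sn0 //; exact: sn1_neq0.
Qed.

End PointTheory.

(** A second name, since [hv] denotes a hypothesis on [v] below. *)
Local Notation fracv := hv.

(** * The universal property of H(z) *)

Section Extension.
Variables (R : realType) (E : balg R) (z : bpt E) (L : fieldType) (v : L -> R).
Variable phi : {rmorphism ba_ring E -> L}.
Hypotheses (hv : is_abs v) (cv : abs_complete v) (iso : forall p, v (phi p) = sn z p).

Let ha := habs_abs z.

Let phi_neq0 q : sn z q <> 0 -> phi q != 0.
Proof. by move=> h; rewrite -(abs_gt0 hv) iso lt_neqAle sn_ge0 andbT eq_sym; apply/eqP. Qed.

Let D (h : HF z) (l : L) := exists p q, [/\ sn z q <> 0, h = fracv z p q & l = phi p / phi q].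

Let D_isom : isom_corr (@habs R E z) v (corr_closure (@habs R E z) v D).
Proof.
apply: corr_closure_isom => //.
- move=> _ _ [p [q [q0 -> ->]]].
  by rewrite habs_hv // (absM hv) (absV hv) !iso.
- move=> _ _ _ _ [p [q [q0 -> ->]]] [p' [q' [q0' -> ->]]].
  exists (p * q' + p' * q), (q * q'); rewrite hvD //; split=> //; first exact: snM_neq0.
  by rewrite rmorphD !rmorphM addf_div ?phi_neq0.
- move=> _ _ [p [q [q0 -> ->]]]; exists (- p), q; rewrite hvN //; split=> //.
  by rewrite rmorphN mulNr.
- move=> _ _ _ _ [p [q [q0 -> ->]]] [p' [q' [q0' -> ->]]].
  exists (p * p'), (q * q'); rewrite hvM //; split=> //; first exact: snM_neq0.
  by rewrite !rmorphM mulf_div.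
- move=> _ _ [p [q [q0 -> ->]]].
  case: (pselect (sn z p = 0)) => p0.
    exists 0, 1; split; first exact: sn1_neq0.
      have -> : fracv z p q = 0.
        by apply/(abs_eq0 ha); rewrite habs_hv // p0 mul0r.
      by rewrite hv0 invr0.
    have -> : phi p = 0 by apply/(abs_eq0 hv); rewrite iso.
    by rewrite rmorph0 !mul0r invr0.
  exists q, p; split=> //; last by rewrite invf_div.
  have h0 : fracv z p q != 0.
    by rewrite -(abs_gt0 ha) habs_hv // divr_gt0 // lt_neqAle sn_ge0 andbT eq_sym; apply/eqP.
  apply: (mulIf h0); rewrite mulVf // hvM // -(hv1 z); apply: hv_eq.
  - exact: sn1_neq0.
  - exact: snM_neq0.
  - by rewrite mulr1 mul1r mulrC subrr sn0.
Qed.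

Let r := corr_closure (@habs R E z) v D.

Let r_total h : exists l, r h l.
Proof.
have inv0 n : 0 < (n.+1%:R)^-1 :> R by rewrite invr_gt0.
have /choice[pq hpq] n : exists pq : ba_ring E * ba_ring E,
    sn z pq.2 <> 0 /\ habs (h - fracv z pq.1 pq.2) < (n.+1%:R)^-1.
  by have [p [q hpq]] := hv_dense h (inv0 n); exists (p, q).
pose u n := phi (pq n).1 / phi (pq n).2; pose w n := fracv z (pq n).1 (pq n).2.
have small (e : R) : 0 < e -> exists N, forall n, (N <= n)%N -> (n.+1%:R)^-1 < e.
  move=> e0; exists (Num.bound e^-1) => m Nm.
  rewrite invf_plt ?posrE //; apply: (lt_le_trans (archi_boundP _)).
    by rewrite invr_ge0 ltW.
  by rewrite ler_nat (leq_trans Nm).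
have Duw n : r (w n) (u n).
  by apply: corr_closure_sub => //; exists (pq n).1, (pq n).2; split=> //; exact: (hpq n).1.
have [|l hl] := cv (u := u).
  move=> e e0; have [N hN] := small _ (divr_gt0 e0 (ltr0n _ 2)).
  exists N => m n Nm Nn.
  have rd := ic_D D_isom (Duw m) (ic_N D_isom (Duw n)).
  rewrite -(ic_iso D_isom rd).
  have h1 := lt_trans (hpq m).2 (hN m Nm); have h2 := lt_trans (hpq n).2 (hN n Nn).
  apply: (le_lt_trans (abs_triang ha _ h _)).
  rewrite (absB ha (w m)); move: h1 h2; rewrite -/(w m) -/(w n); lra.
exists l; apply: (ic_lim D_isom) => e e0.
have [N1 h1] := small _ e0; have [N2 h2] := hl _ e0.
pose m := maxn N1 N2; exists (w m), (u m); split; first exact: Duw.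
  exact: lt_trans (hpq m).2 (h1 m (leq_maxl _ _)).
by rewrite (absB hv); apply: h2; exact: leq_maxr.
Qed.

(** The closure of the relation between fractions and their images is functional because it is
    isometric, and total because fractions are dense in H(z) and L is complete. *)
Lemma exists_extension : exists Phi : {rmorphism HF z -> L},
  (forall h, v (Phi h) = habs h) /\
  (forall p q, sn z q <> 0 -> Phi (fracv z p q) = phi p / phi q).
Proof.
have [F hF] := choice r_total.
have uniq h l l' : r h l -> r h l' -> l = l'.
  move=> h1 h2; have := ic_iso D_isom (ic_D D_isom h1 (ic_N D_isom h2)).
  by rewrite subrr (abs0 ha) => /esym/(abs_eq0 hv)/eqP; rewrite subr_eq0 => /eqP.
have FD : GRing.zmod_morphism F.
  move=> a b; apply: (uniq _ _ _ (hF (a - b))).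
  exact: (ic_D D_isom (hF a) (ic_N D_isom (hF b))).
have Fhv p q : sn z q <> 0 -> F (fracv z p q) = phi p / phi q.
  move=> q0; apply: (uniq _ _ _ (hF (fracv z p q))).
  by apply: corr_closure_sub => //; exists p, q.
have FM : GRing.monoid_morphism F.
  split=> [|a b].
    have := Fhv 1 1; rewrite hv1 rmorph1 divr1; apply; exact: sn1_neq0.
  exact: (uniq _ _ _ (hF (a * b)) (ic_M D_isom (hF a) (hF b))).
pose Phi : {rmorphism HF z -> L} := HB.pack F (GRing.isZmodMorphism.Build _ _ F FD)
  (GRing.isMonoidMorphism.Build _ _ F FM).
by exists Phi; split=> // h; rewrite -(ic_iso D_isom (hF h)).
Qed.
End Extension.

Lemma extension_lim (R : realType) (E : balg R) (z : bpt E) (L : fieldType) (v : L -> R)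
   (phi : {rmorphism ba_ring E -> L}) (Phi : {rmorphism HF z -> L}) :
  is_abs v -> (forall h, v (Phi h) = habs h) ->
  (forall p q, sn z q <> 0 -> Phi (fracv z p q) = phi p / phi q) ->
  forall h l, (forall e, 0 < e -> exists p q, [/\ sn z q <> 0,
     habs (h - fracv z p q) < e & v (l - phi p / phi q) < e]) -> Phi h = l.
Proof.
move=> hv iso Phihv h l hl; apply: (small_eq hv) => e e0.
have [p [q [q0 h1 h2]]] := hl _ (divr_gt0 e0 (ltr0n _ 2)).
apply: (le_lt_trans (abs_triang hv _ (phi p / phi q) _)).
have -> : v (Phi h - phi p / phi q) = habs (h - fracv z p q).
  by rewrite -(Phihv p q q0) -rmorphB iso.
by rewrite (absB hv l) in h2; lra.
Qed.

(** * Points and regular functions of affine spaces *)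

Lemma fmap_ultra (T U : Type) (f : T -> U) (F : set_system T) :
  UltraFilter F -> UltraFilter (fmap f F).
Proof.
move=> UF; have PF : ProperFilter F by exact: ultra_proper.
apply: Build_UltraFilter => G PG hG; apply/seteqP; split=> A hA; last exact: hG.
have [//|h] := in_ultra_setVsetC (f @^-1` A) UF.
have hC : G (~` A) by apply: hG.
have := filterI hA hC; rewrite setICr => h0.
by case: (filter_not_empty G (h0 _)).
Qed.

Section PointTopology.
Variables (R : realType) (E : balg R).
Local Notation P := (ba_ring E).
Implicit Types (x y z : bpt E).

Lemma bpt_cvg (F : set_system (bpt E)) x : Filter F ->
  (forall p, sn z p @[z --> F] --> sn x p) -> F --> x.
Proof.
move=> FF h V; rewrite nbhsE /= => -[B [[A oA <-] Ax] BV].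
have hs : (fmap (@sn R E) F) --> (@sn R E x : prod_topology (fun _ : P => R)).
  apply/cvg_sup => p U; rewrite nbhsE /= => -[C [[D oD <-] Dx] CU].
  have nD : nbhs (sn x p) D by apply: open_nbhs_nbhs.
  have hD : F [set z | D (sn z p)] by exact: (h p D nD).
  have : F (@sn R E @^-1` U) by apply: filterS hD => z Dz; exact: CU.
  by [].
have nA : nbhs (@sn R E x : prod_topology (fun _ : P => R)) A by apply: open_nbhs_nbhs.
by apply: (filterS BV); exact: (hs _ nA).
Qed.

Lemma sn_continuous p : continuous (fun x : bpt E => sn x p).
Proof.
move=> x V nV.
have h1 : continuous (@sn R E : bpt E -> prod_topology (fun _ : P => R)).
  exact: initial_continuous.
have h2 : continuous (fun f : prod_topology (fun _ : P => R) => f p).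
  exact: (@proj_continuous _ (fun _ : P => R) p).
exact: (h1 x _ (h2 _ _ nV)).
Qed.

Lemma bpt_eq x y : (forall p, sn x p = sn y p) -> x = y.
Proof.
case: x y => [f hf] [g hg] /= h; have e : f = g by apply: funext.
by subst g; congr BPt; exact: Prop_irrelevance.
Qed.

Lemma bpt_hausdorff : hausdorff_space (bpt E).
Proof.
move=> x y h; apply: bpt_eq => p.
apply: (@norm_hausdorff _ R) => A B nA nB.
have [z [Az Bz]] := h _ _ (sn_continuous (p := p) nA) (sn_continuous (p := p) nB).
by exists (sn z p).
Qed.

Definition basic_nbhs x (s : seq P) (e : R) : set (bpt E) :=
  [set z | forall p, p \in s -> `|sn z p - sn x p| < e].

Lemma basic_nbhsP x V : nbhs x V ->
  exists s e, 0 < e /\ basic_nbhs x s e `<=` V.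
Proof.
pose F : set_system (bpt E) := [set V | exists s e, 0 < e /\ basic_nbhs x s e `<=` V].
suff h : F --> x by move=> /h.
have FF : Filter F.
  split.
  - by exists [::], 1.
  - move=> A B [s [e [e0 hA]]] [s' [e' [e0' hB]]].
    exists (s ++ s'), (Num.min e e'); split; first by rewrite lt_min e0.
    move=> z hz; split; [apply: hA|apply: hB] => p ps;
      have := hz p; rewrite mem_cat ps ?orbT => /(_ isT); rewrite lt_min => /andP[] //.
  - by move=> A B AB [s [e [e0 h]]]; exists s, e; split=> //; exact: subset_trans h AB.
apply: bpt_cvg => p; apply/cvgrPdist_lt => e e0.
exists [:: p], e; split=> // z /(_ p); rewrite inE => /(_ (eqxx _)).
by rewrite distrC.
Qed.

Lemma basic_nbhs_nbhs x s e : 0 < e -> nbhs x (basic_nbhs x s e).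
Proof.
move=> e0; elim: s => [|p s IH].
  by apply: filterS filterT => z _ p.
have h : nbhs x [set z | `|sn z p - sn x p| < e].
  have /cvgrPdist_lt/(_ _ e0) := @sn_continuous p x.
  by apply: filterS => z /=; rewrite distrC.
by apply: filterS (filterI h IH) => z [/= h1 h2] q; rewrite inE => /predU1P[->|/h2].
Qed.

(** Along an ultrafilter, sn z p converges in the segment from 0 to B p for each p; the seminorm
    axioms pass to the pointwise limit. *)
Lemma bounded_compact (B : P -> R) : compact [set z : bpt E | forall p, sn z p <= B p].
Proof.
rewrite compact_ultra => F UF FK.
have cv p : exists l : R, sn z p @[z --> F] --> l.
  have cI : compact `[0, B p]%classic by exact: segment_compact.
  move: cI; rewrite compact_ultra => /(_ (fmap (fun z : bpt E => sn z p) F)) [||l [_ hl]].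
  - exact: fmap_ultra.
  - have : F ((fun z : bpt E => sn z p) @^-1` `[0, B p]%classic).
      apply: filterS FK => z h; rewrite /preimage /= in_itv /=.
      by rewrite sn_ge0 h.
    by [].
  - by exists l.
have [l hl] := choice cv.
have PF : ProperFilter F by exact: ultra_proper.
have le_lim (f g : bpt E -> R) (a b : R) : f z @[z --> F] --> a -> g z @[z --> F] --> b ->
   (forall z, f z <= g z) -> a <= b.
  move=> hf hg h; rewrite -(cvg_lim (@norm_hausdorff _ R) hf) -(cvg_lim (@norm_hausdorff _ R) hg).
  by apply: ler_lim; [exact: (cvgP _ hf)|exact: (cvgP _ hg)|exact: nearW].
have lcst (c : R) : c @[_ --> F] --> c by exact: cvg_cst.
have eq_lim (f g : bpt E -> R) (a b : R) : f z @[z --> F] --> a -> g z @[z --> F] --> b ->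
   (forall z, f z = g z) -> a = b.
  move=> hf hg h; apply/eqP; rewrite eq_le; apply/andP; split.
    by apply: (le_lim _ _ _ _ hf hg) => z; rewrite h.
  by apply: (le_lim _ _ _ _ hg hf) => z; rewrite h.
have pt : [/\ forall p, 0 <= l p, l 0 = 0 /\ l 1 = 1, forall p q, l (p + q) <= l p + l q,
   forall p q, l (p * q) = l p * l q & forall a, l (ba_map a) <= nr_norm a].
  split.
  - by move=> p; apply: (le_lim _ _ _ _ (lcst 0) (hl p)) => z; exact: sn_ge0.
  - split; first by apply: (eq_lim _ _ _ _ (hl 0) (lcst 0)) => z; exact: sn0.
    by apply: (eq_lim _ _ _ _ (hl 1) (lcst 1)) => z; exact: sn1.
  - by move=> p q; apply: (le_lim _ _ _ _ (hl _) (cvgD (hl p) (hl q))) => z; exact: snD.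
  - by move=> p q; apply: (eq_lim _ _ _ _ (hl _) (cvgM (hl p) (hl q))) => z; exact: snM.
  - by move=> a; apply: (le_lim _ _ _ _ (hl _) (lcst _)) => z; exact: sn_base.
pose x := BPt pt; exists x; split; last exact: bpt_cvg.
move=> p /=.
have : \forall z \near F, sn z p <= B p by apply: filterS FK => z; apply.
have hc := cvgP _ (hl p).
by move=> h; rewrite -(cvg_lim (@norm_hausdorff _ R) (hl p)); apply: limr_le.
Qed.

Definition loc_compact := forall x, exists2 K, compact K & nbhs x K.

Lemma compact_in_nbhs : loc_compact -> forall x V, nbhs x V ->
  exists K, [/\ compact K, nbhs x K & K `<=` V].
Proof.
move=> lc x V /basic_nbhsP[s [e [e0 hV]]]; have [K cK nK] := lc x.
have e2 : 0 < e / 2 by rewrite divr_gt0.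
pose D := [set z : bpt E | forall p, p \in s -> `|sn z p - sn x p| <= e / 2].
have cD : closed D.
  have -> : D = \bigcap_(p in [set` s]) (fun z => `|sn z p - sn x p|) @^-1` [set r | r <= e / 2].
    by apply/seteqP; split=> z h p /h.
  apply: closed_bigI => p _; apply: preimage_closed; last exact: closed_le.
  move=> z _; apply: (@continuous_comp _ _ _ (fun z : bpt E => sn z p - sn x p) (fun r => `|r|)).
    by apply: continuousB; [exact: sn_continuous|exact: cst_continuous].
  exact: norm_continuous.
exists (K `&` D); split.
- exact: compact_closedI.
- apply: filterI => //; apply: filterS (basic_nbhs_nbhs x s e2) => z h p /h; exact: ltW.
- move=> z [_ h]; apply: hV => p /h h'; apply: (le_lt_trans h'); lra.
Qed.

End PointTopology.

Lemma abs_rsn (R : realType) (L : fieldType) (v : L -> R) : is_abs v -> is_rsn v.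
Proof.
move=> hv; split; [exact: abs_ge0 hv|exact: abs0|exact: abs1|exact: absN|exact: absD hv|].
by move=> a b; rewrite (absM hv).
Qed.

Lemma rsn_dist (R : realType) (B : comNzRingType) (z : B -> R) : is_rsn z ->
  forall a b, `|z a - z b| <= z (a - b).
Proof.
move=> hz a b; have h c d : z c <= z d + z (c - d).
  by apply: le_trans (rsnD hz _ _); rewrite addrC subrK.
have sym : z (b - a) = z (a - b) by rewrite -[RHS](rsnN hz) opprB.
rewrite ler_norml; apply/andP; split; last by rewrite lerBlDl; exact: h.
by rewrite lerBrDr addrC lerBlDr -sym; exact: h.
Qed.

Section AffinePoints.
Variables (R : realType) (A : comNzRingType) (nA : A -> R) (n : nat).
Local Notation E := (aff_alg nA n).
Local Notation P := (poly_ring A n).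

Section PointOf.
Variables (B : comNzRingType) (z : B -> R) (io : {rmorphism A -> B}) (w : 'I_n -> B).
Hypotheses (hz : is_rsn z) (mz : is_mult z) (bd : forall a, z (io a) <= nA a).

Fact point_of_subproof : [/\ forall p : ba_ring E, 0 <= z (peval io w p),
  z (peval io w (0 : ba_ring E)) = 0 /\ z (peval io w (1 : ba_ring E)) = 1,
  forall p q : ba_ring E, z (peval io w (p + q)) <= z (peval io w p) + z (peval io w q),
  forall p q : ba_ring E, z (peval io w (p * q)) = z (peval io w p) * z (peval io w q) &
  forall a, z (peval io w (ba_map (b := E) a)) <= nr_norm a].
Proof.
split=> [p|||p q|a].
- exact: (rsn_ge0 hz).
- by rewrite rmorph0 rmorph1 (rsn0 hz) (rsn1 hz).
- by move=> p q; rewrite rmorphD; exact: (rsnD hz).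
- by rewrite rmorphM mz.
- by rewrite pevalC; exact: bd.
Qed.
(** The point defined by a tuple in a ring with a multiplicative seminorm. Not asking [B] to be a
    field admits tuples in H(y)[X], that is, families of points along a line. *)
Definition point_of : bpt E := @BPt R E (fun p => z (peval io w p)) point_of_subproof.
End PointOf.

Lemma peval_estimates (rho : R) (p : P) : 0 <= rho -> exists2 K, 0 <= K &
  forall (B : comNzRingType) (z : B -> R) (io : {rmorphism A -> B}),
  is_rsn z -> is_mult z -> (forall a, z (io a) <= nA a) ->
  forall (w w' : 'I_n -> B) d, (forall i, z (w i) <= rho) -> (forall i, z (w' i) <= rho) ->
  (forall i, z (w i - w' i) <= d) -> 0 <= d ->
  z (peval io w p) <= K /\ z (peval io w p - peval io w' p) <= K * d.
Proof.
move=> rho0; elim/poly_ring_ind: p => [c|i|p q [K K0 hK] [K' K'0 hK']|p q [K K0 hK] [K' K'0 hK']].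
- exists (`|nA c|) => // B z io hz mz bd w w' d hw hw' hd d0.
  rewrite !pevalC subrr (rsn0 hz) mulr_ge0 //; split=> //.
  by apply: (le_trans (bd c)); exact: ler_norm.
- exists (rho + 1); first by rewrite addr_ge0.
  move=> B z io hz mz bd w w' d hw hw' hd d0; rewrite !pevalX; split.
    by apply: (le_trans (hw i)); rewrite lerDl.
  apply: (le_trans (hd i)); rewrite mulrDl mul1r lerDr mulr_ge0 //.
- exists (K + K'); first exact: addr_ge0.
  move=> B z io hz mz bd w w' d hw hw' hd d0.
  have [h1 h2] := hK B z io hz mz bd w w' d hw hw' hd d0.
  have [h3 h4] := hK' B z io hz mz bd w w' d hw hw' hd d0.
  rewrite !rmorphD opprD addrACA mulrDl; split; apply: (le_trans (rsnD hz _ _)); exact: lerD.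
- exists (K * K' + (K * K' + K' * K)); first by rewrite !addr_ge0 // mulr_ge0.
  move=> B z io hz mz bd w w' d hw hw' hd d0.
  have [h1 h2] := hK B z io hz mz bd w w' d hw hw' hd d0.
  have [h3 h4] := hK' B z io hz mz bd w w' d hw hw' hd d0.
  have hd' i : z (w' i - w i) <= d by rewrite -(rsnN hz) opprB.
  have [h5 _] := hK' B z io hz mz bd w' w d hw' hw hd' d0.
  have KK : 0 <= K * K' by rewrite mulr_ge0.
  have KK' : 0 <= K' * K by rewrite mulr_ge0.
  rewrite !rmorphM; split.
    rewrite mz; apply: (@le_trans _ _ (K * K')); last by lra.
    by apply: ler_pM; rewrite ?(rsn_ge0 hz).
  have -> : peval io w p * peval io w q - peval io w' p * peval io w' q =
    peval io w p * (peval io w q - peval io w' q) + peval io w' q * (peval io w p - peval io w' p).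
    by ring.
  apply: (le_trans (rsnD hz _ _)); rewrite !mz.
  have f1 : z (peval io w p) * z (peval io w q - peval io w' q) <= K * (K' * d).
    by apply: ler_pM; rewrite ?(rsn_ge0 hz).
  have f2 : z (peval io w' q) * z (peval io w p - peval io w' p) <= K' * (K * d).
    by apply: ler_pM; rewrite ?(rsn_ge0 hz).
  have f3 : 0 <= K * K' * d by rewrite mulr_ge0.
  lra.
Qed.

(** Bounds on the coordinates bound every polynomial, by induction, so the neighbourhood where
    coordinates exceed those of x by less than 1 lies in a set covered by [bounded_compact]. *)
Lemma aff_loc_compact : loc_compact E.
Proof.
move=> x; pose rho := \sum_i sn x (poly_var A i) + 1.
have rho0 : 0 <= rho by rewrite addr_ge0 // sumr_ge0 // => i _; exact: sn_ge0.
have /choice[B hB] p : exists B, forall z : bpt E,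
    (forall i, sn z (poly_var A i) <= rho) -> sn z p <= B.
  elim/poly_ring_ind: p => [c|i|p q [K hK] [K' hK']|p q [K hK] [K' hK']].
  - by exists (nA c) => z _; exact: (@sn_base R E z c).
  - by exists rho => z; apply.
  - exists (K + K') => z hz; apply: (le_trans (snD _ _ _)).
    by apply: lerD; [exact: hK|exact: hK'].
  - exists (K * K') => z hz; rewrite snM.
    by apply: ler_pM; rewrite ?sn_ge0 ?hK ?hK'.
exists [set z : bpt E | forall p, sn z p <= B p]; first exact: bounded_compact.
pose s : seq (ba_ring E) := [seq poly_var A i | i <- enum 'I_n].
apply: filterS (basic_nbhs_nbhs x s ltr01) => z hz p; apply: hB => i.
have /hz : (poly_var A i : ba_ring E) \in s by apply: map_f; rewrite mem_enum.
rewrite ltr_distl => /andP[_ h]; apply: (le_trans (ltW h)); rewrite /rho lerD2r.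
by rewrite (bigD1 i) //= lerDl sumr_ge0 // => j _; exact: sn_ge0.
Qed.

Lemma poly_const_zmod : GRing.zmod_morphism (@poly_const A n).
Proof. by move=> a b; exact: (mpoly.mpolyCB n a b). Qed.
Lemma poly_const_monoid : GRing.monoid_morphism (@poly_const A n).
Proof. by split=> [|a b]; [exact: mpoly.mpolyC1|exact: (mpoly.mpolyCM n a b)]. Qed.
HB.instance Definition _ := GRing.isZmodMorphism.Build A (poly_ring A n) (@poly_const A n) poly_const_zmod.
HB.instance Definition _ := GRing.isMonoidMorphism.Build A (poly_ring A n) (@poly_const A n) poly_const_monoid.

Section HFPoint.
Variable y : bpt E.
Definition hbase (a : A) : HF y := pv y (poly_const A n a : ba_ring E).
Fact hbase_zmod : GRing.zmod_morphism hbase.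
Proof. by move=> a b; rewrite /hbase (rmorphB (@poly_const A n)) (rmorphB (@pv R E y)). Qed.
Fact hbase_monoid : GRing.monoid_morphism hbase.
Proof.
split; first by rewrite /hbase (rmorph1 (@poly_const A n)) (rmorph1 (@pv R E y)).
by move=> a b; rewrite /hbase (rmorphM (@poly_const A n)) (rmorphM (@pv R E y)).
Qed.
HB.instance Definition _ := GRing.isZmodMorphism.Build A (HF y) hbase hbase_zmod.
HB.instance Definition _ := GRing.isMonoidMorphism.Build A (HF y) hbase hbase_monoid.

Definition hcoord (i : 'I_n) : HF y := pv y (poly_var A i : ba_ring E).

Lemma pv_peval p : pv y p = peval hbase hcoord p.
Proof.
elim/poly_ring_ind: p => [c|i|p q h1 h2|p q h1 h2].
- by rewrite pevalC.
- by rewrite pevalX.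
- have -> : pv y (p + q : P) = pv y p + pv y q by exact: (rmorphD (@pv R E y)).
  by rewrite h1 h2 rmorphD.
- have -> : pv y (p * q : P) = pv y p * pv y q by exact: (rmorphM (@pv R E y)).
  by rewrite h1 h2 rmorphM.
Qed.

Lemma hbase_le a : habs (hbase a) <= nA a.
Proof. by rewrite /hbase habs_pv; exact: (@sn_base R E y a). Qed.
End HFPoint.

(** One radius serves all y near x because [peval_estimates] is uniform in the ring. It will be used
    with B = H(y), for points in the polydisc around y, and with B = H(y)[X], for lines in it. *)
Lemma polydisc_in_nbhs (x : bpt E) V : nbhs x V -> exists W r, [/\ nbhs x W, 0 < r &
  forall y, W y -> forall (B : comNzRingType) (z : B -> R) (k : {rmorphism HF y -> B})
    (io : {rmorphism A -> B}) (hz : is_rsn z) (mz : is_mult z) (bd : forall a, z (io a) <= nA a),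
    (forall h, z (k h) = habs h) -> (forall a, io a = k (hbase y a)) ->
    forall w : 'I_n -> B, (forall i, z (w i - k (hcoord y i)) <= r) ->
    V (point_of w hz mz bd)].
Proof.
move=> /basic_nbhsP[s [e [e0 sV]]].
(* One unit allows for passing from x to y, the other from y to the tuple w, as r <= 1. *)
pose rho := \sum_i sn x (poly_var A i) + 2.
have rho0 : 0 <= rho by rewrite addr_ge0 // sumr_ge0 // => i _; exact: sn_ge0.
have [K [K0 hK]] : exists K, 0 <= K /\ forall p, p \in s ->
  forall (B : comNzRingType) (z : B -> R) (io : {rmorphism A -> B}),
  is_rsn z -> is_mult z -> (forall a, z (io a) <= nA a) ->
  forall (w w' : 'I_n -> B) d, (forall i, z (w i) <= rho) -> (forall i, z (w' i) <= rho) ->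
  (forall i, z (w i - w' i) <= d) -> 0 <= d ->
  z (peval io w p - peval io w' p) <= K * d.
  elim: (s) => [|p s' [K [K0 hK]]]; first by exists 0; split.
  have [K' K'0 hK'] := peval_estimates p rho0.
  exists (K + K'); split; first exact: addr_ge0.
  move=> q; rewrite inE => /predU1P[->|qs] B z io hz mz bd w w' d hw hw' hd d0.
    have [_ h] := hK' B z io hz mz bd w w' d hw hw' hd d0.
    by apply: (le_trans h); rewrite ler_wpM2r // lerDr.
  apply: (le_trans (hK q qs B z io hz mz bd w w' d hw hw' hd d0)).
  by rewrite ler_wpM2r // lerDl.
pose t : seq (ba_ring E) := [seq poly_var A i | i <- enum 'I_n].
have e2 : 0 < e / 2 by rewrite divr_gt0.
pose r := Num.min 1 (e / 2 / (K + 1)).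
have K1 : 0 < K + 1 by lra.
have r0 : 0 < r by rewrite lt_min ltr01 !divr_gt0.
exists (basic_nbhs x s (e / 2) `&` basic_nbhs x t 1), r; split=> //.
  by apply: filterI; exact: basic_nbhs_nbhs.
move=> y [h1 h2] B z k io hz mz bd kiso iok w hw; apply: sV => p ps /=.
have r1 : r <= 1 by rewrite ge_min lexx.
have rK : r * (K + 1) <= e / 2 by rewrite -ler_pdivlMr // ge_min lexx orbT.
have hc i : z (k (hcoord y i)) <= rho - 1.
  rewrite kiso habs_pv.
  have /h2 : (poly_var A i : ba_ring E) \in t by apply: map_f; rewrite mem_enum.
  rewrite ltr_distl => /andP[_ h].
  have : sn x (poly_var A i) <= \sum_i sn x (poly_var A i).
    by rewrite (bigD1 i) //= lerDl sumr_ge0 // => j _; exact: sn_ge0.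
  by move: h; rewrite /rho; lra.
have hc' i : z (k (hcoord y i)) <= rho by have := hc i; lra.
have hw' i : z (w i) <= rho.
  have -> : w i = k (hcoord y i) + (w i - k (hcoord y i)) by rewrite addrC subrK.
  apply: (le_trans (rsnD hz _ _)); have := hw i; have := hc i; lra.
have h3 := hK p ps B z io hz mz bd w _ r hw' hc' hw (ltW r0).
have e1 : peval io (fun i => k (hcoord y i)) p = k (pv y p).
  rewrite pv_peval; elim/poly_ring_ind: (p) => [c|i|q q' H1 H2|q q' H1 H2].
  - by rewrite !pevalC iok.
  - by rewrite !pevalX.
  - transitivity (peval io (fun i => k (hcoord y i)) q + peval io (fun i => k (hcoord y i)) q').
      exact: rmorphD.
    by rewrite H1 H2 -rmorphD; congr (k _); rewrite -rmorphD.
  - transitivity (peval io (fun i => k (hcoord y i)) q * peval io (fun i => k (hcoord y i)) q').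
      exact: rmorphM.
    by rewrite H1 H2 -rmorphM; congr (k _); rewrite -rmorphM.
rewrite e1 in h3.
have h4 := h1 p ps.
have h5 : sn y p = z (k (pv y p)) by rewrite kiso habs_pv.
have d1 : `|z (peval io w p) - z (k (pv y p))| <= z (peval io w p - k (pv y p)).
  exact: (rsn_dist hz).
apply: (le_lt_trans (ler_distD (sn y p) _ _)).
have Kr : K * r <= e / 2 by have := ltW r0; lra.
by rewrite h5 in h4 *; have := le_trans d1 h3; move: h4; rewrite -/(sn x p); lra.
Qed.
End AffinePoints.

(** * Regular functions as uniform limits of fractions *)

Section RegularFunctions.
Variables (R : realType) (E : balg R).
Local Notation P := (ba_ring E).
Implicit Types (x y : bpt E) (V U : set (bpt E)) (g h : fun_ring E).

Definition fval g y : HF y := g y.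

(** Uniform approximability stated with fractions p / q rather than elements of [KV V], whose chosen
    representatives cannot be computed with, and on sets that need not be compact. *)
Definition reg_on V g := forall e : R, 0 < e -> exists p q : P,
  forall y, V y -> sn y q <> 0 /\ habs (fval g y - hv y p q) <= e.

Lemma reg_on_sub V V' g : V' `<=` V -> reg_on V g -> reg_on V' g.
Proof. by move=> s h e e0; have [p [q hpq]] := h e e0; exists p, q => y /s; exact: hpq. Qed.

Lemma KV_den V (k : KV V) y : V y -> sn y (lden k) <> 0.
Proof.
move=> Vy.
have h : mult_gen [set q : P | forall x, V x -> sn x q <> 0] (lden k) by exact: ldenP.
apply: (h [set q | sn y q <> 0]); split; last by move=> q; apply.
by split=> [|a b]; [exact: sn1_neq0|exact: snM_neq0].
Qed.

Lemma KV_frac V (p q : P) y : V y -> (forall y, V y -> sn y q <> 0) ->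
  hv y (lnum (lfrac [set q : P | forall x, V x -> sn x q <> 0] p q))
       (lden (lfrac [set q : P | forall x, V x -> sn x q <> 0] p q)) = hv y p q.
Proof.
move=> Vy hq; set S := [set q | _].
have hqm : mult_gen S q by move=> M [_]; apply.
have [t ht e] := lfracP p hqm.
have ny a : mult_gen S a -> sn y a <> 0.
  move=> ha; apply: (ha [set q | sn y q <> 0]); split; last by move=> r; apply.
  by split=> [|a' b']; [exact: sn1_neq0|exact: snM_neq0].
apply: hv_eq; [exact: ny (ldenP _)|exact: ny hqm|].
have /eqP := congr1 (@sn R E y) e; rewrite snM sn0 mulf_eq0 => /orP[/eqP h|/eqP //].
by case: (ny _ ht).
Qed.

Definition reg_near x g := exists2 V, nbhs x V & reg_on V g.

Lemma is_regular_near U g x : is_regular U g -> U x -> reg_near x g.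
Proof.
move=> h Ux; have [V [cV nV _ hV]] := h x Ux; exists V => // e e0.
have [k hk] := hV e e0; exists (lnum k), (lden k) => y Vy; split; first exact: KV_den.
exact: hk.
Qed.

Hypothesis lc : loc_compact E.

(** Local compactness supplies the compact neighbourhoods demanded by [is_regular]. *)
Lemma near_is_regular U g : open U -> (forall x, U x -> reg_near x g) -> is_regular U g.
Proof.
move=> oU h x Ux; have [V nV hV] := h x Ux.
have [K [cK nK KV]] := compact_in_nbhs lc (filterI nV (open_nbhs_nbhs (conj oU Ux))).
exists K; split=> //; first by move=> y /KV[].
move=> e e0; have [p [q hpq]] := hV e e0.
exists (lfrac _ p q) => y Ky.
have hq y' : K y' -> sn y' q <> 0 by move=> /KV[/hpq[]].
have [_ hy] := hpq y (KV y Ky).1.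
apply: le_trans hy; rewrite le_eqVlt; apply/orP; left; apply/eqP.
have <- := KV_frac p Ky hq.
by [].
Qed.

Lemma reg_near_open x g : reg_near x g ->
  exists U, [/\ open U, U x & is_regular U g].
Proof.
case=> V nV hV; exists V°; split; [exact: open_interior|exact: nV|].
by apply: near_is_regular; [exact: open_interior|move=> y Vy; exists V].
Qed.

Lemma reg_nearP x g : (exists U, [/\ open U, U x & is_regular U g]) <-> reg_near x g.
Proof.
split; last exact: reg_near_open.
by case=> U [oU Ux h]; exact: is_regular_near h Ux.
Qed.

Lemma sn_near_continuous x p e : 0 < e -> exists2 V, nbhs x V &
  forall y, V y -> `|sn y p - sn x p| <= e.
Proof.
move=> e0; exists (basic_nbhs x [:: p] e); first exact: basic_nbhs_nbhs.
by move=> y /(_ p); rewrite inE eqxx => /(_ isT)/ltW.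
Qed.

Lemma sn_neq0_near x q : sn x q <> 0 -> exists2 V, nbhs x V &
  forall y, V y -> sn x q / 2 <= sn y q.
Proof.
move=> /eqP q0; have q0' : 0 < sn x q by rewrite lt_neqAle sn_ge0 andbT eq_sym.
have [V nV hV] := @sn_near_continuous x q (sn x q / 2) (divr_gt0 q0' (ltr0n _ 2)).
exists V => // y /hV; rewrite ler_distl => /andP[h _]; lra.
Qed.

Lemma hv_near x p q e : sn x q <> 0 -> 0 < e -> exists2 V, nbhs x V &
  forall y, V y -> sn y q <> 0 /\ `|sn y p / sn y q - sn x p / sn x q| <= e.
Proof.
move=> q0 e0; have [V nV hV] := sn_neq0_near q0.
have xq : 0 < sn x q by move/eqP: q0; rewrite lt_neqAle sn_ge0 andbT eq_sym.
(* The difference of the quotients is at most d * (sn x p + sn x q) / (sn y q * sn x q), and sn y q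
   is at least sn x q / 2. *)
pose d := e * (sn x q / 2) * sn x q / (sn x p + sn x q).
have pq0 : 0 < sn x p + sn x q by rewrite ltr_wpDl // sn_ge0.
have d0 : 0 < d by rewrite divr_gt0 // mulr_gt0 // mulr_gt0 // divr_gt0.
have [V1 nV1 hV1] := sn_near_continuous x p d0.
have [V2 nV2 hV2] := sn_near_continuous x q d0.
exists (V `&` (V1 `&` V2)); first by apply: filterI => //; exact: filterI.
move=> y [/hV hy [/hV1 h1 /hV2 h2]].
have yq : 0 < sn y q by lra.
split; first by apply/eqP; rewrite gt_eqF.
have -> : sn y p / sn y q - sn x p / sn x q =
  ((sn y p - sn x p) * sn x q - sn x p * (sn y q - sn x q)) / (sn y q * sn x q).
  by field; rewrite !gt_eqF.
rewrite normrM normfV [`|sn y q * _|]ger0_norm; last by rewrite mulr_ge0 // ltW.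
rewrite ler_pdivrMr ?mulr_gt0 //.
apply: (le_trans (ler_normB _ _)); rewrite !normrM.
rewrite (ger0_norm (ltW xq)) (ger0_norm (sn_ge0 x p)).
have f1 : `|sn y p - sn x p| * sn x q <= d * sn x q by rewrite ler_pM2r.
have f2 : sn x p * `|sn y q - sn x q| <= sn x p * d by rewrite ler_wpM2l // sn_ge0.
have f3 : d * (sn x p + sn x q) = e * (sn x q / 2) * sn x q by rewrite /d divfK // gt_eqF.
have f4 : e * (sn x q / 2) * sn x q <= e * (sn y q * sn x q).
  by rewrite -mulrA ler_pM2l // ler_pM2r.
lra.
Qed.

Lemma reg_near_at x g : reg_near x g -> forall e, 0 < e -> exists p q,
  [/\ sn x q <> 0 , habs (fval g x - hv x p q) <= e &
  exists2 V, nbhs x V & forall y, V y -> sn y q <> 0 /\ habs (fval g y - hv y p q) <= e].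
Proof.
case=> V nV hV e e0; have [p [q h]] := hV e e0; exists p, q.
have [h1 h2] := h x (nbhs_singleton nV).
by split=> //; exists V.
Qed.

Lemma habs_near x g e : reg_near x g -> 0 < e -> exists2 V, nbhs x V &
  forall y, V y -> `|habs (fval g y) - habs (fval g x)| <= e.
Proof.
move=> hg e0; have e3 : 0 < e / 3 by rewrite divr_gt0.
have [p [q [q0 h0 [V nV hV]]]] := reg_near_at hg e3.
have [V' nV' hV'] := @hv_near x p q _ q0 e3.
exists (V `&` V'); first exact: filterI.
move=> y [/hV[h1 h2] /hV'[h3 h4]].
have h5 := abs_dist (habs_abs y) (fval g y) (hv y p q).
have h6 := abs_dist (habs_abs x) (fval g x) (hv x p q).
rewrite habs_hv // in h5; rewrite habs_hv // in h6.
exact: (dist3_est (le_trans h5 h2) (le_trans h6 h0) h4).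
Qed.

Lemma reg_near_bounded x g : reg_near x g -> exists V B,
  [/\ nbhs x V, 0 < B, reg_on V g & forall y, V y -> habs (fval g y) <= B].
Proof.
move=> hg; have [V nV hV] := habs_near hg ltr01; case: (hg) => V' nV' hV'.
exists (V `&` V'), (habs (fval g x) + 1); split.
- exact: filterI.
- by rewrite ltr_wpDl // (abs_ge0 (habs_abs x)).
- by apply: reg_on_sub hV' => y [].
- by move=> y [/hV + _]; rewrite ler_distl => /andP[_].
Qed.

Lemma reg_near_hval x (p q : P) : sn x q <> 0 -> reg_near x (hval p q : fun_ring E).
Proof.
move=> q0; have [V nV hV] := sn_neq0_near q0; exists V => // e e0; exists p, q => y /hV h.
have xq : 0 < sn x q by move/eqP: q0; rewrite lt_neqAle sn_ge0 andbT eq_sym.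
split; first by apply/eqP; rewrite gt_eqF //; lra.
have -> : fval (hval p q : fun_ring E) y = hv y p q by [].
by rewrite subrr (abs0 (habs_abs y)) ltW.
Qed.

Lemma reg_near_eq x g g' : reg_near x g -> (\forall y \near x, g y = g' y) -> reg_near x g'.
Proof.
move=> [V nV hV] h; exists (V `&` [set y | g y = g' y]); first exact: filterI.
move=> e e0; have [p [q hpq]] := hV e e0; exists p, q => y [Vy /= ey].
by rewrite /fval -ey; exact: hpq.
Qed.

Lemma reg_nearB x g h : reg_near x g -> reg_near x h -> reg_near x (g - h).
Proof.
move=> [V nV hV] [V' nV' hV']; exists (V `&` V'); first exact: filterI.
move=> e e0; have e2 : 0 < e / 2 by rewrite divr_gt0.
have [p [q hpq]] := hV _ e2; have [p' [q' hpq']] := hV' _ e2.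
exists (p * q' - p' * q), (q * q') => y [/hpq[q0 h1] /hpq'[q0' h2]].
split; first exact: snM_neq0.
have -> : fval (g - h) y = fval g y - fval h y by [].
have -> : hv y (p * q' - p' * q) (q * q') = hv y p q - hv y p' q'.
  by rewrite hvN // hvD // mulNr.
exact: (abs_sub_est (habs_abs y) h1 h2).
Qed.

Lemma reg_nearM x g h : reg_near x g -> reg_near x h -> reg_near x (g * h).
Proof.
move=> /reg_near_bounded[V [B [nV B0 hV bV]]] /reg_near_bounded[V' [B' [nV' B'0 hV' bV']]].
exists (V `&` V'); first exact: filterI.
move=> e e0; have [d [d0 d1 dB]] : exists d, [/\ 0 < d, d <= 1 & d * (B + B' + 1) <= e].
  have BB : 0 < B + B' + 1 by lra.
  exists (Num.min 1 (e / (B + B' + 1))); split; first by rewrite lt_min ltr01 divr_gt0.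
    by rewrite ge_min lexx.
  by rewrite -ler_pdivlMr // ge_min lexx orbT.
have d2 : 0 < d / 2 by rewrite divr_gt0.
have dd r : r <= d / 2 -> r < d by lra.
have [p [q hpq]] := hV _ d2; have [p' [q' hpq']] := hV' _ d2.
exists (p * p'), (q * q') => y [Vy Vy'].
have [q0 h1] := hpq y Vy; have [q0' h2] := hpq' y Vy'.
split; first exact: snM_neq0.
have -> : fval (g * h) y = fval g y * fval h y by [].
rewrite -hvM //; apply: ltW.
exact: (abs_mul_est (habs_abs y) d0 d1 (bV y Vy) (bV' y Vy') dB (dd _ h1) (dd _ h2)).
Qed.

(** Near x the function stays above half its absolute value at x, so inverses q / p of good
    approximants p / q approximate its inverse uniformly. *)
Lemma reg_near_inv x g : reg_near x g -> g x <> 0 :> HF x ->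
  exists2 h, reg_near x h & \forall y \near x, (g * h) y = 1.
Proof.
move=> hg gx0; have hax := habs_abs x.
have c0 : 0 < habs (fval g x) by rewrite (abs_gt0 hax); apply/eqP.
set c := habs (fval g x) in c0; have c2 : 0 < c / 2 by rewrite divr_gt0.
have [V nV hV] := habs_near hg c2; case: (hg) => V' nV' hV'.
pose h : fun_ring E := fun y => (fval g y)^-1.
have low y : V y -> c / 2 <= habs (fval g y).
  by move/hV; rewrite ler_distl -/c => /andP[k _]; lra.
exists h; last first.
  apply: filterS nV => y /low k; have ha := habs_abs y.
  have n0 : fval g y != 0 by rewrite -(abs_gt0 ha); apply: lt_le_trans k.
  exact: (divff n0).
exists (V `&` V'); first exact: filterI.
move=> e e0; have [d [d0 d1 d2]] : exists d, [/\ 0 < d, d <= c / 2 / 2 & 2 * d <= e * (c / 2) ^+ 2].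
  exists (Num.min (c / 2 / 2) (e * (c / 2) ^+ 2 / 2)); split.
  - by rewrite lt_min !divr_gt0 // mulr_gt0 // exprn_gt0.
  - by rewrite ge_min lexx.
  - by rewrite mulrC -ler_pdivlMr // ge_min lexx orbT.
have d20 : 0 < d / 2 by rewrite divr_gt0.
have dd r : r <= d / 2 -> r < d by lra.
have [p [q hpq]] := hV' _ d20; exists q, p => y [Vy V'y].
have [q0 h1] := hpq y V'y; have h2 := low y Vy; have ha := habs_abs y.
have a0 : fval g y != 0 by rewrite -(abs_gt0 ha); apply: lt_le_trans h2.
have k1 : d <= habs (fval g y) / 2.
  by apply: (le_trans d1); rewrite ler_pM2r ?invr_gt0.
have k2 : 2 * d <= e * habs (fval g y) ^+ 2.
  apply: (le_trans d2); rewrite ler_pM2l //.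
  by rewrite !expr2; exact: (ler_pM (ltW c2) (ltW c2) h2 h2).
have [b0 h3] := abs_inv_est ha a0 k1 k2 (dd _ h1).
have p0 : sn y p <> 0.
  move=> e1; have := abs_gt0 ha (hv y p q); rewrite b0 habs_hv // e1 mul0r ltxx //.
split=> //.
have -> : hv y q p = (hv y p q)^-1 by rewrite !hvE // invf_div.
exact: ltW h3.
Qed.
End RegularFunctions.

(** * Stalks and values of germs *)

Section Stalks.
Variables (R : realType) (A : comNzRingType) (nA : A -> R) (n : nat).
Local Notation E := (aff_alg nA n).
Local Notation P := (ba_ring E).
Let lc : loc_compact E := aff_loc_compact (nA := nA) (n := n).
Variable x : bpt E.

Local Notation S := [set g : fun_ring E | exists U, [/\ open U, U x & is_regular U g]].
Local Notation N := [set g : subring S | \forall y \near x, sr_val g y = 0].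

Let SP g : S g <-> reg_near x g. Proof. exact: (reg_nearP lc x g). Qed.

Lemma reg_near1 : reg_near x (1 : fun_ring E).
Proof.
apply: (@reg_near_eq R E x (hval (1 : P) 1 : fun_ring E)); first exact: (reg_near_hval 1 (@sn1_neq0 R E x)).
by apply: filterS filterT => y _; exact: hv1.
Qed.

Lemma near_regular_subring : is_subring S.
Proof.
split; first by apply/(reg_nearP lc); exact: reg_near1.
  by move=> a b /(reg_nearP lc) ha /(reg_nearP lc) hb; apply/(reg_nearP lc); exact: reg_nearB.
by move=> a b /(reg_nearP lc) ha /(reg_nearP lc) hb; apply/(reg_nearP lc); exact: reg_nearM.
Qed.

Let N_ideal : is_ideal N.
Proof.
split; first exact: (filterS _ filterT).
  move=> a b ha hb; apply: filterS2 ha hb => y h1 h2.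
  have -> : sr_val (a + b) y = sr_val a y + sr_val b y by [].
  by rewrite h1 h2 addr0.
move=> a b hb; apply: filterS hb => y h.
have -> : sr_val (a * b) y = sr_val a y * sr_val b y by [].
by rewrite h mulr0.
Qed.

Let sr_inE g : reg_near x g -> sr_val (sr_in S g) = g.
Proof. by move=> hg; apply: (sr_inK near_regular_subring); exact/SP. Qed.

Lemma germ_eq g h : reg_near x g -> reg_near x h ->
  germ x g = germ x h <-> \forall y \near x, g y = h y.
Proof.
move=> hg hh; rewrite /germ qpiP_eq (ideal_gen_id N_ideal).
have e y : sr_val (sr_in S g - sr_in S h) y = g y - h y.
  have -> : sr_val (sr_in S g - sr_in S h) y = sr_val (sr_in S g) y - sr_val (sr_in S h) y by [].
  by rewrite !sr_inE.
split=> H; apply: filterS H => y; first by rewrite e => /eqP; rewrite subr_eq0 => /eqP.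
by move=> h1; rewrite e h1 subrr.
Qed.

Lemma germB g h : reg_near x g -> reg_near x h -> germ x (g - h) = germ x g - germ x h.
Proof.
move=> hg hh; rewrite /germ -qpiB; congr qpi; apply: val_inj.
rewrite -[RHS]/(sr_val (sr_in S g) - sr_val (sr_in S h)) -[LHS]/(sr_val (sr_in S (g - h))).
by rewrite (sr_inE hg) (sr_inE hh) (sr_inE (reg_nearB hg hh)).
Qed.

Lemma germM g h : reg_near x g -> reg_near x h -> germ x (g * h) = germ x g * germ x h.
Proof.
move=> hg hh; rewrite /germ -qpiM; congr qpi; apply: val_inj.
rewrite -[RHS]/(sr_val (sr_in S g) * sr_val (sr_in S h)) -[LHS]/(sr_val (sr_in S (g * h))).
by rewrite (sr_inE hg) (sr_inE hh) (sr_inE (reg_nearM hg hh)).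
Qed.

Lemma germ1 : germ x (1 : fun_ring E) = 1.
Proof.
have -> : (1 : stalk x) = qpi N 1 by rewrite qpi1.
congr qpi; apply: val_inj.
rewrite -[RHS]/(1 : fun_ring E) -[LHS]/(sr_val (sr_in S (1 : fun_ring E))).
by rewrite sr_inE //; exact: reg_near1.
Qed.

Definition germ_rep (a : stalk x) : fun_ring E := sr_val (qrep a).

Lemma germ_rep_reg a : reg_near x (germ_rep a).
Proof. by apply/SP; exact: (sr_valP near_regular_subring). Qed.

Lemma germ_repK a : germ x (germ_rep a) = a.
Proof.
rewrite /germ /germ_rep -[RHS]qrepK; congr qpi; apply: val_inj.
by rewrite -[LHS]/(sr_val _) sr_inE //; exact: germ_rep_reg.
Qed.

Definition gvalF (a : stalk x) : HF x := fval (germ_rep a) x.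

Lemma gvalF_germ g : reg_near x g -> gvalF (germ x g) = g x.
Proof.
move=> hg; rewrite /gvalF /fval.
have /(germ_eq (germ_rep_reg _) hg) h : germ x (germ_rep (germ x g)) = germ x g.
  exact: germ_repK.
exact: (nbhs_singleton h).
Qed.

Fact gvalF_zmod : GRing.zmod_morphism gvalF.
Proof.
move=> a b; rewrite -[in LHS](germ_repK a) -[in LHS](germ_repK b).
rewrite -germB ?gvalF_germ //; [exact: reg_nearB (germ_rep_reg a) (germ_rep_reg b)| |];
  exact: germ_rep_reg.
Qed.
Fact gvalF_monoid : GRing.monoid_morphism gvalF.
Proof.
split; first by rewrite -germ1 gvalF_germ //; exact: reg_near1.
move=> a b; rewrite -[in LHS](germ_repK a) -[in LHS](germ_repK b).
rewrite -germM ?gvalF_germ //; [exact: reg_nearM (germ_rep_reg a) (germ_rep_reg b)| |];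
  exact: germ_rep_reg.
Qed.
HB.instance Definition _ := GRing.isZmodMorphism.Build (stalk x) (HF x) gvalF gvalF_zmod.
HB.instance Definition _ := GRing.isMonoidMorphism.Build (stalk x) (HF x) gvalF gvalF_monoid.

(** Non-units therefore vanish at x; this is the only information on the maximal ideal of a stalk
    used later. *)
Lemma gvalF_unit a : gvalF a <> 0 -> exists b, a * b = 1.
Proof.
move=> ha; have [h hh e] := reg_near_inv (germ_rep_reg a) ha.
exists (germ x h); have hr := germ_rep_reg a.
have E1 : germ x (germ_rep a * h) = germ x (1 : fun_ring E).
  exact: ((germ_eq (reg_nearM hr hh) reg_near1).2 e).
by have := germM hr hh; rewrite germ_repK E1 germ1 => <-.
Qed.

Lemma gvalF_hval (p q : P) : sn x q <> 0 -> gvalF (germ x (hval p q : fun_ring E)) = hv x p q.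
Proof. by move=> q0; rewrite gvalF_germ //; exact: reg_near_hval. Qed.

End Stalks.

Section PolynomialGerms.
Variables (R : realType) (A : comNzRingType) (nA : A -> R) (n : nat).
Local Notation E := (aff_alg nA n).
Variable x : bpt E.

Definition pgerm (p : poly_ring A n) : stalk x := germ x (hval (p : ba_ring E) 1 : fun_ring E).

Let reg (p : ba_ring E) : reg_near x (hval p 1 : fun_ring E).
Proof. by apply: reg_near_hval; exact: sn1_neq0. Qed.

Fact pgerm_zmod : GRing.zmod_morphism pgerm.
Proof.
move=> p q; rewrite /pgerm -germB; try exact: reg.
congr germ; apply: functional_extensionality_dep => y.
exact: (rmorphB (@pv R E y)).
Qed.
Fact pgerm_monoid : GRing.monoid_morphism pgerm.
Proof.
split.
  rewrite -[RHS]germ1; congr germ; apply: functional_extensionality_dep => y.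
  exact: (rmorph1 (@pv R E y)).
move=> p q; rewrite /pgerm -germM; try exact: reg.
congr germ; apply: functional_extensionality_dep => y.
exact: (rmorphM (@pv R E y)).
Qed.
HB.instance Definition _ := GRing.isZmodMorphism.Build (poly_ring A n) (stalk x) pgerm pgerm_zmod.
HB.instance Definition _ := GRing.isMonoidMorphism.Build (poly_ring A n) (stalk x) pgerm pgerm_monoid.

Lemma gvalF_pgerm p : gvalF (pgerm p) = pv x p.
Proof. by rewrite gvalF_hval //; exact: sn1_neq0. Qed.
End PolynomialGerms.

(** * Lipschitz estimates for regular functions *)

Lemma thirds_lt (R : realType) (e : R) : 0 < e -> e / 3 + e / 3 < e.
Proof. by move=> ?; lra. Qed.
Lemma half_lt (R : realType) (e : R) : 0 < e -> e / 2 < e.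
Proof. by move=> ?; lra. Qed.
Lemma le_of_quarter (R : realType) (d r : R) : 0 < d -> 4 * d <= r -> d <= r.
Proof. by move=> ? ?; lra. Qed.

Lemma peval_corr (R : realType) (A : comNzRingType) n (L L' : fieldType) (v : L -> R) (v' : L' -> R)
    (r : L -> L' -> Prop) (io : {rmorphism A -> L}) (io' : {rmorphism A -> L'})
    (u : 'I_n -> L) (u' : 'I_n -> L') : isom_corr v v' r ->
  (forall a, r (io a) (io' a)) -> (forall i, r (u i) (u' i)) ->
  forall p, r (peval io u p) (peval io' u' p).
Proof.
move=> hr rb ruu; elim/poly_ring_ind => [c|i|p q h1 h2|p q h1 h2].
- by rewrite !pevalC.
- by rewrite !pevalX.
- by rewrite !rmorphD; exact: (ic_D hr h1 h2).
- by rewrite !rmorphM; exact: (ic_M hr h1 h2).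
Qed.

Section Line.
Variables (A : comNzRingType) (n : nat) (L : fieldType) (io : {rmorphism A -> L}).
Variables (u t : 'I_n -> L).
(** The line with t at parameter 0 and u at parameter 1; a seminorm on L[X] turns this tuple into a
    point of affine space. *)
Definition line (i : 'I_n) : {poly L} := (t i)%:P + (u i - t i)%:P * 'X.
Definition line_base : {rmorphism A -> {poly L}} := (@polyC L \o io)%FUN.

Lemma line_eval p c : (peval line_base line p).[c] =
  peval io (fun i => t i + (u i - t i) * c) p.
Proof.
elim/poly_ring_ind: p => [a|i|p q h1 h2|p q h1 h2].
- by rewrite !pevalC /= hornerC.
- by rewrite !pevalX /line !hornerE.
- by rewrite !rmorphD hornerD h1 h2.
- by rewrite !rmorphM hornerM h1 h2.
Qed.

Lemma line_eval1 p : (peval line_base line p).[1] = peval io u p.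
Proof. by rewrite line_eval; congr (peval _ _ _); apply: funext => i; rewrite mulr1 addrC subrK. Qed.

Lemma line_eval0 p : (peval line_base line p).[0] = peval io t p.
Proof. by rewrite line_eval; congr (peval _ _ _); apply: funext => i; rewrite mulr0 addr0. Qed.

Lemma line_near (R : realType) (v : L -> R) z r i : is_abs v -> ext_mult v z -> z 'X <= r ->
  z (line i - (t i)%:P) <= v (u i - t i) * r.
Proof.
move=> hv [h1 h2 h3] zX; rewrite /line addrC addKr h2 h3.
by rewrite ler_wpM2l // (abs_ge0 hv).
Qed.

(** The disc of parameters of radius r / d stays in the polydisc of radius r around t, so the
    one-variable estimate applies with r / d in place of r. *)
Lemma peval_lipschitz (R : realType) (v : L -> R) (r B d : R) p q : is_abs v ->
  0 < d -> 4 * d <= r -> 0 <= B -> (forall i, v (u i - t i) <= d) ->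
  (forall z, ext_mult v z -> (forall i, z (line i - (t i)%:P) <= r) ->
     z (peval line_base line q) <> 0 /\
     z (peval line_base line p) <= B * z (peval line_base line q)) ->
  v (peval io u p / peval io u q - peval io t p / peval io t q) <= 4 * B / r * d.
Proof.
move=> hv d0 dr B0 hu hz.
have r0 : 0 < r by apply: lt_le_trans dr; rewrite mulr_gt0.
have -> : 4 * B / r * d = 4 * B / (r / d) by field; rewrite !gt_eqF.
rewrite -!line_eval1 -!line_eval0; apply: rational_lipschitz => //.
  by rewrite ler_pdivlMr.
move=> z ez zX; apply: hz => // i; apply: (le_trans (line_near i hv ez zX)).
apply: (@le_trans _ _ (d * (r / d))); last by rewrite mulrC divfK // gt_eqF.
by rewrite ler_pM2r ?hu // divr_gt0.
Qed.
End Line.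

Lemma abs_near2 (R : realType) (L : fieldType) (v : L -> R) (a b c d : L) (e m : R) :
  is_abs v -> v (a - c) <= e -> v (b - d) <= e -> v (c - d) <= m -> v (a - b) <= 2 * e + m.
Proof.
move=> hv h1 h2 h3; have := abs_triang hv a c b; have := abs_triang hv c d b.
by rewrite (absB hv d); lra.
Qed.

Section Evaluation.
Variables (R : realType) (A : comNzRingType) (nA : A -> R) (n : nat).
Local Notation E := (aff_alg nA n).
Local Notation P := (poly_ring A n).
Implicit Types (x y : bpt E).

Let hmult y : is_mult (@habs R E y). Proof. exact: (absM (habs_abs y)). Qed.

(** The affine point with coordinates u in H(y); its residue field embeds isometrically in H(y)
    through [pt_ext]. *)
Definition pt y (u : 'I_n -> HF y) : bpt E :=
  @point_of R A nA n (HF y) (@habs R E y) (@hbase R A nA n y) u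
    (abs_rsn (habs_abs y)) (hmult (y := y)) (hbase_le y).

Lemma sn_pt y u p : sn (pt (y := y) u) p = habs (peval (@hbase R A nA n y) u p).
Proof. by []. Qed.

Lemma pt_hcoord y : pt (hcoord y) = y.
Proof. by apply: bpt_eq => p; rewrite sn_pt -pv_peval habs_pv. Qed.

Definition pt_ext y u : {rmorphism HF (pt (y := y) u) -> HF y} :=
  projT1 (cid (@exists_extension R E (pt u) (HF y) (@habs R E y) (peval (@hbase R A nA n y) u)
    (habs_abs y) (@habs_complete R E y) (fun p => erefl))).

Lemma pt_ext_iso y u h : habs (pt_ext (y := y) u h) = habs h.
Proof. by rewrite /pt_ext; case: cid => F []. Qed.

Lemma pt_ext_hv y u p q : sn (pt (y := y) u) q <> 0 -> pt_ext u (hv (pt u) p q) =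
  peval (@hbase R A nA n y) u p / peval (@hbase R A nA n y) u q.
Proof. by rewrite /pt_ext; case: cid => F [_ h] /=; exact: h. Qed.

(** Substitution of u in g. Values at different tuples all lie in H(y) and can be subtracted. *)
Definition geval (g : fun_ring E) y u : HF y := pt_ext (y := y) u (fval g (pt u)).

Lemma geval_approx g y u p q e : sn (pt (y := y) u) q <> 0 ->
  habs (fval g (pt u) - hv (pt u) p q) <= e ->
  habs (geval g u - peval (@hbase R A nA n y) u p / peval (@hbase R A nA n y) u q) <= e.
Proof.
move=> q0 h; have E1 := pt_ext_hv p q0; have E2 := rmorphB (pt_ext u) (fval g (pt u)) (hv (pt u) p q).
by rewrite -E1 /geval -E2 pt_ext_iso.
Qed.

(** The two sides come from fields at points that are equal but not convertible, so they are
    compared through common approximants instead of by rewriting. *)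
Lemma geval_hcoord V g y : reg_on V g -> V y -> geval g (hcoord y) = fval g y.
Proof.
move=> hg Vy; apply: (small_eq (habs_abs y)) => e e0.
have [p [q hpq]] := hg (e / 3) (divr_gt0 e0 (ltr0n _ 3)).
have [q0 h1] := hpq y Vy.
have [q0' h2] : sn (pt (hcoord y)) q <> 0 /\
    habs (fval g (pt (hcoord y)) - hv (pt (hcoord y)) p q) <= e / 3.
  by apply: hpq; rewrite pt_hcoord.
have h3 := geval_approx q0' h2.
rewrite -!pv_peval -(hvE p q0) in h3.
have e3 := thirds_lt e0.
apply: (le_lt_trans (abs_triang (habs_abs y) _ (hv y p q) _)); apply: le_lt_trans e3.
rewrite (absB (habs_abs y)) in h1; exact: (lerD h3 h1).
Qed.

(** Corresponding tuples define the same point, by isometry; fractions of polynomials correspond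
    there, and their limits do because r is closed. *)
Lemma geval_corr V g y y' (r : HF y -> HF y' -> Prop) : reg_on V g ->
  isom_corr (@habs R E y) (@habs R E y') r ->
  (forall a, r (hbase y a) (hbase y' a)) ->
  forall u u', (forall i, r (u i) (u' i)) -> V (pt u) -> r (geval g u) (geval g u').
Proof.
move=> hg hr rb u u' ruu Vu.
have rp := peval_corr hr rb ruu.
have Vu' : V (pt u').
  suff <- : pt u = pt u' by [].
  by apply: bpt_eq => p; rewrite !sn_pt; exact: (ic_iso hr (rp p)).
apply: (ic_lim hr) => e e0; have [p [q hpq]] := hg (e / 2) (divr_gt0 e0 (ltr0n _ 2)).
have [q0 h1] := hpq _ Vu; have [q0' h2] := hpq _ Vu'.
have e2 := half_lt e0.
exists (peval (@hbase R A nA n y) u p / peval (@hbase R A nA n y) u q),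
  (peval (@hbase R A nA n y') u' p / peval (@hbase R A nA n y') u' q); split.
- exact: (ic_M hr (rp p) (ic_V hr (rp q))).
- exact: le_lt_trans (geval_approx q0 h1) e2.
- exact: le_lt_trans (geval_approx q0' h2) e2.
Qed.

(** An approximant p / q within e of g on V has no pole and is bounded by B + e on all of V, in
    particular at the seminorms on H(y)[X] along a line; the estimate for p / q passes to g as e
    tends to 0. *)
Lemma regular_lipschitz x g : reg_near x g -> exists V W r B,
  [/\ nbhs x W, 0 < r, 0 < B, reg_on V g & forall y, W y ->
   [/\ V y, habs (fval g y) <= B, (forall u, (forall i, habs (u i - hcoord y i) <= r) -> V (pt u)) &
   forall u d, 0 <= d -> (forall i, habs (u i - hcoord y i) <= d) -> 4 * d <= r ->
     habs (geval g u - geval g (hcoord y)) <= 4 * B / r * d]].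
Proof.
move=> /reg_near_bounded[V [B [nV B0 hV bV]]].
have [W [r [nW r0 hW]]] := polydisc_in_nbhs nV.
exists V, (V `&` W), r, B; split=> //; first exact: filterI.
move=> y [Vy Wy]; have ha := habs_abs y.
have inV (u : 'I_n -> HF y) : (forall i, habs (u i - hcoord y i) <= r) -> V (pt u).
  by move=> hu; apply: (hW y Wy (HF y) (@habs R E y) idfun).
split=> //; first exact: bV.
move=> u d; rewrite le_eqVlt => /predU1P[<-|d0] hu dr.
  have -> : u = hcoord y.
    apply: funext => i; apply: (small_eq ha) => e e0.
    exact: le_lt_trans (hu i) e0.
  by rewrite subrr (abs0 ha) mulr0.
have lim e : 0 < e -> habs (geval g u - geval g (hcoord y)) <= 2 * e + 4 * (B + e) / r * d.
  move=> e0; have [p [q hpq]] := hV e e0.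
  have dr' := le_of_quarter d0 dr.
  have hu' i : habs (u i - hcoord y i) <= r := le_trans (hu i) dr'.
  have [q0 h1] := hpq _ (inV u hu').
  have ht i : habs (hcoord y i - hcoord y i) <= r by rewrite subrr (abs0 ha) ltW.
  have [q1 h2] := hpq _ (inV (hcoord y) ht).
  have Be : 0 <= B + e by rewrite addr_ge0 // ltW.
  apply: (abs_near2 ha (geval_approx q0 h1) (geval_approx q1 h2)).
  apply: (peval_lipschitz ha d0 dr Be hu) => z hz hw.
  have [z1 z2 z3] := hz.
  have bd a : z (line_base (@hbase R A nA n y) a) <= nA a.
    by rewrite -[line_base _ a]/((hbase y a)%:P) z3; exact: (hbase_le y).
  have Vw := hW y Wy _ z (@polyC (HF y)) _ z1 z2 bd z3 (fun a => erefl) _ hw.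
  have [nq h3] := hpq _ Vw; split=> //.
  have hp := habs_abs (point_of (line u (hcoord y)) z1 z2 bd).
  set x' := point_of _ _ _ _ in Vw nq h3 hp *.
  have h4 : habs (hv x' p q) <= B + e.
    apply: (le_trans (abs_le_near hp _ (fval g x'))).
    by rewrite (absB hp); exact: (lerD (bV _ Vw) h3).
  rewrite habs_hv // ler_pdivrMr // in h4.
  by rewrite lt_neqAle sn_ge0 andbT eq_sym; apply/eqP.
apply/ler_addgt0Pr => e e0.
(* The total coefficient of e in [lim]. *)
pose c := 2 + 4 / r * d.
have c0 : 0 < c by rewrite ltr_pwDl // mulr_ge0 ?divr_ge0 // ltW.
have := lim (e / c) (divr_gt0 e0 c0).
have -> : 2 * (e / c) + 4 * (B + e / c) / r * d = 4 * B / r * d + e / c * c by rewrite /c; ring.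
by rewrite divfK // gt_eqF.
Qed.
End Evaluation.

(** A step consists of field operations and evaluations, all of which respect the correspondence.
    The set [D] is where the evaluations are known to do so; it only constrains the first orbit. *)
Lemma ic_iterates (R : realType) (k L L' : fieldType) (v : L -> R) (v' : L' -> R)
    (r : L -> L' -> Prop) (io : {rmorphism k -> L}) (io' : {rmorphism k -> L'}) N J
    (M : {poly k}) (P : 'I_N -> {poly k}) (a : 'I_J -> k) f0 f f0' f' al al'
    (D : ('I_N -> L) -> Prop) :
  isom_corr v v' r -> (forall c, r (io c) (io' c)) -> r al al' ->
  (forall j u u', D u -> (forall l, r (u l) (u' l)) -> r (f0 j u) (f0' j u')) ->
  (forall i j u u', D u -> (forall l, r (u l) (u' l)) -> r (f i j u) (f' i j u')) ->
  let st := newton_step (map_poly io M) (fun i : 'I_N => map_poly io (P i))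
              (fun j : 'I_J => io (a j)) f0 f (map_poly io M)^`().[al] in
  let st' := newton_step (map_poly io' M) (fun i : 'I_N => map_poly io' (P i))
              (fun j : 'I_J => io' (a j)) f0' f' (map_poly io' M)^`().[al'] in
  let s m := iter m st (al, fun i => (map_poly io (P i)).[al]) in
  let s' m := iter m st' (al', fun i => (map_poly io' (P i)).[al']) in
  (forall m, D (s m).2) ->
  forall m, r (s m).1 (s' m).1 /\ forall i, r ((s m).2 i) ((s' m).2 i).
Proof.
move=> hr rb ra h0 hf st st' s s' hD.
have r0 : r 0 0 by exact: (ic_0 hr ra).
elim=> [|m [IH1 IH2]].
  by split=> //= i; apply: (ic_horner hr rb).
have sum g g' : (forall j, r (g j) (g' j)) ->
    r (\sum_j io (a j) * g j) (\sum_j io' (a j) * g' j).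
  by move=> hg; apply: (ic_sum hr) => // j; apply: (ic_M hr).
have -> : s m.+1 = st (s m) by []. have -> : s' m.+1 = st' (s' m) by [].
split=> [|i] /=.
  apply: (ic_D hr) => //; apply: (ic_N hr); apply: (ic_M hr).
    by apply: (ic_V hr); rewrite !deriv_map; apply: (ic_horner hr rb).
  apply: (ic_D hr); first exact: (ic_horner hr rb).
  by apply: (ic_N hr); apply: sum => j; exact: h0.
apply: (ic_D hr); first exact: (ic_horner hr rb).
by apply: sum => j; exact: hf.
Qed.

Lemma ic_cvg (R : realType) (L L' : fieldType) (v : L -> R) (v' : L' -> R)
    (r : L -> L' -> Prop) (s : nat -> L) (s' : nat -> L') l l' :
  is_abs v -> is_abs v' -> isom_corr v v' r -> (forall m, r (s m) (s' m)) -> abs_cvg v s l -> abs_cvg v' s' l' ->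
  r l l'.
Proof.
move=> hv hv' hr h hs hs'; apply: (ic_lim hr) => e e0.
have [n1 h1] := hs _ e0; have [n2 h2] := hs' _ e0.
exists (s (maxn n1 n2)), (s' (maxn n1 n2)); split=> //.
  by rewrite (absB hv); apply: h1; exact: leq_maxl.
by rewrite (absB hv'); apply: h2; exact: leq_maxr.
Qed.

Lemma eval_prime_ideal (k L : fieldType) (io : {rmorphism k -> L}) al :
  prime_poly_ideal [set g : {poly k} | (map_poly io g).[al] = 0].
Proof.
split=> /=.
- by rewrite rmorph1 hornerC => /eqP; rewrite oner_eq0.
- by move=> f g hf hg; rewrite rmorphD hornerD hf hg addr0.
- by move=> f g hf; rewrite rmorphM hornerM hf mulr0.
- by move=> f g /eqP; rewrite rmorphM hornerM mulf_eq0 => /orP[/eqP|/eqP]; [left|right].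
Qed.

Lemma finite_set_inj_on (T U : Type) (Y : set T) (F : T -> U) (I : set U) :
  finite_set I -> (forall y, Y y -> I (F y)) ->
  (forall y y', Y y -> Y y' -> F y = F y' -> y = y') -> finite_set Y.
Proof.
move=> fI YI inj; case: (pselect (exists y, Y y)) => [[y0 _]|ne]; last first.
  by rewrite (_ : Y = set0) //; apply/seteqP; split=> // y Yy; apply: ne; exists y.
have /choice[G hG] u : exists y, (exists2 y', Y y' & F y' = u) -> Y y /\ F y = u.
  case: (pselect (exists2 y', Y y' & F y' = u)) => [[y h1 h2]|h]; last by exists y0.
  by exists y.
apply: (@sub_finite_set _ _ (G @` I)); last exact: finite_image.
move=> y Yy; exists (F y); first exact: YI.
have [|h1 h2] := hG (F y); first by exists y.
exact: inj.
Qed.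

Section Family.
Variables (R : realType) (A : comNzRingType) (nA : A -> R) (n : nat).
Local Notation E := (aff_alg nA n).

(** The input of [newton_system] in monotone form, so that finitely many functions can share W, sg,
    B and Lam. *)
Definition good_data (g : fun_ring E) (W : set (bpt E)) (sg B Lam : R) :=
  exists V, reg_on V g /\ forall y, W y ->
  [/\ V y, habs (fval g y) <= B, (forall u, (forall i, habs (u i - hcoord y i) <= sg) -> V (pt u)) &
   forall u d, 0 <= d -> d <= sg -> (forall i, habs (u i - hcoord y i) <= d) ->
     habs (geval g u - geval g (hcoord y)) <= Lam * d].

Lemma good_data_mono g W sg B Lam W' sg' B' Lam' : good_data g W sg B Lam ->
  W' `<=` W -> sg' <= sg -> B <= B' -> Lam <= Lam' -> good_data g W' sg' B' Lam'.
Proof.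
move=> [V [hV h]] WW ss BB LL; exists V; split=> // y /WW Wy.
have [h1 h2 h3 h4] := h y Wy; split=> //; first exact: le_trans BB.
  by move=> u hu; apply: h3 => i; exact: le_trans (hu i) ss.
move=> u d d0 ds hu; apply: (le_trans (h4 u d d0 (le_trans ds ss) hu)).
by rewrite ler_wpM2r.
Qed.

Lemma good_family (T : finType) (F : T -> fun_ring E) x : (forall t, reg_near x (F t)) ->
  exists W sg B Lam, [/\ nbhs x W, 0 < sg, 0 <= B, 0 <= Lam &
    forall t, good_data (F t) W sg B Lam].
Proof.
move=> hF; suff h (s : seq T) : exists W sg B Lam, [/\ nbhs x W, 0 < sg, 0 <= B, 0 <= Lam &
    forall t, t \in s -> good_data (F t) W sg B Lam].
  have [W [sg [B [Lam [h1 h2 h3 h4 h5]]]]] := h (enum T).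
  by exists W, sg, B, Lam; split=> // t; apply: h5; rewrite mem_enum.
elim: s => [|t s [W [sg [B [Lam [h1 h2 h3 h4 h5]]]]]].
  by exists setT, 1, 0, 0; split=> //; exact: filterT.
have [V [W' [r [B' [nW r0 B'0 hV hW]]]]] := regular_lipschitz (hF t).
have r4 : 0 < r / 4 by rewrite divr_gt0.
have L0 : 0 <= 4 * B' / r by rewrite divr_ge0 ?mulr_ge0 // ltW.
have gt : good_data (F t) W' (r / 4) B' (4 * B' / r).
  exists V; split=> // y Wy; have [k1 k2 k3 k4] := hW y Wy; split=> //.
    move=> u hu; apply: k3 => i; apply: (le_trans (hu i)).
    by rewrite ler_pdivrMr // ler_peMr ?ler1n // ltW.
  by move=> u d d0 dr hu; apply: k4 => //; rewrite mulrC -ler_pdivlMr.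
exists (W `&` W'), (Num.min sg (r / 4)), (B + B'), (Lam + 4 * B' / r); split.
- exact: filterI.
- by rewrite lt_min h2.
- by rewrite addr_ge0 // ltW.
- by rewrite addr_ge0.
- move=> t'; rewrite inE => /predU1P[->|/h5 gt'].
    apply: (good_data_mono gt); first by move=> y [].
    + by rewrite ge_min lexx orbT.
    + by rewrite lerDr.
    + by rewrite lerDr.
  apply: (good_data_mono gt'); first by move=> y [].
  + by rewrite ge_min lexx.
  + by rewrite lerDl ltW.
  + by rewrite lerDl.
Qed.
End Family.

Lemma habs_peval (R : realType) (A : comNzRingType) (nA : A -> R) (n : nat)
    (y : bpt (aff_alg nA n)) p : habs (peval (@hbase R A nA n y) (hcoord y) p) = sn y p.
Proof. by rewrite -pv_peval habs_pv. Qed.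

Section FiniteSolutions.
Variables (R : realType) (A : comNzRingType) (nA : A -> R) (N J : nat).
Local Notation E := (aff_alg nA N).

(** [th] lifts a primitive element of [kappa(x)], [M] its minimal polynomial,
    and the [P i] the expressions of the coordinates in it. *)
Definition is_solution (th : fun_ring E) (f0 : 'I_J -> fun_ring E)
    (f : 'I_N -> 'I_J -> fun_ring E) (k : fieldType) (vk : k -> R) (base : A -> k)
    (M : {poly k}) (P : 'I_N -> {poly k}) (a : 'I_J -> k) (dlt : R) (y : bpt E)
    (io : {rmorphism k -> HF y}) :=
  [/\ forall c, habs (io c) = vk c, forall b, io (base b) = hbase y b,
      dlt <= habs (map_poly io M)^`().[fval th y],
      (map_poly io M).[fval th y] = \sum_j io (a j) * fval (f0 j) y &
      forall i, hcoord y i = (map_poly io (P i)).[fval th y] + \sum_j io (a j) * fval (f i j) y].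

(** Two solutions for the same parameters whose roots [al] of [M] satisfy the same
    polynomials over [k] are limits of the same iteration, and hence define the
    same seminorm; there are finitely many primes of [k[X]] above [M]. *)
Lemma finite_solutions (th : fun_ring E) f0 f x (C dlt : R) (n : nat) : 0 <= C -> 0 < dlt ->
  reg_near x th -> (forall j, reg_near x (f0 j)) -> (forall i j, reg_near x (f i j)) ->
  exists W eps, [/\ nbhs x W, 0 < eps &
    forall (k : fieldType) (vk : k -> R) (base : A -> k) (M : {poly k})
      (P : 'I_N -> {poly k}) (a : 'I_J -> k),
    is_abs vk -> abs_complete vk -> M != 0 -> (size M <= n)%N -> (forall m, vk M`_m <= C) ->
    (forall i, (size (P i) <= n)%N /\ forall m, vk (P i)`_m <= C) ->
    \sum_j vk (a j) <= eps ->
    finite_set [set y | W y /\ exists io, @is_solution th f0 f k vk base M P a dlt y io]].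
Proof.
move=> C0 dlt0 hth hf0 hf.
(* One finite index type for th, the f_0j and the f_ij gives constants common to all of them. *)
pose F (t : unit + ('I_J + 'I_N * 'I_J)) : fun_ring E :=
  match t with inl _ => th | inr (inl j) => f0 j | inr (inr (i, j)) => f i j end.
have [|W [sg [B [Lam [nW sg0 B0 L0 hW]]]]] := @good_family R A nA N _ F x.
  by case=> [u|[j|[i j]]]; [exact: hth|exact: hf0|exact: hf].
have [eps eps0 heps] := @newton_system R C B dlt Lam B sg n C0 B0 dlt0 L0 B0 sg0.
exists W, eps; split=> // k vk base M P a hvk ck M0 sM hM hP ha.
set Y := [set y | _].
have sol y : Y y -> exists (I : set {poly k}) (io : {rmorphism k -> HF y}) (al : HF y),
  [/\ I = [set g : {poly k} | (map_poly io g).[al] = 0], @is_solution th f0 f k vk base M P a dlt y io, (map_poly io M).[al] = 0 &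
    let s m := iter m (newton_step (map_poly io M) (fun i => map_poly io (P i))
        (fun j => io (a j)) (fun j u => geval (f0 j) u) (fun i j u => geval (f i j) u)
        (map_poly io M)^`().[al]) (al, fun i => (map_poly io (P i)).[al]) in
    (forall m i, habs ((s m).2 i - hcoord y i) <= sg) /\
    (forall i, abs_cvg (@habs R E y) (fun m => (s m).2 i) (hcoord y i))].
  move=> [Wy [io hio]].
  have [iso hb hd e0 eT] := hio.
  have gv g : good_data g W sg B Lam -> geval g (hcoord y) = fval g y.
    by move=> [V [hV h]]; have [Vy _ _ _] := h y Wy; exact: (geval_hcoord hV Vy).
  have bg g : good_data g W sg B Lam -> habs (geval g (hcoord y)) <= B.
    by move=> gd; rewrite gv //; case: gd => V [_ h]; case: (h y Wy).
  have lg g : good_data g W sg B Lam -> forall u d, 0 <= d -> d <= sg ->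
      (forall i, habs (u i - hcoord y i) <= d) -> habs (geval g u - geval g (hcoord y)) <= Lam * d.
    by case=> V [_ h]; case: (h y Wy).
  have [||||||||||||al [h1 h2]] := heps (HF y) (@habs R E y) N J (map_poly io M) (fun i => map_poly io (P i))
    (fun j => io (a j)) (fun j u => geval (f0 j) u) (fun i j u => geval (f i j) u) (fval th y) (hcoord y)
    (habs_abs y) (@habs_complete R E y).
  - by rewrite size_map_poly.
  - by move=> m; rewrite coef_map iso.
  - by move=> i; rewrite size_map_poly; split; [exact: (hP i).1|move=> m; rewrite coef_map iso; exact: (hP i).2].
  - by have [V [_ h]] := hW (inl tt); case: (h y Wy).
  - exact: hd.
  - by move=> j; exact: (bg _ (hW (inr (inl j)))).
  - by move=> i j; exact: (bg _ (hW (inr (inr (i, j))))).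
  - by move=> j u e k1 k2 k3; exact: (lg _ (hW (inr (inl j))) u e k1 k2 k3).
  - by move=> i j u e k1 k2 k3; exact: (lg _ (hW (inr (inr (i, j)))) u e k1 k2 k3).
  - rewrite e0; apply: eq_bigr => j _; congr (_ * _).
    exact: (esym (gv _ (hW (inr (inl j))))).
  - move=> i; rewrite [LHS]eT; congr (_ + _); apply: eq_bigr => j _; congr (_ * _).
    exact: (esym (gv _ (hW (inr (inr (i, j)))))).
  - by under eq_bigr do rewrite iso.
  by exists [set g : {poly k} | (map_poly io g).[al] = 0], io, al.
have /choice[I hI] y : exists I : set {poly k}, Y y -> exists (io : {rmorphism k -> HF y}) (al : HF y),
  [/\ I = [set g : {poly k} | (map_poly io g).[al] = 0],
      @is_solution th f0 f k vk base M P a dlt y io, (map_poly io M).[al] = 0 &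
    let s m := iter m (newton_step (map_poly io M) (fun i => map_poly io (P i))
        (fun j => io (a j)) (fun j u => geval (f0 j) u) (fun i j u => geval (f i j) u)
        (map_poly io M)^`().[al]) (al, fun i => (map_poly io (P i)).[al]) in
    (forall m i, habs ((s m).2 i - hcoord y i) <= sg) /\
    (forall i, abs_cvg (@habs R E y) (fun m => (s m).2 i) (hcoord y i))].
  case: (pselect (Y y)) => [/sol[I hI]|nY]; first by exists I.
  by exists set0.
apply: (@finite_set_inj_on _ _ Y I _ (finite_primes_over M0)).
  move=> y /hI[io [al [-> _ h2 _]]]; split; [exact: eval_prime_ideal|exact: h2].
move=> y y' Yy Yy'.
have [io [al [-> s1 s2 s3]]] := hI y Yy.
have [io' [al' [-> s1' s2' s3']]] := hI y' Yy'.
move=> eI.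
(* Equality of the two primes is exactly the kernel condition of [exists_corr]. *)
have ker g : (map_poly io g).[al] = 0 <-> (map_poly io' g).[al'] = 0.
  have e : ((map_poly io g).[al] = 0) = ((map_poly io' g).[al'] = 0).
    exact: (congr1 (fun S : set {poly k} => S g) eI).
  by split=> h; [exact: (eq_ind _ id h _ e)|exact: (eq_ind _ id h _ (esym e))].
have [iso hb _ _ _] := s1; have [iso' hb' _ _ _] := s1'.
have [r [hr rb ra]] := @exists_corr R k (HF y) (HF y') vk (@habs R E y) (@habs R E y') io io' al al'
  hvk (habs_abs y) (habs_abs y') ck iso iso' ker M M0 s2.
have rb' b : r (hbase y b) (hbase y' b) by rewrite -hb -hb'; exact: rb.
pose D (u : 'I_N -> HF y) := forall i, habs (u i - hcoord y i) <= sg.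
have gr g : good_data g W sg B Lam -> forall (u : 'I_N -> HF y) (u' : 'I_N -> HF y'), D u ->
    (forall l, r (u l) (u' l)) -> r (geval g u) (geval g u').
  move=> [V [hV hg]] u u' Du ruu; have [_ _ h3 _] := hg y Yy.1.
  exact: (geval_corr hV hr rb' ruu (h3 u Du)).
(* Both orbits start at corresponding values and converge to the coordinates of y and y', which
   therefore correspond; polynomials in them have equal absolute values. *)
have it := ic_iterates hr rb ra (fun j => gr _ (hW (inr (inl j)))) (fun i j => gr _ (hW (inr (inr (i, j))))) s3.1.
apply: bpt_eq => p.
have rc i : r (hcoord y i) (hcoord y' i).
  exact: (ic_cvg (habs_abs y) (habs_abs y') hr (fun m => (it m).2 i) (s3.2 i) (s3'.2 i)).
have e := ic_iso hr (peval_corr hr rb' rc p).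
exact: (etrans (esym (habs_peval y p)) (etrans e (habs_peval y' p))).
Qed.
End FiniteSolutions.

(** * Equations of an unramified point *)

Section QuotientMorphism.
Variables (R : comPzRingType) (I : set R).
Fact qpi_monoid : GRing.monoid_morphism (qpi I).
Proof. by split=> [|a b]; [exact: qpi1|exact: qpiM]. Qed.
HB.instance Definition _ := GRing.isZmodMorphism.Build R (quot I) (qpi I) (@qpiB R I).
HB.instance Definition _ := GRing.isMonoidMorphism.Build R (quot I) (qpi I) qpi_monoid.
End QuotientMorphism.

Section CommonGenerators.
Variables (L L' : comPzRingType) (ms : {rmorphism L -> L'}) (I : set L).

Definition comb n (a : 'I_n -> L) : set L' :=
  [set z | exists f : 'I_n -> L', z = \sum_j ms (a j) * f j].

Definition fcat T m n (a : 'I_m -> T) (b : 'I_n -> T) (k : 'I_(m + n)) : T :=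
  match fintype.split k with inl i => a i | inr j => b j end.

Lemma fcat_lshift T m n (a : 'I_m -> T) (b : 'I_n -> T) i : fcat a b (lshift n i) = a i.
Proof. by rewrite /fcat (unsplitK (inl i)). Qed.
Lemma fcat_rshift T m n (a : 'I_m -> T) (b : 'I_n -> T) i : fcat a b (rshift m i) = b i.
Proof. by rewrite /fcat (unsplitK (inr i)). Qed.

Lemma comb_fcat m n (a : 'I_m -> L) (b : 'I_n -> L) z z' : comb a z -> comb b z' ->
  comb (fcat a b) (z + z').
Proof.
move=> [f ->] [g ->]; exists (fcat f g); rewrite big_split_ord /=.
by congr (_ + _); apply: eq_bigr => i _; rewrite ?fcat_lshift ?fcat_rshift.
Qed.

Lemma fcat_in m n (a : 'I_m -> L) (b : 'I_n -> L) : (forall j, I (a j)) ->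
  (forall j, I (b j)) -> forall j, I (fcat a b j).
Proof. by move=> ha hb j; rewrite /fcat; case: fintype.split. Qed.

Lemma comb0 n (a : 'I_n -> L) : comb a 0.
Proof. by exists (fun=> 0); rewrite big1 // => j _; rewrite mulr0. Qed.

Lemma ideal_gen_comb z : ideal_gen (ms @` I) z ->
  exists n (a : 'I_n -> L), (forall j, I (a j)) /\ comb a z.
Proof.
pose Z := [set z | exists n (a : 'I_n -> L), (forall j, I (a j)) /\ comb a z].
move=> h; apply: (h Z); split; first split.
- by exists 0, (fun=> 0); split; [case|exact: comb0].
- move=> u v [m [a [ha ca]]] [n [b [hb cb]]].
  by exists (m + n)%N, (fcat a b); split; [exact: fcat_in|exact: comb_fcat].
- move=> r u [m [a [ha [g ->]]]]; exists m, a; split=> //; exists (fun j => r * g j).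
  by rewrite mulr_sumr; apply: eq_bigr => j _; rewrite mulrCA.
move=> _ [a Ia <-]; exists 1%N, (fun=> a); split=> //.
by exists (fun=> 1); rewrite big_ord_recl big_ord0 addr0 mulr1.
Qed.

(** Concatenating tuples makes finitely many elements combinations of the same a_j, so that a single
    smallness condition on the a_j controls all equations. *)
Lemma common_generators (zs : seq L') : (forall z, z \in zs -> ideal_gen (ms @` I) z) ->
  exists n (a : 'I_n -> L), (forall j, I (a j)) /\ forall z, z \in zs -> comb a z.
Proof.
elim: zs => [|z zs IH] h.
  by exists 0, (fun=> 0); split; [case|].
have [m [a [ha ca]]] := ideal_gen_comb (h z (mem_head _ _)).
have [|n [b [hb cb]]] := IH; first by move=> w hw; apply: h; rewrite inE hw orbT.
exists (m + n)%N, (fcat a b); split; first exact: fcat_in.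
move=> w; rewrite inE => /orP[/eqP ->|/cb cw].
  by rewrite -[z]addr0; apply: comb_fcat => //; exact: comb0.
by rewrite -[w]add0r; apply: comb_fcat => //; exact: comb0.
Qed.
End CommonGenerators.

Section Unramified.
Variables (Ls Lx : comPzRingType) (ms : {rmorphism Ls -> Lx}).
Variables (k : fieldType) (K : fieldExtType k).
Variables (i : {rmorphism quot (maxid Ls) -> k}) (j : {rmorphism quot (maxid Lx) -> K}).
Hypotheses (locX : is_local Lx) (bi : bijective i) (bj : bijective j).
Hypothesis ij : forall a, j (qpi _ (ms a)) = (i (qpi _ a))%:A.
Hypothesis sep : separable 1 {:K}.
Hypothesis hmax : maxid Lx = ideal_gen (ms @` maxid Ls).

Let lift_k (c : k) : exists b : Ls, i (qpi _ b) = c.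
Proof. by case: bi => g _ gK; exists (qrep (g c)); rewrite qrepK. Qed.

Let j_eq0 z : j (qpi _ z) = 0 -> ideal_gen (ms @` maxid Ls) z.
Proof.
move=> h; have /qpiP_eq : qpi (maxid Lx) z = qpi (maxid Lx) 0.
  by apply: (bij_inj bj); rewrite h qpi0 rmorph0.
by rewrite subr0 (ideal_gen_id locX) hmax.
Qed.

Let horner_lift (p : {poly k}) (b : nat -> Ls) (Th : Lx) n :
  (forall m, i (qpi _ (b m)) = p`_m) -> (size p <= n)%N ->
  j (qpi _ (\sum_(m < n) ms (b m) * Th ^+ m)) = (map_poly (in_alg K) p).[j (qpi _ Th)].
Proof.
move=> hb hp; rewrite !rmorph_sum.
rewrite (@horner_coef_wide _ n); last exact: leq_trans (size_poly _ _) hp.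
apply: eq_bigr => m _; rewrite !rmorphM !rmorphXn.
by rewrite (ij (b m)) hb coef_map.
Qed.

(** Relations in kappa(x) between a separable generator and the coordinates are lifted
    coefficientwise to O_s. Their defects vanish in kappa(x), so they lie in m_x = m_s O_x.
    Separability makes the derivative nonzero in kappa(x), hence a unit in O_x. *)
Lemma unramified_equations N (T : 'I_N -> Lx) : exists n J (b : nat -> Ls)
    (p : 'I_N -> nat -> Ls) (Th : Lx) (a : 'I_J -> Ls) (f0 : 'I_J -> Lx) (f : 'I_N -> 'I_J -> Lx),
  [/\ forall l, maxid Ls (a l),
      \sum_(m < n) ms (b m) * Th ^+ m = \sum_l ms (a l) * f0 l,
      forall t, T t = \sum_(m < n) ms (p t m) * Th ^+ m + \sum_l ms (a l) * f t l &
      exists u, (\sum_(m < n) (ms (b m) * Th ^+ m.-1) *+ m) * u = 1].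
Proof.
pose th : K := separable_generator 1 {:K}.
have gen : (<<1; th>> = {:K})%VS := esym (eq_adjoin_separable_generator sep (sub1v _)).
have [M hM] : exists M : {poly k}, minPoly 1 th = map_poly (in_alg K) M.
  by apply/polyOver1P; exact: minPolyOver.
have gen_poly (c : K) : exists q : {poly k}, c = (map_poly (in_alg K) q).[th].
  have /Fadjoin_poly_eq <- : c \in <<1; th>>%VS by rewrite gen memvf.
  have /polyOver1P[q hq] : Fadjoin_poly 1 th c \is a polyOver 1%VS by exact: Fadjoin_polyOver.
  by exists q; rewrite hq.
have [Th hTh] : exists Th : Lx, j (qpi _ Th) = th.
  by case: bj => g _ gK; exists (qrep (g th)); rewrite qrepK.
have /choice[b hb] m : exists b : Ls, i (qpi _ b) = M`_m by exact: lift_k.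
have /choice[q hq] t : exists q : {poly k}, j (qpi _ (T t)) = (map_poly (in_alg K) q).[th].
  exact: gen_poly.
have /choice[p hp] t : exists p : nat -> Ls, forall m, i (qpi _ (p m)) = (q t)`_m.
  have [p hp] := choice (fun m : nat => lift_k (q t)`_m); by exists p.
(* A common length for all polynomials; missing coefficients are lifts of 0. *)
pose n := maxn (size M) (\max_(t < N) size (q t)).
have nM : (size M <= n)%N by exact: leq_maxl.
have nq t : (size (q t) <= n)%N.
  apply: leq_trans (leq_maxr _ _); exact: (leq_bigmax t).
pose z0 := \sum_(m < n) ms (b m) * Th ^+ m.
pose z t := T t - \sum_(m < n) ms (p t m) * Th ^+ m.
have [|J [a [ha ca]]] := @common_generators _ _ ms (maxid Ls) (z0 :: [seq z t | t <- enum 'I_N]).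
  move=> w; rewrite inE => /orP[/eqP ->|/mapP[t _ ->]]; apply: j_eq0.
    rewrite (horner_lift Th hb nM) hTh -hM; exact/eqP/root_minPoly.
  rewrite /z rmorphB rmorphB (horner_lift Th (hp t) (nq t)) hTh hq; exact: subrr.
have [f0 hf0] := ca z0 (mem_head _ _).
have /choice[f hf] t : exists g : 'I_J -> Lx, z t = \sum_l ms (a l) * g l.
  by apply: ca; rewrite inE; apply/orP; right; apply: map_f; rewrite mem_enum.
exists n, J, b, p, Th, a, f0, f; split=> //.
  by move=> t; rewrite -hf /z addrC subrK.
set D := \sum_(m < n) _.
have jD : j (qpi _ D) = (map_poly (in_alg K) M)^`().[th].
  rewrite (@horner_coef_wide _ n.-1); last first.
    by apply: leq_trans (size_poly _ _) _; rewrite size_map_poly -!subn1; exact: leq_sub2r.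
  rewrite /D; case: (n) => [|n'] /=; first by rewrite !big_ord0 !rmorph0.
  rewrite big_ord_recl /= mulr0n add0r !rmorph_sum; apply: eq_bigr => m _ /=.
  rewrite !rmorphMn !rmorphM !rmorphXn /= (ij (b m.+1)) hb hTh.
  by rewrite coef_deriv coef_map mulrnAl.
have D0 : j (qpi _ D) != 0.
  have sth : separable_element 1 th by apply: (separableP sep); exact: memvf.
  by have := separable_root_der 1 th; rewrite sth jD -hM.
case: (pselect (exists u, D * u = 1)) => // nD; case/eqP: D0.
have /qpiP_eq -> : ideal_gen (maxid Lx) (D - 0) by rewrite subr0 (ideal_gen_id locX).
by rewrite qpi0 rmorph0.
Qed.
End Unramified.

(** * Properness of maps with finite fibres *)

Section LocalEmbedding.
Variables (X Y : topologicalType) (D : set X) (e : X -> Y).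

(** A homeomorphism from [D] onto a closed subset of an open set of [Y], phrased for a map on all of
    [X] whose values outside [D] are arbitrary. *)
Record local_embedding := LocalEmbedding {
  le_open : open D;
  le_inj : forall y y', D y -> D y' -> e y = e y' -> y = y';
  le_cont : forall y, D y -> e @ y --> e y;
  le_emb : forall y B, D y -> nbhs y B ->
    exists2 W, nbhs (e y) W & forall y', D y' -> W (e y') -> B y';
  le_closed : exists U, [/\ open U, e @` D `<=` U &
    forall v, U v -> ~ (e @` D) v -> nbhs v (~` (e @` D))] }.

Hypothesis H : local_embedding.
Hypothesis lcY : forall (v : Y) W, nbhs v W -> exists K, [/\ compact K, nbhs v K & K `<=` W].

Lemma le_nbhs y : D y -> nbhs y D.
Proof. by move=> Dy; apply: open_nbhs_nbhs; split=> //; exact: le_open H. Qed.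

Lemma le_compact_nbhs x B : D x -> nbhs x B -> exists K, [/\ compact K, nbhs x K & K `<=` B `&` D].
Proof.
move=> Dx nB; have [W nW hW] := le_emb H Dx nB.
have [U [oU sU cU]] := le_closed H.
have nU : nbhs (e x) U by apply: open_nbhs_nbhs; split=> //; apply: sU; exists x.
have [K0 [cK nK KO]] := lcY (filterI nW nU).
pose K := [set y | D y /\ K0 (e y)]; exists K; split; last 1 first.
- by move=> y [Dy /KO[Oy _]]; split=> //; exact: hW.
- move=> F PF FK.
  have [p [K0p hp]] : exists p, K0 p /\ cluster (e @ F) p.
    have eK : (e @ F) K0 by exact: (filterS (fun y (h : K y) => proj2 h) FK).
    by have [p [h1 h2]] := cK (e @ F) _ eK; exists p.
  have [y Dy ep] : (e @` D) p.
    apply: contrapT => np; have [_ Up] := KO _ K0p.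
    have h1 : (e @ F) (e @` D) by apply: (filterS (P := K)) => [y [Dy _]|]; [exists y|].
    by have [q [h2]] := hp _ _ h1 (cU p Up np).
  exists y; split; first by split; rewrite ?ep.
  move=> A B' FA nB'; have [Z' nZ' hZ'] := le_emb H Dy nB'.
  have h1 : F (e @^-1` (e @` (A `&` K))).
    by apply: (filterS (P := A `&` K)); [move=> z hz; exists z|exact: filterI].
  rewrite ep in nZ'; have [_ [[z [Az [Dz Kz]] <-] Oz]] := hp _ _ h1 nZ'.
  by exists z; split=> //; exact: hZ'.
- apply: filterS2 (le_nbhs Dx) (le_cont H Dx nK) => y Dy Ky; by split.
Qed.

(** X is not assumed Hausdorff, so compact sets need not be closed in it; separation is borrowed
    from Y and only available at points of D. *)
Lemma le_closed_image C t : hausdorff_space Y -> compact (e @` C) -> C `<=` D -> D t -> ~ C t ->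
  nbhs t (~` C).
Proof.
move=> hY cC CD Dt nC; have oC : open (~` (e @` C)) by apply: closed_openC; exact: compact_closed.
have nt : (~` (e @` C)) (e t).
  by move=> [y Cy ey]; apply: nC; rewrite -(le_inj H (CD _ Cy) Dt ey).
have h : nbhs t (e @^-1` (~` (e @` C))) by exact: (le_cont H Dt (open_nbhs_nbhs (conj oC nt))).
apply: filterS h => y ny Cy.
by apply: ny; exists y.
Qed.
End LocalEmbedding.

(** The properness of [f] near [x]: a compact neighbourhood [K] of [x] meeting
    the fibre only in [x] has its boundary mapped to a compact set avoiding [f x]. *)
Lemma finite_fibres_closed (X S Y Z : topologicalType) (f : X -> S) (D : set X) (e : X -> Y)
    (D' : set S) (e' : S -> Z) (x : X) (B : set X) :
  local_embedding D e -> local_embedding D' e' -> hausdorff_space Y -> hausdorff_space Z ->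
  (forall (v : Y) W, nbhs v W -> exists K, [/\ compact K, nbhs v K & K `<=` W]) ->
  continuous f -> D x -> D' (f x) -> nbhs x B ->
  (forall t, finite_set (B `&` f @^-1` [set t])) ->
  isolated (f @^-1` [set f x]) x /\
  exists U V, [/\ open U, open V, U x, f @` U `<=` V & 
    (forall t, finite_set (U `&` f @^-1` [set t])) /\
    forall G, closed G -> forall t, V t -> ~ (f @` (U `&` G)) t -> nbhs t (~` (f @` (U `&` G)))].
Proof.
move=> hD hD' hY hZ lcY cf Dx Dx' nB finB.
have nD := le_nbhs hD Dx.
have [B1 nB1 [B1B B1x]] : exists2 B1, nbhs x B1 & B1 `<=` B /\ B1 `&` f @^-1` [set f x] = [set x].
  (* The other points of the fibre in the chart form a finite set, whose removal leaves a
     neighbourhood of x. *)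
  pose Q := ((B `&` f @^-1` [set f x]) `\ x) `&` D.
  have cQ : compact (e @` Q).
    apply: finite_compact; apply: finite_image; apply: finite_setIl; exact: finite_setD.
  have nQ : ~ Q x by move=> [[_ /= h] _].
  have QD : Q `<=` D by move=> y [].
  exists (B `&` D `&` ~` Q).
    apply: filterI; first exact: filterI.
    exact: (le_closed_image hD hY cQ QD Dx nQ).
  split; first by move=> y [[]].
  apply/seteqP; split=> [y [[[By Dy] nQy] fy]|_ ->].
    by apply: contrapT => yx; apply: nQy.
  by split=> //; split=> //; split=> //; exact: nbhs_singleton.
have B1fx := nbhs_singleton nB1.
split; first by split; [exact/mem_set|exists B1].
have nfD' : nbhs x (f @^-1` D') by apply: cf; exact: (le_nbhs hD' Dx').
have [K [cK nK KB]] := le_compact_nbhs hD lcY Dx (filterI nB1 nfD').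
have cim C : compact C -> C `<=` K -> compact (e' @` (f @` C)).
  move=> cC CK; rewrite image_comp; apply: continuous_compact => //.
  apply: continuous_in_subspaceT => y /set_mem /CK /KB [[_ D'y] _].
  exact: (continuous_comp (cf y) (le_cont hD' D'y)).
have sub C : C `<=` K -> f @` C `<=` D' by move=> CK _ [y /CK /KB [[_ h] _] <-].
have cl C t : compact C -> C `<=` K -> D' t -> ~ (f @` C) t -> nbhs t (~` (f @` C)).
  move=> cC CK; apply: (le_closed_image hD' hZ); [exact: cim|exact: sub].
pose dK := K `&` ~` K°.
have cdK : compact dK by apply: compact_closedI => //; apply: open_closedC; exact: open_interior.
have dKK : dK `<=` K by move=> y [].
pose V := D' `&` ~` (f @` dK).
have oV : open V.
  rewrite openE => t [D't nt]; apply: filterI; [exact: (le_nbhs hD')|exact: cl].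
have Kin y : K y -> V (f y) -> K° y.
  by move=> Ky [_ h]; apply: contrapT => nK'; apply: h; exists y.
exists (K° `&` f @^-1` V), V; split=> //.
- apply: openI; first exact: open_interior.
  exact: (@open_comp _ _ f V (fun y _ => cf y) oV).
- split=> //; split=> // -[y [Ky nKy] fy].
  have : [set x] y by rewrite -B1x; split; [case: (KB _ Ky) => -[]|].
  by move=> /= yx; apply: nKy; rewrite yx.
- by move=> _ [y [_ h] <-].
split=> [t|G cG t Vt nt].
  apply: (sub_finite_set _ (finB t)) => y [[Ky _] fy]; split=> //.
  by apply: B1B; case: (KB y (interior_subset Ky)) => -[].
have KG : K `&` G `<=` K by move=> y [].
(* [K] ∩ [G] is compact, so its image is closed near t; over V it agrees with the image of U ∩ G,
   since points of K above V are interior to K. *)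
have h : nbhs t (~` (f @` (K `&` G))).
  apply: cl => //; first exact: compact_closedI.
    by case: Vt.
  move=> [y [Ky Gy] fy]; apply: nt; exists y => //; split=> //; split=> /=; last by rewrite fy.
  by apply: Kin => //; rewrite fy.
apply: filterS h => u hu [y [[Ky _] Gy] fy]; apply: hu; exists y => //; split=> //.
exact: interior_subset.
Qed.

(** * Charts *)

Lemma nbhs_set_type (X : topologicalType) (D : set X) (u : set_type D) (B : set (set_type D)) :
  nbhs u B <-> exists2 W : set X, nbhs (val u : X) W & forall w, W (val w) -> B w.
Proof.
split; last first.
  move=> [W nW hW]; have h : nbhs u (val @^-1` W) by exact: (@initial_continuous _ _ set_val u).
  exact: (filterS (P := val @^-1` W)).
move=> nB; have [B' [[W oW WB'] B'u] B'B] : exists2 B', open_nbhs u B' & B' `<=` B.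
  by move: nB; rewrite nbhsE.
exists W; first by apply: open_nbhs_nbhs; split=> //; rewrite -WB' in B'u.
by move=> w Ww; apply: B'B; rewrite -WB'.
Qed.

Lemma set_val_continuous (X : topologicalType) (D : set X) : continuous (val : set_type D -> X).
Proof. exact: initial_continuous. Qed.

Lemma open_set_val (X : topologicalType) (D : set X) (B : set (set_type D)) :
  open D -> open B -> open (val @` B).
Proof.
move=> oD oB; rewrite openE => _ [u Bu <-].
have /nbhs_set_type[W nW hW] : nbhs u B by exact: open_nbhs_nbhs.
have nD : nbhs (val u) D by apply: open_nbhs_nbhs; split=> //; exact: set_mem (valP u).
by apply: filterS2 nW nD => w Ww Dw; exists (exist _ w (mem_set Dw)) => //; exact: hW.
Qed.

Section MorphismStalks.
Variables (X Y : lrs) (f : mor X Y) (hf : is_mor f) (x : X).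
(** The proof argument lets the ring morphism structure be inferred. *)
Definition msf (_ : is_mor f) : lst (f x) -> lst x := @ms _ _ f x.
Fact msf_zmod : GRing.zmod_morphism (msf hf).
Proof. by have [_ h _ _] := hf; case: (h x). Qed.
Fact msf_monoid : GRing.monoid_morphism (msf hf).
Proof. by have [_ h _ _] := hf; case: (h x). Qed.
HB.instance Definition _ := GRing.isZmodMorphism.Build _ _ (msf hf) msf_zmod.
HB.instance Definition _ := GRing.isMonoidMorphism.Build _ _ (msf hf) msf_monoid.
End MorphismStalks.

(** Maps on stalks are compared on families of germs; this recovers the statement for a single
    germ. *)
Lemma family_through (T : Type) (F : T -> Type) (d : forall x, F x) x (a : F x) :
  exists t : forall x, F x, t x = a.
Proof.
exists (fun y => match pselect (x = y) with left e => eq_rect x F a y e | right _ => d y end).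
by case: pselect => // e; rewrite (Prop_irrelevance e erefl).
Qed.

Section RegularGerms.
Variables (R : realType) (A : comNzRingType) (nA : A -> R) (n : nat).
Local Notation E := (aff_alg nA n).

(** Functions regular near x before passing to germs: [rgerm] maps this ring to the stalk at x and
    [reval] evaluates at any other point, so one algebraic expression can be read in both places. *)
Definition regs (x : bpt E) := subring [set g : fun_ring E | exists U, [/\ open U, U x & is_regular U g]].

Lemma regs_near x (r : regs x) : reg_near x (sr_val r).
Proof.
exact/(reg_nearP (aff_loc_compact (nA := nA) (n := n)))/(sr_valP (near_regular_subring x)).
Qed.

Definition rgerm x (r : regs x) : stalk x := qpi _ r.
Fact rgerm_zmod x : GRing.zmod_morphism (@rgerm x).
Proof. by move=> r s; exact: qpiB. Qed.
Fact rgerm_monoid x : GRing.monoid_morphism (@rgerm x).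
Proof. by split=> [|r s]; [exact: qpi1|exact: qpiM]. Qed.
HB.instance Definition _ x := GRing.isZmodMorphism.Build (regs x) (stalk x) (@rgerm x) (@rgerm_zmod x).
HB.instance Definition _ x := GRing.isMonoidMorphism.Build (regs x) (stalk x) (@rgerm x) (@rgerm_monoid x).

Lemma rgermE x (r : regs x) : rgerm r = germ x (sr_val r).
Proof.
congr qpi; apply: val_inj; rewrite /= -[RHS]/(sr_val (sr_in _ (sr_val r))).
by rewrite /sr_in -[RHS]/(val _) val_insubd; case: r => r /= ->.
Qed.

Definition reval x y (r : regs x) : HF y := fval (sr_val r) y.
Fact reval_zmod x y : GRing.zmod_morphism (@reval x y). Proof. by []. Qed.
Fact reval_monoid x y : GRing.monoid_morphism (@reval x y). Proof. by []. Qed.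
HB.instance Definition _ x y := GRing.isZmodMorphism.Build (regs x) (HF y) (@reval x y) (@reval_zmod x y).
HB.instance Definition _ x y := GRing.isMonoidMorphism.Build (regs x) (HF y) (@reval x y) (@reval_monoid x y).

Lemma gvalF_rgerm x (r : regs x) : gvalF (rgerm r) = reval x r.
Proof. by rewrite rgermE gvalF_germ //; exact: regs_near. Qed.

Lemma regs_of x g : reg_near x g -> exists r : regs x, sr_val r = g.
Proof.
move=> hg; exists (sr_in _ g); rewrite /sr_in -[sr_val _]/(val _) val_insubd.
have /(reg_nearP (aff_loc_compact (nA := nA) (n := n))) h := hg.
by rewrite ifT //; apply/asboolP => M [_]; exact.
Qed.

Lemma rgerm_surj x (a : stalk x) : exists r, rgerm r = a.
Proof. by exists (qrep a); exact: qrepK. Qed.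
End RegularGerms.

Lemma comp_qpi_zmod (L L' : comPzRingType) (I : set L) (phi : {rmorphism quot I -> L'}) :
  GRing.zmod_morphism (fun a => phi (qpi I a)).
Proof. by move=> a b; rewrite qpiB rmorphB. Qed.
Lemma comp_qpi_monoid (L L' : comPzRingType) (I : set L) (phi : {rmorphism quot I -> L'}) :
  GRing.monoid_morphism (fun a => phi (qpi I a)).
Proof. by split=> [|a b]; rewrite ?qpi1 ?rmorph1 // qpiM rmorphM. Qed.

Lemma closed_sub_emb_open (X : lrs) (U : set X) (I : forall u : open_sub U, set (lst u))
    (z : closed_sub I) (B : set (closed_sub I)) : nbhs z B ->
  exists2 W : set X, nbhs (val (val z) : X) W & forall z' : closed_sub I, W (val (val z')) -> B z'.
Proof.
move=> /nbhs_set_type[W1 /nbhs_set_type[W nW hW] hW1]; exists W => // z' Wz'.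
by apply: hW1; exact: hW.
Qed.

Lemma closed_sub_emb_continuous (X : lrs) (U : set X) (I : forall u : open_sub U, set (lst u)) :
  continuous (fun z : closed_sub I => val (val z) : X).
Proof.
move=> z; exact: (@continuous_comp _ _ _ (val : closed_sub I -> open_sub U) val z
  (@set_val_continuous _ _ z) (@set_val_continuous _ _ (val z))).
Qed.

Section Model.
Variables (R : realType) (A : comNzRingType) (nA : A -> R) (M : model nA).

Lemma md_emb_continuous : continuous (@md_emb R A nA M).
Proof. exact: (@closed_sub_emb_continuous (aff nA (md_n M)) (@md_U _ _ _ M) (@md_I _ _ _ M)). Qed.

Lemma md_emb_open (z : md_lrs M) (B : set (md_lrs M)) : nbhs z B ->
  exists2 W, nbhs (md_emb M z) W & forall z', W (md_emb M z') -> B z'.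
Proof. exact: (@closed_sub_emb_open (aff nA (md_n M)) (@md_U _ _ _ M) (@md_I _ _ _ M) z B). Qed.
End Model.

Section Chart.
Variables (R : realType) (A : comNzRingType) (nA : A -> R) (X : lrs).
Variables (str : forall x : X, A -> lst x) (c : chart nA str).
Local Notation D := (ch_dom c).
Local Notation N := (md_n (ch_model c)).
Local Notation E := (aff_alg nA N).

Definition chart_emb (y : open_sub D) : bpt E := ch_emb c y.

Let mch : is_mor (@ch_map _ _ _ _ _ c) := (ch_iso c).1.

Definition chart_ms (y : open_sub D) (a : stalk (chart_emb y)) : lst (val y) :=
  @msf _ _ _ y mch (qpi _ a).
Fact chart_ms_zmod y : GRing.zmod_morphism (@chart_ms y).
Proof. exact: (comp_qpi_zmod (GRing.RMorphism.clone _ _ (@msf _ _ _ y mch) _)). Qed.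
Fact chart_ms_monoid y : GRing.monoid_morphism (@chart_ms y).
Proof. exact: (comp_qpi_monoid (GRing.RMorphism.clone _ _ (@msf _ _ _ y mch) _)). Qed.
HB.instance Definition _ y := GRing.isZmodMorphism.Build (stalk (chart_emb y)) (lst (val y)) (@chart_ms y) (@chart_ms_zmod y).
HB.instance Definition _ y := GRing.isMonoidMorphism.Build (stalk (chart_emb y)) (lst (val y)) (@chart_ms y) (@chart_ms_monoid y).

Lemma chart_ms_surj (y : open_sub D) (b : lst (val y)) : exists a : stalk (chart_emb y), chart_ms a = b.
Proof.
have [_ [g [_ h1 _]]] := ch_iso c.
have [t ht] := @family_through _ (fun u : open_sub D => lst u) (fun=> 0) y b.
have [_ /(_ t)] := h1 y; rewrite /= ht => e.
set q := @ms _ _ g (ch_map c y) (t (g (ch_map c y))) in e.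
exists (qrep q); exact: (etrans (congr1 (@ms _ _ (ch_map c) y) (qrepK q)) e).
Qed.

Lemma chart_emb_inj : injective chart_emb.
Proof.
move=> y y' /val_inj/val_inj; have [_ [g [_ h1 _]]] := ch_iso c.
move=> e; have [gy _] := h1 y; have [gy' _] := h1 y'.
by move: gy gy'; rewrite /= e => -> ->.
Qed.

Lemma chart_emb_continuous : continuous chart_emb.
Proof.
move=> y; have [cm _ _ _] := mch.
exact: (@continuous_comp _ _ _ (@ch_map _ _ _ _ _ c) (@md_emb _ _ _ (ch_model c)) y (cm y)
  (@md_emb_continuous R A nA (ch_model c) (ch_map c y))).
Qed.

Lemma chart_emb_open y B : nbhs y B ->
  exists2 W, nbhs (chart_emb y) W & forall y', W (chart_emb y') -> B y'.
Proof.
have [_ [g [[cg _ _ _] h1 _]]] := ch_iso c; move=> nB.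
have gy y' : g (ch_map c y') = y' by have [] := h1 y'.
have h : nbhs (ch_map c y) (g @^-1` B) by apply: cg; rewrite gy.
have [W nW hW] := md_emb_open h; exists W; first exact: nW.
move=> y' Wy'; rewrite -(gy y'); exact: (hW (ch_map c y') Wy').
Qed.

Definition chart_pt (x : X) (h : D x) : open_sub D := open_pt (mem_set h).

(** [v0] is the junk value outside the domain of the chart. *)
Definition chart_tot (v0 : bpt E) (y : X) : bpt E :=
  match pselect (D y) with left h => chart_emb (chart_pt h) | right _ => v0 end.

Lemma chart_totE v0 (y : open_sub D) : chart_tot v0 (val y) = chart_emb y.
Proof.
rewrite /chart_tot; case: pselect => [h|[]]; last exact: set_mem (valP y).
by congr chart_emb; exact: val_inj.
Qed.

Lemma chart_ptP (x : X) : D x -> exists y : open_sub D, val y = x.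
Proof. by move=> h; exists (chart_pt h). Qed.

Lemma chart_emb_ideal (y : open_sub D) : ~ @md_I _ _ _ (ch_model c) (val (ch_map c y)) 1.
Proof. exact: set_mem (valP (ch_map c y)). Qed.

Lemma chart_emb_onto (u : open_sub (@md_U _ _ _ (ch_model c))) :
  ~ @md_I _ _ _ (ch_model c) u 1 -> exists y, chart_emb y = val u.
Proof.
move=> h; have [_ [g [_ _ h2]]] := ch_iso c.
pose z : md_lrs (ch_model c) := exist _ u (mem_set h).
have [e _] := h2 z; exists (g z).
exact: (congr1 (fun z' : md_lrs (ch_model c) => val (val z') : bpt E) e).
Qed.
End Chart.

Lemma closed_sub_section (X : lrs) (U V : set X) (I : forall u : open_sub U, set (lst u))
    (t : forall x : X, lst x) : open V -> lsec (V `&` U) t ->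
  @lsec (closed_sub I) [set z | V (val (val z))] (fun z => qpi (I (val z)) (t (val (val z)))).
Proof.
move=> oV ht z Vz; exists [set u : open_sub U | V (val u)]; split=> //.
  exact: (@open_comp _ _ (val : set_type U -> X) V (fun u _ => @set_val_continuous X U u) oV).
exists (fun u : open_sub U => t (val u)) => //; exists t => //.
suff -> : val @` [set u : open_sub U | V (val u)] = V `&` U by [].
apply/seteqP; split=> [_ [u Vu <-]|v [Vv Uv]]; first by split=> //; exact: set_mem (valP u).
by exists (exist _ v (mem_set Uv)).
Qed.

Lemma mor_closed_sub_section (X Z : lrs) (D : set X) (U V : set Z)
    (I : forall u : open_sub U, set (lst u)) (f : mor (open_sub D) (closed_sub I)) (t : forall z : Z, lst z) :
  is_mor f -> open V -> lsec (V `&` U) t ->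
  exists2 s, @lsec X (val @` [set y : open_sub D | V (val (val (f y)))]) s &
    forall y : open_sub D, V (val (val (f y))) ->
      @ms _ _ f y (qpi (I (val (f y))) (t (val (val (f y))))) = s (val y).
Proof.
move=> [_ _ _ h] oV /(@closed_sub_section _ _ _ I _ oV) ht.
have oV1 : open [set z : closed_sub I | V (val (val z))].
  exact: (@open_comp _ _ _ V (fun z _ => @closed_sub_emb_continuous Z U I z) oV).
by have [s hs e] := h _ _ oV1 ht; exists s.
Qed.

(** If 1 lies in I_u, a section of I has germ 1 at u; it keeps germ 1, and stays in I, at all nearby
    points. *)
Lemma support_closed (X : lrs) (U : set X) (I : forall u : open_sub U, set (lst u)) :
  open U -> is_ideal_sheaf I ->
  (forall V s (x : X), open V -> lsec V s -> V x -> s x = 1 -> \forall y \near x, s y = 1) ->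
  forall u, I u 1 -> \forall v \near (val u : X), forall w : open_sub U, val w = v -> I w 1.
Proof.
move=> oU [_ hI] h1 u /hI[W [oW Wu [s [[s' hs' e] sI] su]]].
have oW' := open_set_val oU oW.
have Wu' : (val @` W) (val u) by exists u.
have n1 := h1 _ _ _ oW' hs' Wu' (etrans (esym (e u Wu)) su).
apply: filterS2 n1 (open_nbhs_nbhs (conj oW' Wu')) => v s1 [w' Ww' w'v] w wv.
have ww : w' = w by apply: val_inj; rewrite w'v.
move: (sI w'); rewrite ww in Ww' *; move=> /(_ Ww').
by rewrite -wv in s1; rewrite (etrans (e w Ww') s1).
Qed.

Section Chart.
Variables (R : realType) (A : comNzRingType) (nA : A -> R) (X : lrs).
Variables (str : forall x : X, A -> lst x) (c : chart nA str).
Local Notation D := (ch_dom c).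
Local Notation N := (md_n (ch_model c)).
Local Notation E := (aff_alg nA N).

Let lcE : loc_compact E := aff_loc_compact (nA := nA) (n := N).

Lemma chart_section (V : set (bpt E)) g : open V -> is_regular V g ->
  exists2 s, @lsec X (val @` (@chart_emb _ _ _ _ _ c @^-1` V)) s &
    forall y, V (chart_emb y) -> chart_ms (germ (chart_emb y) g : stalk (chart_emb y)) = s (val y).
Proof.
move=> oV hg; pose t (v : bpt E) := germ v g.
have ht : @lsec (aff nA N) (V `&` @md_U _ _ _ (ch_model c)) t.
  exists g => //; apply: (near_is_regular lcE).
    by apply: openI => //; exact: md_open.
  by move=> v [Vv _]; exact: (is_regular_near hg Vv).
exact: (@mor_closed_sub_section X (aff nA N) D _ V (@md_I _ _ _ (ch_model c))
  (@ch_map _ _ _ _ _ c) t (ch_iso c).1 oV ht).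
Qed.

Lemma germ_section_near (v : bpt E) V (s : forall v : bpt E, stalk v) : @lsec (aff nA N) V s -> V v ->
  s v = 1 -> \forall w \near v, s w = 1.
Proof.
move=> [g hg hs] Vv; have gv := is_regular_near hg Vv.
rewrite hs // -germ1 => /(germ_eq gv (reg_near1 v)).
have [W [cW nW WV _]] := hg v Vv.
move=> h; apply: filterS2 nW (nbhs_interior h) => w Ww hw.
rewrite hs; last exact: WV.
rewrite -[RHS]germ1; apply/(germ_eq (is_regular_near hg (WV _ Ww)) (reg_near1 w)).
exact: hw.
Qed.

Lemma chart_local_embedding v0 : local_embedding D (chart_tot (c := c) v0).
Proof.
have nD (y : open_sub D) : nbhs (val y : X) D.
  by apply: open_nbhs_nbhs; split; [exact: ch_open|exact: set_mem (valP y)].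
split.
- exact: ch_open.
- move=> _ _ /(chart_ptP (c := c))[y <-] /(chart_ptP (c := c))[y' <-].
  by rewrite !chart_totE => /chart_emb_inj ->.
- move=> _ /(chart_ptP (c := c))[y <-]; rewrite chart_totE => W nW.
  have [B nB hB] := (nbhs_set_type y _).1 (@chart_emb_continuous _ _ _ _ _ c y _ nW).
  apply: filterS2 nB (nD y) => z Bz Dz.
  by have [z' ez] := chart_ptP Dz; rewrite /= -ez chart_totE; apply: hB; rewrite ez.
- move=> _ B /(chart_ptP (c := c))[y <-] nB.
  have [W nW hW] := chart_emb_open ((nbhs_set_type y [set z | B (val z)]).2 (ex_intro2 _ _ B nB (fun _ h => h))).
  exists W; first by rewrite chart_totE.
  by move=> _ /(chart_ptP (c := c))[z <-]; rewrite chart_totE => /hW.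
exists (@md_U _ _ _ (ch_model c)); split; first exact: md_open.
  move=> _ [_ /(chart_ptP (c := c))[y <-] <-]; rewrite chart_totE.
  exact: set_mem (valP (val (ch_map c y))).
move=> v Uv nv; pose u : open_sub (@md_U _ _ _ (ch_model c)) := exist _ v (mem_set Uv).
have Iu : @md_I _ _ _ (ch_model c) u 1.
  apply: contrapT => /chart_emb_onto[y ey]; apply: nv; exists (val y); first exact: set_mem (valP y).
  by rewrite chart_totE ey.
have [hI _ _] := md_coh (ch_model c).
have h := @support_closed (aff nA N) _ (@md_I _ _ _ (ch_model c)) (@md_open _ _ _ (ch_model c)) hI
  (fun V s x _ hs Vx => @germ_section_near x V s hs Vx) u Iu.
apply: filterS h => w hw [_ /(chart_ptP (c := c))[y <-]]; rewrite chart_totE => yw.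
exact: (@chart_emb_ideal _ _ _ _ _ c y (hw (val (ch_map c y)) yw)).
Qed.

Hypothesis hX : is_lrs X.

(** A germ with nonzero value is a unit, and its image would make 0 a unit in the local ring at
    y. *)
Lemma chart_ms_eq0 y (a : stalk (chart_emb y)) : @chart_ms _ _ _ _ _ c y a = 0 -> gvalF a = 0.
Proof.
move=> a0; apply: contrapT => /gvalF_unit[b ab].
have [_ _ _ _ /(_ (val y))[n0 _ _]] := hX; apply: n0; exists 1; rewrite mul0r.
have := congr1 (@chart_ms _ _ _ _ _ c y) ab.
rewrite (rmorphM (@chart_ms _ _ _ _ _ c y)) (rmorph1 (@chart_ms _ _ _ _ _ c y)) => h.
exact: (etrans (esym (etrans (congr1 (fun z => z * _) a0) (mul0r _))) h).
Qed.

(** A relation in the stalk of X at y holds between sections near y; at each nearby point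
    [chart_ms_eq0] turns it into an equation between values. *)
Lemma chart_vanish v0 y (r : regs (chart_emb y)) : @chart_ms _ _ _ _ _ c y (rgerm r) = 0 ->
  \forall z \near (val y : X), fval (sr_val r) (chart_tot (c := c) v0 z) = 0.
Proof.
move=> r0; have [V [oV Vy hV]] := reg_near_open lcE (regs_near r).
have [s hs e] := chart_section oV hV.
have oD := @ch_open _ _ _ _ _ c.
have oW : open (val @` (@chart_emb _ _ _ _ _ c @^-1` V)).
  apply: open_set_val => //.
  exact: (@open_comp _ _ _ V (fun z _ => @chart_emb_continuous _ _ _ _ _ c z) oV).
have Wy : (val @` (@chart_emb _ _ _ _ _ c @^-1` V)) (val y) by exists y.
have sy : s (val y) = 0 by rewrite -(e y Vy) -r0 rgermE.
have [_ _ _ h4 _] := hX.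
apply: filterS2 (h4 _ _ _ oW hs Wy sy) (open_nbhs_nbhs (conj oW Wy)) => z sz [w Vw wz].
rewrite -wz chart_totE; rewrite -wz in sz.
have gw := is_regular_near hV Vw.
by rewrite -[LHS](gvalF_germ gw); apply: chart_ms_eq0; rewrite (e w Vw).
Qed.
End Chart.

(** * Morphisms between affine spaces *)

Lemma abs_transport_frac (R : realType) (L L' : fieldType) (v : L -> R) (v' : L' -> R)
    (h x y : L) (h' x' y' : L') : is_abs v -> is_abs v' -> y != 0 -> v y = v' y' ->
  v (h * y - x) = v' (h' * y' - x') -> v (h - x / y) = v' (h' - x' / y').
Proof.
move=> hv hv' y0 ey e; have vy : v y != 0 by rewrite gt_eqF // (abs_gt0 hv).
have y'0 : y' != 0 by rewrite -(abs_gt0 hv') -ey (abs_gt0 hv).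
apply: (mulIf vy); rewrite {2}ey -(absM hv) -(absM hv').
by rewrite !mulrBl !divfK.
Qed.

Section StalkExtension.
Variables (R : realType) (A : comNzRingType) (nA : A -> R) (n m : nat).
Local Notation E := (aff_alg nA n).
Local Notation E' := (aff_alg nA m).
Variables (z : bpt E') (x : bpt E) (psi : {rmorphism stalk z -> stalk x}).
Hypothesis habs_psi : forall a, habs (gvalF (psi a)) = habs (gvalF a).
Hypothesis psi_str : forall a : A, psi (pgerm z (poly_const A m a)) = pgerm x (poly_const A n a).

Definition stalk_phi (p : ba_ring E') : HF x := gvalF (psi (pgerm z p)).
Fact stalk_phi_zmod : GRing.zmod_morphism stalk_phi.
Proof.
by move=> p q; rewrite /stalk_phi (rmorphB (@pgerm _ _ _ _ z)) (rmorphB psi) (rmorphB (@gvalF _ _ _ _ x)).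
Qed.
Fact stalk_phi_monoid : GRing.monoid_morphism stalk_phi.
Proof.
split.
  by rewrite /stalk_phi (rmorph1 (@pgerm _ _ _ _ z)) (rmorph1 psi) (rmorph1 (@gvalF _ _ _ _ x)).
by move=> p q; rewrite /stalk_phi (rmorphM (@pgerm _ _ _ _ z)) (rmorphM psi) (rmorphM (@gvalF _ _ _ _ x)).
Qed.
HB.instance Definition _ := GRing.isZmodMorphism.Build (ba_ring E') (HF x) stalk_phi stalk_phi_zmod.
HB.instance Definition _ := GRing.isMonoidMorphism.Build (ba_ring E') (HF x) stalk_phi stalk_phi_monoid.

(** The map on polynomials extends to H(z) by the universal property. It is compatible with all
    germs, since psi is isometric and hence preserves approximation by fractions. *)
Lemma stalk_extension : exists Phi : {rmorphism HF z -> HF x},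
  [/\ forall h, habs (Phi h) = habs h, forall a, Phi (hbase z a) = hbase x a &
      forall b, Phi (gvalF b) = gvalF (psi b)].
Proof.
have habs_phi p : habs (stalk_phi p) = sn z p.
  by rewrite /stalk_phi habs_psi gvalF_pgerm habs_pv.
have hx := habs_abs x; have hz := habs_abs z.
have [Phi [h1 h2]] := @exists_extension R E' z _ _ stalk_phi hx (@habs_complete _ _ x) habs_phi.
have h3 b : Phi (gvalF b) = gvalF (psi b).
  apply: (@extension_lim R E' z _ _ stalk_phi Phi hx h1 h2) => e e0.
  have [p [q [q0 hpq]]] := @hv_dense R E' z (gvalF b) e e0; exists p, q; split; [exact: q0|exact: hpq|].
  suff <- : habs (gvalF b - fracv z p q) = habs (gvalF (psi b) - stalk_phi p / stalk_phi q) by exact: hpq.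
  rewrite (@hvE R E' z p q q0).
  have qn0 : pv z q != 0.
    by rewrite -(abs_gt0 hz) habs_pv lt_neqAle sn_ge0 andbT eq_sym; apply/eqP.
  have e1 : habs (pv z q) = habs (stalk_phi q) by rewrite habs_phi habs_pv.
  have e2 : habs (gvalF b * pv z q - pv z p) = habs (gvalF (psi b) * stalk_phi q - stalk_phi p).
    have -> : gvalF b * pv z q - pv z p = gvalF (b * pgerm z q - pgerm z p).
      by rewrite (rmorphB (@gvalF _ _ _ _ z)) (rmorphM (@gvalF _ _ _ _ z)) /= !gvalF_pgerm.
    have -> : gvalF (psi b) * stalk_phi q - stalk_phi p = gvalF (psi (b * pgerm z q - pgerm z p)).
      by rewrite (rmorphB psi) (rmorphM psi) (rmorphB (@gvalF _ _ _ _ x)) (rmorphM (@gvalF _ _ _ _ x)).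
    exact: (esym (habs_psi (b * pgerm z q - pgerm z p))).
  exact: (@abs_transport_frac R (HF z) (HF x) (@habs R E' z) (@habs R E x) (gvalF b) (pv z p) (pv z q)
    (gvalF (psi b)) (stalk_phi p) (stalk_phi q) hz hx qn0 e1 e2).
by exists Phi; split=> // a; rewrite /hbase -!gvalF_pgerm h3 psi_str.
Qed.
End StalkExtension.

Section AffineMorphism.
Variables (R : realType) (A : comNzRingType) (nA : A -> R) (n m : nat).
Variables (W : set (aff nA n)) (F : mor (open_sub W) (aff nA m)).
Hypotheses (oW : open W) (hF : is_aff_mor F).
Local Notation E := (aff_alg nA n).
Local Notation E' := (aff_alg nA m).

Let mF : is_mor F. Proof. by case: hF. Qed.

Definition aff_ms (w : open_sub W) (a : stalk (F w : bpt E')) : stalk (val w : bpt E) := @ms _ _ F w a.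
Fact aff_ms_zmod w : GRing.zmod_morphism (@aff_ms w).
Proof. by case: mF => _ /(_ w)[h _] _ _; exact: h. Qed.
Fact aff_ms_monoid w : GRing.monoid_morphism (@aff_ms w).
Proof. by case: mF => _ /(_ w)[_ h] _ _; exact: h. Qed.
HB.instance Definition _ w := GRing.isZmodMorphism.Build (stalk (F w : bpt E')) (stalk (val w : bpt E))
  (@aff_ms w) (@aff_ms_zmod w).
HB.instance Definition _ w := GRing.isMonoidMorphism.Build (stalk (F w : bpt E')) (stalk (val w : bpt E))
  (@aff_ms w) (@aff_ms_monoid w).

Lemma habs_aff_ms w a : habs (gvalF (@aff_ms w a)) = habs (gvalF a).
Proof. by case: hF => _ _ /(_ w a). Qed.

Lemma aff_ms_extension (w : open_sub W) : exists Phi : {rmorphism HF (F w : bpt E') -> HF (val w : bpt E)},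
  [/\ forall h, habs (Phi h) = habs h,
      forall a, Phi (hbase (F w : bpt E') a) = hbase (val w : bpt E) a &
      forall b, Phi (gvalF b) = gvalF (@aff_ms w b)].
Proof.
have [_ h _] := hF.
exact: (@stalk_extension R A nA n m (F w) (val w) (GRing.RMorphism.clone _ _ (@aff_ms w) _)
  (@habs_aff_ms w) (h w)).
Qed.

(** A single regular function represents the pull-back at all nearby points, which a choice of germs
    point by point would not give. *)
Lemma aff_ms_section w0 (r : regs (F w0 : bpt E')) : exists r' : regs (val w0 : bpt E),
  rgerm r' = aff_ms (rgerm r) /\
  \forall v \near (val w0 : bpt E), forall w : open_sub W, val w = v ->
    reg_near (F w : bpt E') (sr_val r) /\
    gvalF (@aff_ms w (germ (F w) (sr_val r))) = fval (sr_val r') (val w).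
Proof.
have [V [oV Vw hV]] := reg_near_open (aff_loc_compact (nA := nA) (n := m)) (regs_near r).
case: mF => cF _ _ /(_ V (fun v : bpt E' => germ v (sr_val r)) oV).
case; first by exists (sr_val r).
move=> s [g hg hs] e.
have oFV : open (F @^-1` V) by exact: (@open_comp _ _ F V (fun z _ => cF z) oV).
have oZ := open_set_val oW oFV.
have Zw : (val @` (F @^-1` V)) (val w0) by exists w0.
have [r' hr'] := regs_of (is_regular_near hg Zw); exists r'; split.
  rewrite rgermE hr' -hs // -(e w0 Vw); congr aff_ms.
  by rewrite -rgermE.
apply: filterS (open_nbhs_nbhs (conj oZ Zw)) => v [w' Vw' w'v] w wv.
have ww : w' = w by apply: val_inj; rewrite w'v.
rewrite ww in Vw'; split; first exact: (is_regular_near hV Vw').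
have Zw' : (val @` (F @^-1` V)) (val w) by exists w.
rewrite hr' -[RHS](gvalF_germ (is_regular_near hg Zw')) -(hs _ Zw').
by rewrite -(e w Vw').
Qed.
End AffineMorphism.

Section NearBounds.
Variables (R : realType) (E : balg R) (q0 : bpt E).

Lemma near_bounded (I : finType) (g : I -> fun_ring E) : (forall i, reg_near q0 (g i)) ->
  exists2 C, 0 <= C & \forall q \near q0, forall i, habs (fval (g i) q) <= C.
Proof.
move=> hg; pose C (i : I) := habs (fval (g i) q0) + 1.
have C0 i : 0 <= C i by rewrite addr_ge0 //; exact: (abs_ge0 (habs_abs q0)).
exists (\sum_i C i); first exact: sumr_ge0.
apply: (@filter_forall _ I (fun i q => habs (fval (g i) q) <= _) (nbhs q0)) => i; have [V nV hV] := habs_near (hg i) ltr01.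
apply: filterS nV => q /hV; rewrite ler_distl => /andP[_ h].
by apply: (le_trans h); rewrite (bigD1 i) //= lerDl sumr_ge0.
Qed.

Lemma near_small (J : nat) (g : 'I_J -> fun_ring E) e : 0 < e -> (forall l, reg_near q0 (g l)) ->
  (forall l, fval (g l) q0 = 0) -> \forall q \near q0, \sum_l habs (fval (g l) q) <= e.
Proof.
(* J + 1 rather than J, so that the empty family needs no separate case. *)
move=> e0 hg g0; have J0 : 0 < (J.+1)%:R :> R by rewrite ltr0n.
have eJ : 0 < e / J.+1%:R by rewrite divr_gt0.
have h : \forall q \near q0, forall l, habs (fval (g l) q) <= e / J.+1%:R.
  apply: (@filter_forall _ _ (fun l q => habs (fval (g l) q) <= _) (nbhs q0)) => l; have [V nV hV] := habs_near (hg l) eJ.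
  apply: filterS nV => q /hV; rewrite g0 (abs0 (habs_abs q0)) subr0.
  exact: le_trans (ler_norm _).
apply: filterS h => q hq; apply: (le_trans (ler_sum _ (fun l _ => hq l))).
rewrite sumr_const card_ord -[X in X <= _]mulr_natr mulrAC ler_pdivrMr //.
by apply: ler_wpM2l; [exact: ltW|rewrite ler_nat].
Qed.
End NearBounds.

Section PolynomialRelations.
Variables (k L : fieldType) (io : {rmorphism k -> L}) (B : comPzRingType) (rv : {rmorphism B -> L}).
Variables (n : nat) (c : nat -> k) (b : nat -> B) (Th : B).
Hypothesis cb : forall m, (m < n)%N -> io (c m) = rv (b m).

Lemma horner_map_sum : (map_poly io (\poly_(m < n) c m)).[rv Th] = rv (\sum_(m < n) b m * Th ^+ m).
Proof.
rewrite (@horner_coef_wide _ n); last exact: leq_trans (size_poly _ _) (size_poly _ _).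
rewrite rmorph_sum; apply: eq_bigr => m _.
by rewrite coef_map coef_poly ltn_ord /= cb // rmorphM rmorphXn.
Qed.

Lemma horner_deriv_map_sum : (map_poly io (\poly_(m < n) c m))^`().[rv Th] =
  rv (\sum_(m < n) (b m * Th ^+ m.-1) *+ m).
Proof.
rewrite poly_def rmorph_sum linear_sum horner_sum rmorph_sum; apply: eq_bigr => m _.
rewrite /= map_polyZ map_polyXn derivZ derivXn hornerZ hornerMn hornerXn mulrnAr /= cb //.
by rewrite rmorphMn rmorphM rmorphXn.
Qed.

Variables (J : nat) (d : 'I_J -> k) (a f : 'I_J -> B).
Hypothesis da : forall l, io (d l) = rv (a l).

Lemma rmorph_comb : rv (\sum_l a l * f l) = \sum_l io (d l) * rv (f l).
Proof. by rewrite rmorph_sum; apply: eq_bigr => l _; rewrite rmorphM da. Qed.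

Lemma root_relation : rv (\sum_(m < n) b m * Th ^+ m - \sum_l a l * f l) = 0 ->
  (map_poly io (\poly_(m < n) c m)).[rv Th] = \sum_l io (d l) * rv (f l).
Proof. by move/eqP; rewrite rmorphB subr_eq0 horner_map_sum rmorph_comb => /eqP. Qed.

Lemma coord_relation X : rv (X - (\sum_(m < n) b m * Th ^+ m + \sum_l a l * f l)) = 0 ->
  rv X = (map_poly io (\poly_(m < n) c m)).[rv Th] + \sum_l io (d l) * rv (f l).
Proof. by move/eqP; rewrite rmorphB subr_eq0 rmorphD horner_map_sum rmorph_comb => /eqP. Qed.
End PolynomialRelations.

Lemma near_half (R : realType) (a b : R) : `|b - a| <= a / 2 -> a / 2 <= b.
Proof. by rewrite ler_distl => /andP[h _]; lra. Qed.

Lemma preimage_set_type (X Y : topologicalType) (W : set X) (F : set_type W -> Y) (w : set_type W) Q :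
  F @ w --> F w -> nbhs (F w) Q ->
  exists2 V : set X, nbhs (val w : X) V & forall u, V (val u) -> Q (F u).
Proof. by move=> cF /cF/nbhs_set_type. Qed.

(** * Fibres of morphisms between affine spaces *)

Section AffineFibres.
Variables (R : realType) (A : comNzRingType) (nA : A -> R) (N N' : nat).
Variables (W : set (aff nA N)) (F : mor (open_sub W) (aff nA N')).
Hypotheses (oW : open W) (hF : is_aff_mor F).
Local Notation E := (aff_alg nA N).
Local Notation E' := (aff_alg nA N').
Variable w0 : open_sub W.
Local Notation v0 := (val w0 : bpt E).
Local Notation q0 := (F w0 : bpt E').

Definition pulled (r : regs q0) (r' : regs v0) :=
  \forall v \near v0, forall w : open_sub W, val w = v ->
    reg_near (F w : bpt E') (sr_val r) /\
    gvalF (@aff_ms _ _ _ _ _ _ F w (germ (F w : bpt E') (sr_val r))) = fval (sr_val r') (val w : bpt E).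

Definition pull_at (q : bpt E') (v : bpt E) (Phi : {rmorphism HF q -> HF v}) (r : regs q0) (r' : regs v0) :=
  Phi (fval (sr_val r) q) = fval (sr_val r') v.

(** The points v and q are variables tied by equations, so that all points over one q share the
    field H(q) literally. *)
Lemma pulled_extension (I : finType) (r : I -> regs q0) (r' : I -> regs v0) :
  (forall i, pulled (r i) (r' i)) ->
  \forall v \near v0, forall (w : open_sub W) (q : bpt E'), val w = v -> F w = q ->
    exists Phi : {rmorphism HF q -> HF v}, [/\ forall h, habs (Phi h) = habs h,
      forall a, Phi (hbase q a) = hbase v a & forall i, pull_at Phi (r i) (r' i)].
Proof.
move=> h; have FF : Filter (nbhs v0) by exact: (@nbhs_filter (aff nA N)).
have h' := @filter_forall _ I _ (nbhs v0) FF h.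
apply: (@filterS _ (nbhs v0) FF _ _ _ h') => v hv w q wv Fw; case: v / wv hv => hv.
case: q / Fw; have [Phi [h1 h2 h3]] := aff_ms_extension hF w.
exists Phi; split; [exact: h1|exact: h2|move=> i].
have [k1 k2] := hv i w erefl.
exact: (etrans (congr1 Phi (esym (gvalF_germ k1))) (etrans (h3 (germ (F w : bpt E') (sr_val (r i)))) k2)).
Qed.

Variables (n J : nat) (rTh : regs v0) (rX : 'I_N -> regs v0).
Variables (f0 : 'I_J -> regs v0) (f : 'I_N -> 'I_J -> regs v0).
Variables (b : nat -> regs q0) (p : 'I_N -> nat -> regs q0) (a : 'I_J -> regs q0).
Variables (b' : nat -> regs v0) (p' : 'I_N -> nat -> regs v0) (a' : 'I_J -> regs v0).
Hypotheses (hb : forall m, pulled (b m) (b' m)) (hp : forall i m, pulled (p i m) (p' i m)).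
Hypotheses (ha : forall l, pulled (a l) (a' l)) (a0 : forall l, fval (sr_val (a l)) q0 = 0).
Hypothesis hX : forall i, sr_val (rX i) = (hval (poly_var A i : ba_ring E) 1 : fun_ring E).

(** Both sides of an equation of the unramified point differ by this function, which vanishes on the
    analytic space near x but not on the ambient affine space; likewise for [coord_defect]. *)
Definition root_defect : regs v0 :=
  \sum_(m < n) b' m * rTh ^+ m - \sum_l a' l * f0 l.
Definition coord_defect i : regs v0 :=
  rX i - (\sum_(m < n) p' i m * rTh ^+ m + \sum_l a' l * f i l).
Definition root_derivative : regs v0 := \sum_(m < n) (b' m * rTh ^+ m.-1) *+ m.

Lemma solution_at (v : bpt E) (q : bpt E') (Phi : {rmorphism HF q -> HF v}) dlt :
  (forall h, habs (Phi h) = habs h) -> (forall a, Phi (hbase q a) = hbase v a) ->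
  (forall m, (m < n)%N -> pull_at Phi (b m) (b' m)) -> (forall i m, (m < n)%N -> pull_at Phi (p i m) (p' i m)) ->
  (forall l, pull_at Phi (a l) (a' l)) ->
  dlt <= habs (fval (sr_val root_derivative) v) ->
  fval (sr_val root_defect) v = 0 -> (forall i, fval (sr_val (coord_defect i)) v = 0) ->
  @is_solution R A nA N J (sr_val rTh) (fun l => sr_val (f0 l)) (fun i l => sr_val (f i l)) (HF q)
    (@habs R E' q) (hbase q) (\poly_(m < n) fval (sr_val (b m)) q)
    (fun i => \poly_(m < n) fval (sr_val (p i m)) q) (fun l => fval (sr_val (a l)) q) dlt v Phi.
Proof.
move=> h1 h2 hb1 hp1 ha1 hd hr hc.
pose rv : {rmorphism regs v0 -> HF v} := @reval R A nA N v0 v.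
split; [exact: h1|exact: h2| | |].
- have e := @horner_deriv_map_sum (HF q) (HF v) Phi _ rv n (fun m => fval (sr_val (b m)) q) b' rTh hb1.
  by rewrite -[X in habs X]/(_.[rv rTh]) e.
- exact: (@root_relation (HF q) (HF v) Phi _ rv n (fun m => fval (sr_val (b m)) q) b' rTh hb1 J
    (fun l => fval (sr_val (a l)) q) a' f0 ha1 hr).
move=> i.
have e := @coord_relation (HF q) (HF v) Phi _ rv n (fun m => fval (sr_val (p i m)) q) (p' i) rTh (hp1 i) J
    (fun l => fval (sr_val (a l)) q) a' (f i) ha1 (rX i) (hc i).
have eX : rv (rX i) = hcoord v i by exact: (congr1 (fun g : fun_ring E => fval g v) (hX i)).
exact: (etrans (esym eX) e).
Qed.

Hypothesis der0 : fval (sr_val root_derivative) v0 <> 0.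

(** For fixed q, the coefficients are values at q in k = H(q), common to all points over q; only the
    embedding of k in H(v) depends on v. So one instance of [finite_solutions] covers the fibre. *)
Lemma affine_finite_fibres : exists2 V, nbhs v0 V & forall q : bpt E', finite_set
  [set v | [/\ V v, fval (sr_val root_defect) v = 0, forall i, fval (sr_val (coord_defect i)) v = 0 &
                exists2 w : open_sub W, val w = v & F w = q]].
Proof.
pose dlt := habs (fval (sr_val root_derivative) v0) / 2.
have dlt0 : 0 < dlt by rewrite divr_gt0 // (abs_gt0 (habs_abs v0)); apply/eqP.
pose I1 := ('I_n + 'I_N * 'I_n)%type.
pose c1 (t : I1) : regs q0 := match t with inl m => b m | inr (i, m) => p i m end.
have [C C0 hC] := near_bounded (fun t : I1 => regs_near (c1 t)).
have [V1 [eps [nV1 eps0 fin]]] := @finite_solutions R A nA N J (sr_val rTh) (fun l => sr_val (f0 l))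
  (fun i l => sr_val (f i l)) v0 C dlt n C0 dlt0 (regs_near rTh) (fun l => regs_near (f0 l))
  (fun i l => regs_near (f i l)).
have hs := near_small eps0 (fun l => regs_near (a l)) a0.
have [V2 nV2 hV2] := habs_near (regs_near root_derivative) dlt0.
pose I2 := (I1 + 'I_J)%type.
pose r2 (t : I2) : regs q0 := match t with inl t => c1 t | inr l => a l end.
pose r2' (t : I2) : regs v0 :=
  match t with inl (inl m) => b' m | inl (inr (i, m)) => p' i m | inr l => a' l end.
have h2 : forall t, pulled (r2 t) (r2' t).
  by move=> [[m|[i m]]|l]; [exact: hb|exact: hp|exact: ha].
have nV3 := pulled_extension h2.
have [cF _ _ _] : is_mor F by case: hF.
pose Q (q : bpt E') := (forall t, habs (fval (sr_val (c1 t)) q) <= C) /\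
    \sum_l habs (fval (sr_val (a l)) q) <= eps.
have nQ : nbhs q0 Q by exact: (@filterI _ (nbhs q0) _ _ _ hC hs).
have [V4 nV4 hV4] := @preimage_set_type (aff nA N) (aff nA N') W F w0 Q (cF w0) nQ.
exists (V1 `&` V2 `&` V4 `&` [set v | forall (w : open_sub W) (q : bpt E'), val w = v -> F w = q ->
    exists Phi : {rmorphism HF q -> HF v}, [/\ forall h, habs (Phi h) = habs h,
      forall a, Phi (hbase q a) = hbase v a & forall i, pull_at Phi (r2 i) (r2' i)]]).
  have FF : Filter (nbhs v0) by exact: (@nbhs_filter (aff nA N)).
  exact: (@filterI _ (nbhs v0) FF _ _ (@filterI _ (nbhs v0) FF _ _ (@filterI _ (nbhs v0) FF _ _ nV1 nV2) nV4) nV3).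
move=> q; set Y := [set v | _].
case: (pselect (exists v, Y v)) => [[v1 Yv1]|ne]; last first.
  by rewrite (_ : Y = set0) //; apply/seteqP; split=> // v Yv; apply: ne; exists v.
pose M : {poly HF q} := \poly_(m < n) fval (sr_val (b m)) q.
pose P i : {poly HF q} := \poly_(m < n) fval (sr_val (p i m)) q.
pose al l := fval (sr_val (a l)) q.
have sol v : Y v -> exists Phi : {rmorphism HF q -> HF v},
    @is_solution R A nA N J (sr_val rTh) (fun l => sr_val (f0 l)) (fun i l => sr_val (f i l)) (HF q)
    (@habs R E' q) (hbase q) M P al dlt v Phi.
  move=> [[[[_ Vv2] _] Vv3] hr hc [w wv Fw]]; have [Phi [g1 g2 g3]] := Vv3 w q wv Fw.
  exists Phi; apply: (solution_at g1 g2 _ _ _ _ hr hc).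
  - by move=> m hm; exact: (g3 (inl (inl (Ordinal hm)))).
  - by move=> i m hm; exact: (g3 (inl (inr (i, Ordinal hm)))).
  - by move=> l; exact: (g3 (inr l)).
  by have := hV2 v Vv2; exact: near_half.
have [hqC hqe] : (forall t, habs (fval (sr_val (c1 t)) q) <= C) /\ \sum_l habs (al l) <= eps.
  by case: Yv1 => [[[_ Vv4] _] _ _ [w wv Fw]]; rewrite -wv in Vv4; have := hV4 w Vv4; rewrite /= Fw.
have ha0 := abs0 (habs_abs q).
(* If M were 0, its derivative would vanish at v1, against the lower bound [dlt]; this is why a
   point v1 of the fibre was chosen. *)
have M0 : M != 0.
  apply/eqP => M0; have [Phi [_ _ h _ _]] := sol v1 Yv1.
  by move: h; rewrite M0 rmorph0 deriv0 horner0 (abs0 (habs_abs v1)) leNgt dlt0.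
have hM m : habs M`_m <= C.
  rewrite /M coef_poly; case: ifP => [hm|_]; last by rewrite ha0.
  exact: (hqC (inl (Ordinal hm))).
have hP i : (size (P i) <= n)%N /\ forall m, habs (P i)`_m <= C.
  split=> [|m]; first exact: size_poly.
  rewrite /P coef_poly; case: ifP => [hm|_]; last by rewrite ha0.
  exact: (hqC (inr (i, Ordinal hm))).
apply: sub_finite_set (fin (HF q) (@habs R E' q) (hbase q) M P al (habs_abs q) (@habs_complete R E' q) M0
  (size_poly _ _) hM hP hqe) => v Yv.
have hsol := sol v Yv; case: Yv => -[[[Vv _] _] _] _ _ _; exact: (conj Vv hsol).
Qed.
End AffineFibres.

(** * From germs at an unramified point to equations near it *)

Section UnramifiedAffine.
Variables (R : realType) (A : comNzRingType) (nA : A -> R) (N N' : nat).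
Variables (W : set (aff nA N)) (F : mor (open_sub W) (aff nA N')).
Hypotheses (oW : open W) (hF : is_aff_mor F).
Local Notation E := (aff_alg nA N).
Local Notation E' := (aff_alg nA N').
Variable w0 : open_sub W.
Local Notation v0 := (val w0 : bpt E).
Local Notation q0 := (F w0 : bpt E').
Variables (Ls Lx : comPzRingType) (z : bpt E').
Variables (psi : {rmorphism stalk v0 -> Lx}) (chi : {rmorphism stalk z -> Ls}) (mu : {rmorphism Ls -> Lx}).
Hypotheses (psi_surj : forall b, exists a, psi a = b) (psi_eq0 : forall a, psi a = 0 -> gvalF a = 0).
Hypotheses (chi_surj : forall b, exists a, chi a = b) (Fz : q0 = z).
Hypothesis psi_chi : forall t : (forall v : bpt E', stalk v), psi (@aff_ms _ _ _ _ _ _ F w0 (t q0)) = mu (chi (t z)).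

Lemma lift_source (b : Lx) : exists r : regs v0, psi (rgerm r) = b.
Proof. by have [a <-] := psi_surj b; have [r <-] := rgerm_surj a; exists r. Qed.

Lemma lift_target (b : Ls) : exists (r : regs q0) (r' : regs v0),
  [/\ psi (rgerm r') = mu b, pulled r r' & maxid Ls b -> fval (sr_val r) q0 = 0].
Proof.
have [a ab] := chi_surj b; have [ra ra_a] := rgerm_surj a.
(* The points q0 and z are equal but not convertible; one function gives germs at both, which is the
   form that [psi_chi] requires. *)
pose t (v : bpt E') := germ v (sr_val ra).
have tz : t z = a by rewrite /t -rgermE.
have hr : reg_near q0 (sr_val ra) by rewrite Fz; exact: regs_near.
have [r er] := regs_of hr; have [r' [e' hr']] := aff_ms_section oW hF r.
exists r, r'; split; [|exact: hr'|].
  rewrite e' -ab -tz -psi_chi; congr (psi (aff_ms _)).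
  by rewrite rgermE er.
move=> hb; rewrite er; suff h : fval (sr_val ra) z = 0 by rewrite Fz.
apply: contrapT => h; apply: hb.
have [a' aa'] : exists a', a * a' = 1.
  by apply: gvalF_unit; rewrite -ra_a gvalF_rgerm.
by exists (chi a'); rewrite -ab -rmorphM aa' rmorph1.
Qed.

(** The equations in O_x become functions g0 and g_i killed by psi. Elements of m_s lift to
    functions vanishing at q0, which is what makes the a_l small near q0. *)
Lemma unramified_finite_fibres n J (b : nat -> Ls) (p : 'I_N -> nat -> Ls) (Th : Lx) (a : 'I_J -> Ls)
    (f0 : 'I_J -> Lx) (f : 'I_N -> 'I_J -> Lx) :
  (forall l, maxid Ls (a l)) ->
  \sum_(m < n) mu (b m) * Th ^+ m = \sum_l mu (a l) * f0 l ->
  (forall i, psi (pgerm v0 (poly_var A i)) =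
     \sum_(m < n) mu (p i m) * Th ^+ m + \sum_l mu (a l) * f i l) ->
  (exists u, (\sum_(m < n) (mu (b m) * Th ^+ m.-1) *+ m) * u = 1) ->
  exists (g0 : regs v0) (g : 'I_N -> regs v0) (V : set (bpt E)),
  [/\ psi (rgerm g0) = 0, forall i, psi (rgerm (g i)) = 0, nbhs v0 V & forall q : bpt E',
    finite_set [set v | [/\ V v, fval (sr_val g0) v = 0, forall i, fval (sr_val (g i)) v = 0 &
                exists2 w : open_sub W, val w = v & F w = q]]].
Proof.
move=> ma e0 eT [u eu].
have [rTh hTh] := lift_source Th.
have [ru hu] := lift_source u.
have /choice[rf0 hf0] l := lift_source (f0 l).
have /choice[rf hf] i : exists r : 'I_J -> regs v0, forall l, psi (rgerm (r l)) = f i l.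
  by have [r hr] := choice (fun l => lift_source (f i l)); exists r.
have /choice[rb /choice[rb' hb]] m := lift_target (b m).
have /choice[rp hp1] i : exists r : nat -> regs q0, exists r' : nat -> regs v0, forall m,
    psi (rgerm (r' m)) = mu (p i m) /\ pulled (r m) (r' m).
  have /choice[r /choice[r' h]] m := lift_target (p i m).
  by exists r, r' => m; case: (h m).
have [rp' hp] := choice hp1.
have /choice[ra /choice[ra' ha]] l := lift_target (a l).
have /choice[rX hX] i : exists r : regs v0, sr_val r = (hval (poly_var A i : ba_ring E) 1 : fun_ring E).
  by apply: regs_of; apply: reg_near_hval; exact: (@sn1_neq0 R E v0).
pose ph : {rmorphism regs v0 -> Lx} := GRing.RMorphism.clone _ _ (psi \o @rgerm R A nA N v0) _.
have pb m : ph (rb' m) = mu (b m) by have [] := hb m.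
have pa l : ph (ra' l) = mu (a l) by have [] := ha l.
have pp i m : ph (rp' i m) = mu (p i m) by have [] := hp i m.
have pTh : ph rTh = Th by [].
have pX i : ph (rX i) = psi (pgerm v0 (poly_var A i)).
  by rewrite /ph /= rgermE hX.
(* The derivative is a unit only in O_x, but a germ killed by psi has value 0 at v0, so the relation
   with its inverse holds between values. *)
have der0 : fval (sr_val (root_derivative n rTh rb')) v0 <> 0.
  have h : ph (root_derivative n rTh rb' * ru - 1) = 0.
    rewrite rmorphB rmorphM rmorph1 (_ : ph ru = u) // rmorph_sum -eu.
    apply/eqP; rewrite subr_eq0; apply/eqP; congr (_ * _).
    by apply: eq_bigr => m _; rewrite rmorphMn rmorphM rmorphXn pb pTh.
  have := psi_eq0 h; rewrite (gvalF_rgerm (root_derivative n rTh rb' * ru - 1)).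
  rewrite (rmorphB (@reval R A nA N v0 v0)) (rmorphM (@reval R A nA N v0 v0)) (rmorph1 (@reval R A nA N v0 v0)).
  move=> h1 h2; move: h1; rewrite /= [reval v0 (root_derivative _ _ _)]h2 mul0r sub0r => /eqP.
  by rewrite oppr_eq0 oner_eq0.
have [V nV fin] := @affine_finite_fibres R A nA N N' W F hF w0 n J rTh rX rf0 rf rb rp ra rb' rp' ra'
  (fun m => let: And3 _ h _ := hb m in h) (fun i m => (hp i m).2) (fun l => let: And3 _ h _ := ha l in h) (fun l => let: And3 _ _ h := ha l in h (ma l)) hX der0.
exists (root_defect n rTh rf0 rb' ra'), (fun i => coord_defect n rTh rX rf rp' ra' i), V; split.
- rewrite -[LHS]/(ph _) rmorphB !rmorph_sum; apply/eqP; rewrite subr_eq0; apply/eqP.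
  transitivity (\sum_(m < n) mu (b m) * Th ^+ m).
    by apply: eq_bigr => m _; rewrite rmorphM rmorphXn pb pTh.
  by rewrite e0; apply: eq_bigr => l _; rewrite rmorphM pa -hf0.
- move=> i; rewrite -[LHS]/(ph _) rmorphB rmorphD !rmorph_sum pX eT; apply/eqP; rewrite subr_eq0; apply/eqP.
  congr (_ + _); apply: eq_bigr => m _; first by rewrite rmorphM rmorphXn pp pTh.
  by rewrite rmorphM pa -hf.
- exact: nV.
- exact: fin.
Qed.
End UnramifiedAffine.

Lemma nbhs_inter (T : topologicalType) (x : T) (I : finType) (A B C D P : set T) (Q : I -> set T) :
  nbhs x A -> nbhs x B -> nbhs x C -> nbhs x D -> nbhs x P -> (forall i, nbhs x (Q i)) ->
  nbhs x [set y | [/\ A y /\ B y, C y, D y, P y & forall i, Q i y]].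
Proof.
move=> nA nB nC nD nP nQ; have n := @filter_forall _ I Q (nbhs x) (nbhs_filter x) nQ.
have h1 : nbhs x (A `&` B `&` (C `&` D)) by apply: filterI; exact: filterI.
have h2 : nbhs x (P `&` [set y | forall i, Q i y]) by exact: filterI.
by apply: filterS2 h1 h2 => y [[? ?] [? ?]] [? ?].
Qed.

Lemma mor_restr_finite (X S : lrs) (f : mor X S) (U : set X) (V : set S)
    (h : forall y, U y -> V (f y)) :
  (forall t, finite_set (U `&` f @^-1` [set t])) ->
  (forall G, closed G -> forall t, V t -> ~ (f @` (U `&` G)) t -> nbhs t (~` (f @` (U `&` G)))) ->
  is_finite_mor (mor_restr h).
Proof.
move=> fin cl; split=> [C cC|v].
  have [Z oZ ZC] : exists2 Z : set X, open Z & val @^-1` Z = ~` C by exact: closed_openC cC.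
  have CE u : C u <-> ~ Z (val u).
    have := congr1 (fun T : set (set_type U) => T u) ZC; rewrite /= => e.
    by rewrite e; split=> [Cu nCu|/contrapT].
  rewrite -[_ @` _]setCK; apply: open_closedC; rewrite openE => v nv; apply/nbhs_set_type.
  have Vv : V (val v) by exact: set_mem (valP v).
  exists (~` (f @` (U `&` ~` Z))).
    apply: cl => //; first exact: open_closedC.
    move=> [y [Uy nZ] fy]; apply: nv; exists (exist _ y (mem_set Uy)); first exact/CE.
    exact: val_inj.
  move=> w nw [u /CE nZ uw]; apply: nw; exists (val u).
    by split=> //; exact: set_mem (valP u).
  by rewrite -uw.
apply: (finite_set_inj_on (F := val) (fin (val v))) => [u uv|u u' _ _]; last exact: val_inj.
split; first exact: set_mem (valP u).
by rewrite /= -uv.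
Qed.

Theorem mainTheorem8 (R : realType) (A : comNzRingType) (nA : A -> R)
    (hA : geometric_base_ring (@NRing R A nA))
    (X S : analytic_space nA) (f : mor X S) (hf : is_analytic_mor f) (x : X) :
  is_unramified f x ->
  isolated (fibre f (f x)) x /\ is_finite_at f x.
Proof.
move=> [hmax [k [K [i [j [bi bj ij sep]]]]]].
have [mf _ li] := hf; have hX := as_lrsP X.
have [c cA cx] := as_cover x; have [d dS ds] := as_cover (f x).
have [W [F [oW hF [hx Wx] compat]]] := li c d cA dS x cx ds.
pose y0 : open_sub (ch_dom c) := open_pt hx.
pose z0 : open_sub (ch_dom d) := open_pt (mem_set ds).
pose w0 : open_sub W := open_pt (mem_set Wx).
have [Fz chi] := compat x hx (mem_set ds) (mem_set Wx).
have locX : is_local (lst x) by case: hX.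
have [n [J [b [p [Th [a [f0 [g [ma e0 eT eu]]]]]]]]] :=
  @unramified_equations (lst (f x)) (lst x) (GRing.RMorphism.clone _ _ (@msf _ _ f x mf) _) k K i j
    locX bi bj ij sep hmax _ (fun l => @chart_ms _ _ _ _ _ c y0 (pgerm (chart_emb y0) (poly_var A l))).
have [g0 [gi [V [r0 ri nV fin]]]] := @unramified_finite_fibres R A nA _ _ W F oW hF w0 (lst (f x)) (lst x)
  (chart_emb z0) (GRing.RMorphism.clone _ _ (@chart_ms _ _ _ _ _ c y0) _)
  (GRing.RMorphism.clone _ _ (@chart_ms _ _ _ _ _ d z0) _)
  (GRing.RMorphism.clone _ _ (@msf _ _ f x mf) _)
  (@chart_ms_surj _ _ _ _ _ c y0) (@chart_ms_eq0 _ _ _ _ _ c hX y0) (@chart_ms_surj _ _ _ _ _ d z0) Fz chi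
  n J b p Th a f0 g ma e0 eT eu.
pose v0 := chart_emb y0; pose tc := chart_tot (c := c) v0; pose td := chart_tot (c := d) (chart_emb z0).
have hD : local_embedding (ch_dom c) tc := chart_local_embedding v0.
have hD' : local_embedding (ch_dom d) td := chart_local_embedding (chart_emb z0).
have tcx : tc x = v0 by exact: (chart_totE v0 y0).
(* On X the defects vanish near x, so a whole neighbourhood of x, read in the chart, consists of
   solutions of the equations. *)
pose B y := [/\ ch_dom c y /\ ch_dom d (f y), W (tc y), V (tc y), fval (sr_val g0) (tc y) = 0 &
  forall l, fval (sr_val (gi l)) (tc y) = 0].
have nW : nbhs v0 W by apply: open_nbhs_nbhs.
have cx' Q : nbhs v0 Q -> nbhs x (tc @^-1` Q).
  by move=> nQ; apply: (le_cont hD cx); rewrite tcx.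
have nB : nbhs x B.
  have n1 : nbhs x (f @^-1` ch_dom d).
    by have [cf _ _ _] := mf; apply: cf; exact: (le_nbhs hD').
  exact: (@nbhs_inter (lpt X) x _ _ _ _ _ _ _ (le_nbhs hD cx) n1 (cx' _ nW) (cx' _ nV)
    (@chart_vanish _ _ _ _ _ c hX v0 y0 _ r0) (fun l => @chart_vanish _ _ _ _ _ c hX v0 y0 _ (ri l))).
have finB t : finite_set (B `&` f @^-1` [set t]).
  apply: (finite_set_inj_on (F := tc) (fin (td t))); last first.
    by move=> y y' [[[Dy _] _ _ _ _] _] [[[Dy' _] _ _ _ _] _]; exact: (le_inj hD).
  move=> y [[[Dy Dfy] Wy Vy g0y gy] fy]; split; [exact: Vy|exact: g0y|exact: gy|].
  have [y' yy'] := chart_ptP (c := c) Dy.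
  have ty : tc y = chart_emb y' by rewrite -yy' /tc chart_totE.
  have hc : y \in ch_dom c by rewrite inE.
  have hd : f y \in ch_dom d by rewrite inE.
  have ty' : tc y = chart_emb (open_pt hc : open_sub (ch_dom c)).
    exact: (chart_totE v0 (open_pt hc : open_sub (ch_dom c))).
  have hw : ch_emb c (open_pt hc) \in W by rewrite inE; rewrite ty' in Wy.
  have [Fw _] := compat y hc hd hw.
  exists (open_pt hw); first exact: (esym ty').
  rewrite Fw -fy; exact: (esym (chart_totE (chart_emb z0) (open_pt hd : open_sub (ch_dom d)))).
have [iso [U [V' [oU oV' Ux UV [finU clU]]]]] := finite_fibres_closed hD hD' (@bpt_hausdorff _ _) (@bpt_hausdorff _ _)
  (compact_in_nbhs (@aff_loc_compact R A nA _)) (let: And4 h _ _ _ := mf in h) cx ds nB finB.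
split; first exact: iso.
have h y : U y -> V' (f y) by move=> Uy; apply: UV; exists y.
by exists U, V', h; split=> //; exact: mor_restr_finite.
Qed.
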